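(* Let $(M,\nabla,h)$ be a K-V manifold and let $N\subset M$ be a coisotropic K-V submanifold. Then $(TN^\circ,N,\bullet,\rho)$ is a left symmetric algebroid, where $\alpha\bullet\beta=\mathcal{D}_\alpha\beta$ for $\alpha,\beta\in\Gamma(TN^\circ)$ and $\rho:TN^\circ\to TN$ is the restriction of $h_\#$ to the subbundle $TN^\circ\subset T^*_NM$. Moreover, for any $x\in N$, the vector space $\mathfrak{g}_x=\ker\rho_x$ (with the product induced by $\bullet$) is a commutative associative algebra.
   Context: An affine manifold $(M,\nabla)$ is a manifold with a flat torsion-free connection $\nabla$ on $TM$. For a symmetric bivector field $h$ on $M$, let $h_\#:T^*M\to TM$, $\alpha\mapsto\alpha^\#$, be defined by $\beta(\alpha^\#)=h(\alpha,\beta)$. The triple $(M,\nabla,h)$ is a Koszul-Vinberg (K-V) manifold if $(\nabla_{\alpha^\#}h)(\beta,\gamma)=(\nabla_{\beta^\#}h)(\alpha,\gamma)$ for all $\alpha,\beta,\gamma\in\Omega^1(M)$. The contravariant connection $\mathcal{D}:\Omega^1(M)\times\Omega^1(M)\to\Omega^1(M)$ is given by $$(\mathcal{D}_\alpha\beta)(X)=(\nabla_Xh)(\alpha,\beta)+(\nabla_{\alpha^\#}\beta)(X),\qquad X\in\Gamma(TM).$$ An affine submanifold $N$ of $(M,\nabla)$ is a submanifold with a flat torsion-free connection such that the inclusion maps geodesics to geodesics; equivalently, parallel transport of $M$ along curves in $N$ preserves $TN$. $T_N^*M$ is the restriction of $T^*M$ to $N$ and $TN^\circ\subset T^*_NM$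 is the annihilator of $TN$. A coisotropic K-V submanifold is an affine submanifold $N\subset M$ with $h_\#(TN^\circ)\subset TN$. For $\alpha,\beta\in\Gamma(TN^\circ)$, $\mathcal{D}_\alpha\beta$ means the restriction to $N$ of $\mathcal{D}_{\tilde\alpha}\tilde\beta$ for (local) extensions $\tilde\alpha,\tilde\beta\in\Omega^1(M)$ of $\alpha,\beta$; part of the claim is that this is a well-defined section of $TN^\circ$. A left symmetric algebroid $(A,N,\bullet,\rho)$ is a vector bundle $A\to N$ with a bundle map (anchor) $\rho:A\to TN$ and an $\mathbb{R}$-bilinear product $\bullet$ on $\Gamma(A)$ such that for $a,b,c\in\Gamma(A)$, $f\in C^\infty(N)$: $(fa)\bullet b=f(a\bullet b)$, $a\bullet(fb)=f(a\bullet b)+\rho(a)(f)\,b$, and $\mathrm{ass}(a,b,c)=\mathrm{ass}(b,a,c)$ where $\mathrm{ass}(a,b,c)=(a\bullet b)\bullet c-a\bullet(b\bullet c)$. The product induced on $\ker\rho_x$ is $a\bullet b:=(\tilde a\bullet\tilde b)(x)$ for any sections $\tilde a,\tilde b$ of $A$ with $\tilde a(x)=a$, $\tilde b(x)=b$. *)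

(* Defs.v *)
From HB Require Import structures.
From mathcomp Require Import all_boot all_order all_algebra.
From mathcomp Require Import all_classical all_reals all_analysis.

Set Implicit Arguments.
Unset Strict Implicit.
Unset Printing Implicit Defensive.

Import Order.TTheory GRing.Theory Num.Theory numFieldNormedType.Exports.

Local Open Scope classical_set_scope.
Local Open Scope ring_scope.

(* Conventions. A section, vector field or form over an open set [U] is a total
   function of the base point; only its restriction to [U] is constrained. The
   fibres of tangent and cotangent bundles are linear subspaces of fixed
   function spaces, and their elements vanish on irrelevant arguments, so that
   Leibniz equality in these function spaces is equality in the fibre. *)

Section Euclidean.
Variable R : realType.

Definition pderiv n (i : 'I_n) (f : 'rV[R]_n -> R) : 'rV[R]_n -> R :=
  fun u => 'D_(delta_mx 0 i) f u.

(* C^oo on a neighbourhood of [u]. *)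
Definition smooth_at n (f : 'rV[R]_n -> R) (u : 'rV[R]_n) : Prop :=
  \forall v \near u, forall s : seq 'I_n,
    differentiable (foldr (@pderiv n) f s) v.

Definition smooth1_at (g : R -> R) (t : R) : Prop :=
  \forall s \near t, forall j : nat, derivable (derive1n j g) s 1.

End Euclidean.

Record chart (R : realType) (M : topologicalType) (n : nat) := Chart {
  source : set M;
  target : set 'rV[R]_n;
  coord : M -> 'rV[R]_n;
  uncoord : 'rV[R]_n -> M;
  open_source : open source;
  open_target : open target;
  coord_target : forall x, source x -> target (coord x);
  uncoord_source : forall u, target u -> source (uncoord u);
  coordK : forall x, source x -> uncoord (coord x) = x;
  uncoordK : forall u, target u -> coord (uncoord u) = u;
  coord_continuous : forall x, source x -> {for x, continuous coord};
  uncoord_continuous : forall u, target u -> {for u, continuous uncoord}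
}.

Definition smooth_transition (R : realType) (M : topologicalType) n
    (c c' : chart R M n) : Prop :=
  forall u, target c u -> source c' (uncoord c u) ->
  forall i, smooth_at (fun v => coord c' (uncoord c v) 0 i) u.

Definition compatible (R : realType) (M : topologicalType) n
    (c c' : chart R M n) : Prop :=
  smooth_transition c c' /\ smooth_transition c' c.

Record manifold (R : realType) (n : nat) := Manifold {
  points :> topologicalType;
  atlas : set (chart R points n);
  manifold_hausdorff : hausdorff_space points;
  manifold_second_countable : @second_countable points;
  atlas_covers : forall x, exists2 c, atlas c & source c x;
  atlas_compatible : forall c c', atlas c -> atlas c' -> compatible c c';
  atlas_maximal : forall c, (forall c', atlas c' -> compatible c c') -> atlas c
}.

Section Tensors.
Variables (R : realType) (n : nat) (M : manifold R n).

Definition smooth_near (f : M -> R) (x : M) : Prop :=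
  forall c, @atlas R n M c -> source c x -> smooth_at (f \o uncoord c) (coord c x).

Definition smooth (U : set M) (f : M -> R) : Prop :=
  forall x, U x -> smooth_near f x.

(* Tangent vectors at [x] are derivations on germs at [x] of smooth functions;
   they are set to 0 on functions that are not smooth near [x]. *)
Definition tvec : lmodType R := ((M -> R) -> R).

(* The derivation sum_i w_i d/dx^i at [x] of the chart [c]. *)
Definition coord_vec (c : chart R M n) (w : 'rV[R]_n) (x : M) : tvec :=
  fun f => if `[< smooth_near f x >] then 'D_w (f \o uncoord c) (coord c x)
           else 0.

Definition tangent (x : M) : set tvec :=
  [set v | exists c w, [/\ @atlas R n M c, source c x & v = coord_vec c w x]].

Definition covec : lmodType R := (tvec -> R).

Definition cotangent (x : M) : set covec :=
  [set b | (forall r v w, tangent x v -> tangent x w ->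
             b (r *: v + w) = r * b v + b w) /\
           (forall v, ~ tangent x v -> b v = 0)].

Definition act (X : M -> tvec) (f : M -> R) : M -> R := fun x => X x f.

(* Gamma(U, TM) *)
Definition vfield (U : set M) : set (M -> tvec) :=
  [set X | forall x, U x ->
     tangent x (X x) /\ forall f, smooth_near f x -> smooth_near (act X f) x].

Definition pairing (alpha : M -> covec) (X : M -> tvec) : M -> R :=
  fun x => alpha x (X x).

(* Omega^1(U) *)
Definition oneform (U : set M) : set (M -> covec) :=
  [set alpha | (forall x, U x -> cotangent x (alpha x)) /\
     forall V X, open V -> V `<=` U -> vfield V X -> smooth V (pairing alpha X)].

Definition lie (X Y : M -> tvec) : M -> tvec :=
  fun x f => if `[< smooth_near f x >] then X x (act Y f) - Y x (act X f)
             else 0.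

(* A vector field with value [v] at [x]; used only to evaluate at [v]
   expressions that are C^oo-linear in a vector field. *)
Definition extend (x : M) (v : tvec) : M -> tvec :=
  xget (0 : M -> tvec) [set X | vfield setT X /\ X x = v].

End Tensors.

Arguments tangent {R n M} x.
Arguments cotangent {R n M} x.
Arguments vfield {R n M} U.
Arguments oneform {R n M} U.

Section Connections.
Variables (R : realType) (n : nat) (M : manifold R n).

Definition connection_op : Type := (M -> tvec M) -> (M -> tvec M) -> (M -> tvec M).

(* A connection on TM, as an operator on sections over every open subset. *)
Record is_connection (nabla : connection_op) : Prop := {
  nabla_vfield : forall U X Y, open U -> vfield U X -> vfield U Y ->
    vfield U (nabla X Y);
  nabla_local : forall U X X' Y Y', open U ->
    vfield U X -> vfield U Y -> vfield U X' -> vfield U Y' ->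
    (forall x, U x -> X x = X' x) -> (forall x, U x -> Y x = Y' x) ->
    forall x, U x -> nabla X Y x = nabla X' Y' x;
  nabla_linearl : forall U f X X' Y, open U -> smooth U f ->
    vfield U X -> vfield U X' -> vfield U Y ->
    forall x, U x ->
    nabla (fun y => f y *: X y + X' y) Y x = f x *: nabla X Y x + nabla X' Y x;
  nabla_additiver : forall U X Y Y', open U ->
    vfield U X -> vfield U Y -> vfield U Y' ->
    forall x, U x -> nabla X (fun y => Y y + Y' y) x = nabla X Y x + nabla X Y' x;
  nabla_leibniz : forall U f X Y, open U -> smooth U f ->
    vfield U X -> vfield U Y ->
    forall x, U x ->
    nabla X (fun y => f y *: Y y) x = f x *: nabla X Y x + X x f *: Y x
}.

Definition torsion_free (nabla : connection_op) : Prop :=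
  forall U X Y, open U -> vfield U X -> vfield U Y ->
  forall x, U x -> nabla X Y x - nabla Y X x = lie X Y x.

Definition flat (nabla : connection_op) : Prop :=
  forall U X Y Z, open U -> vfield U X -> vfield U Y -> vfield U Z ->
  forall x, U x ->
  nabla X (nabla Y Z) x - nabla Y (nabla X Z) x - nabla (lie X Y) Z x = 0.

Definition affine_manifold (nabla : connection_op) : Prop :=
  [/\ is_connection nabla, flat nabla & torsion_free nabla].

Definition christoffel (nabla : connection_op) (c : chart R M n)
    (i j k : 'I_n) (x : M) : R :=
  nabla (coord_vec c (delta_mx 0 i)) (coord_vec c (delta_mx 0 j)) x
    (fun y => coord c y 0 k).

Definition smooth_curve (I : set R) (gamma : R -> M) : Prop :=
  forall t, I t -> forall f, smooth_near f (gamma t) ->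
  smooth1_at (f \o gamma) t.

Definition geodesic (nabla : connection_op) (I : set R) (gamma : R -> M) : Prop :=
  smooth_curve I gamma /\
  forall t c, I t -> @atlas R n M c -> source c (gamma t) ->
  let g i := fun s => coord c (gamma s) 0 i in
  forall k, derive1n 2 (g k) t +
    \sum_i \sum_j christoffel nabla c i j k (gamma t)
                  * derive1n 1 (g i) t * derive1n 1 (g j) t = 0.

End Connections.

Section KoszulVinberg.
Variables (R : realType) (n : nat) (M : manifold R n).
Variables (nabla : connection_op M) (h : M -> covec M -> covec M -> R).

Record symmetric_bivector : Prop := {
  bivector_sym : forall x a b, cotangent x a -> cotangent x b ->
    h x a b = h x b a;
  bivector_linear : forall x r a a' b,
    cotangent x a -> cotangent x a' -> cotangent x b ->
    h x (r *: a + a') b = r * h x a b + h x a' b;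
  bivector_smooth : forall U alpha beta, open U ->
    oneform U alpha -> oneform U beta ->
    smooth U (fun x => h x (alpha x) (beta x))
}.

Definition sharp (x : M) (a : covec M) : tvec M :=
  xget 0 [set v | tangent x v /\ forall b, cotangent x b -> b v = h x a b].

Definition sharp_form (alpha : M -> covec M) : M -> tvec M :=
  fun x => sharp x (alpha x).

(* (nabla_X alpha)(Y) = X(alpha(Y)) - alpha(nabla_X Y) *)
Definition nabla_form (X : M -> tvec M) (alpha : M -> covec M) : M -> covec M :=
  fun x v => if `[< tangent x v >]
             then X x (pairing alpha (extend x v))
                  - alpha x (nabla X (extend x v) x)
             else 0.

Definition nabla_h (X : M -> tvec M) (alpha beta : M -> covec M) : M -> R :=
  fun x => X x (fun y => h y (alpha y) (beta y))
           - h x (nabla_form X alpha x) (beta x)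
           - h x (alpha x) (nabla_form X beta x).

Definition kv_manifold : Prop :=
  [/\ affine_manifold nabla, symmetric_bivector &
      forall alpha beta gamma,
        oneform setT alpha -> oneform setT beta -> oneform setT gamma ->
        nabla_h (sharp_form alpha) beta gamma
        = nabla_h (sharp_form beta) alpha gamma].

(* (D_alpha beta)(X) = (nabla_X h)(alpha, beta) + (nabla_{alpha^#} beta)(X) *)
Definition contravariant (alpha beta : M -> covec M) : M -> covec M :=
  fun x v => if `[< tangent x v >]
             then nabla_h (extend x v) alpha beta x
                  + nabla_form (sharp_form alpha) beta x v
             else 0.

End KoszulVinberg.

Section Submanifolds.
Variables (R : realType) (k m : nat).
Variables (M : manifold R (k + m)) (N : manifold R k) (iota : N -> M).

(* [iota] identifies [N] with an embedded submanifold: [M] has charts around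
   the points of [N] in which [N] is the slice given by the vanishing of the
   last [m] coordinates, and the first [k] coordinates are charts of [N]. *)
Definition submanifold : Prop :=
  injective iota /\
  forall y, exists c d,
    [/\ @atlas R _ M c /\ source c (iota y),
        @atlas R _ N d,
        source d = iota @^-1` source c,
        forall z, source d z -> coord c (iota z) = row_mx (coord d z) 0 &
        forall x, source c x -> rsubmx (coord c x) = 0 -> range iota x].

Definition push (y : N) (u : tvec N) : tvec M :=
  fun f => if `[< smooth_near f (iota y) >] then u (f \o iota) else 0.

(* The annihilator TN° at [y], a subspace of the cotangent space of M. *)
Definition ann (y : N) : set (covec M) :=
  [set a | cotangent (iota y) a /\ forall u, tangent y u -> a (push y u) = 0].

(* Gamma(U, TN°) *)
Definition ann_section (U : set N) : set (N -> covec M) :=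
  [set alpha | (forall y, U y -> ann y (alpha y)) /\
     forall V X, open V -> vfield V X ->
       forall y, U y -> V (iota y) ->
       smooth_near (fun z => alpha z (X (iota z))) y].

Definition affine_submanifold (nabla : connection_op M) : Prop :=
  submanifold /\
  exists nablaN : connection_op N, affine_manifold nablaN /\
    forall (I : set R) gamma, open I -> is_interval I ->
      geodesic nablaN I gamma -> geodesic nabla I (iota \o gamma).

Definition coisotropic_kv_submanifold (nabla : connection_op M)
    (h : M -> covec M -> covec M -> R) : Prop :=
  affine_submanifold nabla /\
  forall y a, ann y a ->
    exists2 u, tangent y u & push y u = sharp h (iota y) a.

(* h_# on TN°, corestricted to TN: the vector of N whose image is [sharp a]. *)
Definition ann_anchor (h : M -> covec M -> covec M -> R)
    (y : N) (a : covec M) : tvec N :=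
  xget 0 [set u | tangent y u /\ push y u = sharp h (iota y) a].

Definition extends_form (U : set M) (alphat : M -> covec M)
    (alpha : N -> covec M) : Prop :=
  oneform U alphat /\ forall z, U (iota z) -> alphat (iota z) = alpha z.

(* [bullet alpha beta] is the restriction to [N] of [D alphat betat], for all
   local extensions [alphat] and [betat], and there are such extensions. *)
Definition restricted_contravariant (nabla : connection_op M)
    (h : M -> covec M -> covec M -> R)
    (bullet : (N -> covec M) -> (N -> covec M) -> (N -> covec M)) : Prop :=
  forall alpha beta, ann_section setT alpha -> ann_section setT beta ->
  forall y,
    (exists U alphat betat, [/\ open U, U (iota y),
       extends_form U alphat alpha & extends_form U betat beta]) /\
    (forall U alphat betat, open U -> U (iota y) ->
       extends_form U alphat alpha -> extends_form U betat beta ->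
       contravariant nabla h alphat betat (iota y) = bullet alpha beta y).

End Submanifolds.

Section Algebroids.
Variables (R : realType) (n : nat) (N : manifold R n) (E : lmodType R).
(* A bundle whose fibres are subspaces of [E]: [sec U] are the smooth sections
   over [U]. *)
Variables (fib : N -> set E) (sec : set N -> set (N -> E)).

Definition subspace (V : set E) : Prop :=
  V 0 /\ forall r a b, V a -> V b -> V (r *: a + b).

(* The smooth sections form a sheaf, and near every point there is a smooth
   frame: a basis of each fibre such that a section is smooth if and only if
   its coefficients are. *)
Record vector_bundle : Prop := {
  fib_subspace : forall y, subspace (fib y);
  sec_local : forall U s, open U ->
    sec U s <->
    forall y, U y -> exists V, [/\ open V, V y, V `<=` U & sec V s];
  sec_frame : forall y, exists W (r : nat) (e : 'I_r -> N -> E),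
    [/\ open W, W y,
        forall z, W z -> forall a,
          fib z a <-> exists l : 'I_r -> R, a = \sum_i l i *: e i z,
        forall z, W z -> forall l : 'I_r -> R,
          \sum_i l i *: e i z = 0 -> forall i, l i = 0 &
        forall U s, open U -> U `<=` W ->
          sec U s <->
          exists l : 'I_r -> N -> R, (forall i, smooth U (l i)) /\
            forall z, U z -> s z = \sum_i l i z *: e i z]
}.

Variables (anchor : N -> E -> tvec N).
Variables (bullet : (N -> E) -> (N -> E) -> (N -> E)).

Record bundle_map_to_tangent : Prop := {
  anchor_tangent : forall y a, fib y a -> tangent y (anchor y a);
  anchor_linear : forall y r a b, fib y a -> fib y b ->
    anchor y (r *: a + b) = r *: anchor y a + anchor y b;
  anchor_smooth : forall U s, open U -> sec U s ->
    vfield U (fun y => anchor y (s y))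
}.

Definition ass (a b c : N -> E) : N -> E :=
  bullet (bullet a b) c - bullet a (bullet b c).

Record left_symmetric_algebroid : Prop := {
  lsa_bundle : vector_bundle;
  lsa_anchor : bundle_map_to_tangent;
  lsa_closed : forall a b, sec setT a -> sec setT b -> sec setT (bullet a b);
  lsa_linearl : forall (r : R) a a' b,
    sec setT a -> sec setT a' -> sec setT b ->
    bullet (r *: a + a') b = r *: bullet a b + bullet a' b;
  lsa_linearr : forall (r : R) a b b',
    sec setT a -> sec setT b -> sec setT b' ->
    bullet a (r *: b + b') = r *: bullet a b + bullet a b';
  lsa_scalel : forall f a b, smooth setT f -> sec setT a -> sec setT b ->
    bullet (fun y => f y *: a y) b = (fun y => f y *: bullet a b y);
  lsa_leibniz : forall f a b, smooth setT f -> sec setT a -> sec setT b ->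
    bullet a (fun y => f y *: b y)
    = (fun y => f y *: bullet a b y + anchor y (a y) f *: b y);
  lsa_ass : forall a b c, sec setT a -> sec setT b -> sec setT c ->
    ass a b c = ass b a c
}.

Definition isotropy (x : N) : set E := [set a | fib x a /\ anchor x a = 0].

Definition induced_product (x : N) (mul : E -> E -> E) : Prop :=
  forall a b, isotropy x a -> isotropy x b ->
    (exists s t, [/\ sec setT s, sec setT t, s x = a & t x = b]) /\
    (forall s t, sec setT s -> sec setT t -> s x = a -> t x = b ->
       mul a b = bullet s t x).

Record commutative_associative_algebra (V : set E) (mul : E -> E -> E) : Prop := {
  caa_subspace : subspace V;
  caa_closed : forall a b, V a -> V b -> V (mul a b);
  caa_linear : forall r a a' b, V a -> V a' -> V b ->
    mul (r *: a + a') b = r *: mul a b + mul a' b;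
  caa_comm : forall a b, V a -> V b -> mul a b = mul b a;
  caa_assoc : forall a b c, V a -> V b -> V c -> mul a (mul b c) = mul (mul a b) c
}.

End Algebroids.

(* Main.v *)
(* The condition (nabla_a# h)(b, c) = (nabla_b# h)(a, c) gives (D_a b)# = nabla_a# b#.
   Writing D_a b = nabla_a# b + S(a, b) with S(a, b)(X) = (nabla_X h)(a, b), and
   differentiating the condition along X, the flatness of nabla yields
   [D_a, D_b] = D_(D_a b - D_b a), which is the left symmetry of D on M.

   Let a, b be sections of TN°. The first and last terms of
   (D_a b)(X) = (nabla_X h)(a, b) + a#(b(X)) - b(nabla_a# X)
   are tensorial, and the middle one is a derivative along N because a# is tangent
   to N; so D_a b depends on a and b along N only. It lies in TN° because nabla
   preserves TN along N: in a slice chart, the geodesics of N are geodesics of M with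
   vanishing normal coordinates, whence the Christoffel symbols with two tangential
   lower indices and a normal upper one vanish on N.

   On the kernel of the anchor, (D_a b)(X) = (nabla_X h)(a, b), which is symmetric;
   a commutative left symmetric product is associative. *)
Require Import Defs.
From mathcomp Require Import all_boot all_order all_algebra.
From mathcomp Require Import all_classical all_reals all_analysis.
From mathcomp Require Import ring lra.
(* [Defs.coord] is shadowed by [vector.coord]. *)
Import Defs.
Set Implicit Arguments.
Unset Strict Implicit.
Unset Printing Implicit Defensive.
Import Order.TTheory GRing.Theory Num.Theory numFieldNormedType.Exports.
Local Open Scope classical_set_scope.
Local Open Scope ring_scope.

(** The relation between [N] and [M] is given only through geodesics. Extracting a pointwise
    statement on Christoffel symbols requires a geodesic of [N] with arbitrary initial velocity, and
    [geodesic] demands the equation in every chart. Hence the Picard iteration, the smoothness of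
    integral curves, and the Hessian, whose tensoriality carries the equation from one chart to
    another. Another obstacle is that [nabla_form], [nabla_h] and [contravariant] are defined
    through the arbitrary global field [extend], while the K-V condition is assumed for global
    forms. Each expression is shown to be local and linear over smooth functions; with local frames,
    this makes it depend on values at the point only. Bump functions supply global fields and forms
    with prescribed values. The product on [N] is defined pointwise by choosing local extensions.
    Iterated products are accessible because [contravariant] of two extensions is again an extension
    of the product, so that left symmetry on [N] is the restriction of left symmetry on [M]. *)

Lemma near_forall (T : topologicalType) p (P : 'I_p -> T -> Prop) (t : T) :
  (forall i, \forall s \near t, P i s) -> \forall s \near t, forall i, P i s.
Proof. exact: filter_forall. Qed.

(** * Smooth functions on Euclidean space *)

Section EuclideanSmooth.
Variable R : realType.

(** The difference [g - f] vanishes near [x], so its expansion there has zero linear part; [g] is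
    the sum of [f] and this difference. *)
Lemma near_eq_differentiable (V W : normedModType R) (f g : V -> W) (x : V) :
  {near x, f =1 g} -> differentiable f x -> differentiable g x.
Proof.
move=> fg df; have -> : g = f + (g - f) by rewrite addrC subrK.
apply: differentiableD => //.
have z0 : {near x, g - f =1 cst 0}.
  by near=> y; rewrite !fctE (near fg y)// subrr.
have fact : (g - f) \o shift x = cst ((g - f) x) + \0 +o_ 0 id.
  apply/eqaddoP => e e0; rewrite /= (nbhs_singleton z0).
  have : \forall y \near (0 : V), (g - f) (y + x) = 0.
    by have := z0; rewrite (near_shift (0 : V)) /= subr0.
  apply: filterS => y Hy; rewrite !fctE /= in Hy *.
  by rewrite Hy addr0 subr0 normr0 mulr_ge0// ltW.
apply/diff_locallyP.
have -> : 'd (g - f) x = \0 :> (V -> W).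
  by apply: diff_unique fact; exact: cst_continuous.
by split=> //; exact: cst_continuous.
Unshelve. all: by end_near. Qed.

Lemma pderiv_near_eq n (i : 'I_n) (f g : 'rV[R]_n -> R) (u : 'rV[R]_n) :
  {near u, f =1 g} -> {near u, pderiv i f =1 pderiv i g}.
Proof.
move=> /near_join; apply: filterS => v fg; exact: near_eq_derive.
Qed.

Lemma near_eq_smooth_at n (f g : 'rV[R]_n -> R) (u : 'rV[R]_n) :
  {near u, f =1 g} -> smooth_at f u -> smooth_at g u.
Proof.
move=> /near_join fg sf; near=> v => s.
have fgv : {near v, f =1 g} by near: v.
apply: near_eq_differentiable (_ : differentiable (foldr (@pderiv R n) f s) v).
  by elim: s => //= i s IH; exact: pderiv_near_eq.
by move: s; near: v.
Unshelve. all: by end_near. Qed.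

Lemma smooth_at_near n (f : 'rV[R]_n -> R) u :
  smooth_at f u -> \forall v \near u, smooth_at f v.
Proof. exact: near_join. Qed.

Lemma smooth_at_differentiable n (f : 'rV[R]_n -> R) u :
  smooth_at f u -> differentiable f u.
Proof. by move=> /nbhs_singleton /(_ [::]). Qed.

Lemma smooth_at_pderiv n (i : 'I_n) (f : 'rV[R]_n -> R) u :
  smooth_at f u -> smooth_at (pderiv i f) u.
Proof.
by apply: filterS => v sf s; have := sf (rcons s i); rewrite foldr_rcons.
Qed.

(** A coinduction principle: iterated partial derivatives never leave the class [P], all of whose
    members are differentiable on [U]. Smoothness thus reduces to finding a class closed under
    [pderiv]. *)
Lemma smooth_at_coind n (U : set 'rV[R]_n) (P : ('rV[R]_n -> R) -> Prop) :
  open U ->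
  (forall f, P f -> forall u, U u -> differentiable f u) ->
  (forall f i, P f -> P (pderiv i f)) ->
  forall f, P f -> forall u, U u -> smooth_at f u.
Proof.
move=> oU dP pP f Pf u Uu.
have Us : \forall v \near u, U v by exact: open_nbhs_nbhs.
apply: filterS Us => v Uv s; apply: dP Uv.
by elim: s => //= i s; exact: pP.
Qed.

Lemma pderiv_cst n (i : 'I_n) (r : R) : pderiv i (cst r) = cst 0.
Proof. by apply/funext => u; exact: derive_cst. Qed.

Lemma smooth_at_cst n (r : R) (u : 'rV[R]_n) : smooth_at (cst r) u.
Proof.
apply: (@smooth_at_coind n setT (fun f => exists s, f = cst s)) => //.
- exact: openT.
- by move=> _ [s ->] v _; exact: differentiable_cst.
- by move=> _ i [s ->]; exists 0; rewrite pderiv_cst.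
- by exists r.
Qed.

Lemma deriv_coord n (j : 'I_n) (w u : 'rV[R]_n) :
  'D_w (fun v : 'rV[R]_n => v 0 j) u = w 0 j.
Proof.
have := @derive_mx R _ 1 n (id : 'rV[R]_n -> 'rV[R]_n) u w (@derivable_id _ _ u w).
by rewrite derive_id => /rowP/(_ j); rewrite !mxE.
Qed.

Lemma smooth_at_coord n (j : 'I_n) (u : 'rV[R]_n) :
  smooth_at (fun v : 'rV[R]_n => v 0 j) u.
Proof.
apply: (@smooth_at_coind n setT (fun f => (exists s, f = cst s) \/
   f = (fun v => v 0 j))) => //.
- exact: openT.
- move=> _ [[s ->] v _|-> v _]; first exact: differentiable_cst.
  exact: differentiable_coord.
- move=> _ i [[s ->]|->]; left; first by exists 0; rewrite pderiv_cst.
  exists ((delta_mx 0 i : 'rV[R]_n) 0 j); apply/funext => v; exact: deriv_coord.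
- by right.
Qed.

Lemma derive_pderiv n (f : 'rV[R]_n -> R) u w : differentiable f u ->
  'D_w f u = \sum_i w 0 i * pderiv i f u.
Proof.
move=> df; rewrite deriveE // {1}(row_sum_delta w) linear_sum.
by apply: eq_bigr => i _; rewrite linearZ /pderiv deriveE.
Qed.

Lemma differentiable_row (V : normedModType R) n (g : V -> 'rV[R]_n) u :
  (forall j, differentiable (fun v => g v 0 j) u) -> differentiable g u.
Proof.
move=> dg.
have -> : g = \sum_j (fun v => g v 0 j *: delta_mx 0 j).
  by apply/funext => v; rewrite fct_sumE {1}(row_sum_delta (g v)).
by apply: differentiable_sum => j; exact: differentiableZl.
Qed.

Lemma derive_comp_row (V : normedModType R) n (f : 'rV[R]_n -> R)
    (g : V -> 'rV[R]_n) u w :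
  differentiable f (g u) -> (forall j, differentiable (fun v => g v 0 j) u) ->
  'D_w (f \o g) u = \sum_j 'D_w (fun v => g v 0 j) u * pderiv j f (g u).
Proof.
move=> df dg; have dg' := differentiable_row dg.
rewrite deriveE; last exact: differentiable_comp.
rewrite diff_comp //= -deriveE // -deriveE // derive_mx; last first.
  exact: diff_derivable.
by rewrite derive_pderiv //; apply: eq_bigr => j _; rewrite mxE.
Qed.

(* Stable under partial derivatives by the product and chain rules, so that its
   members are smooth by [smooth_at_coind]. *)
Inductive generated n (U : set 'rV[R]_n) : ('rV[R]_n -> R) -> Prop :=
| GenExt f g of generated U f & (forall u, U u -> f u = g u) : generated U g
| GenSmooth f of (forall u, U u -> smooth_at f u) : generated U f
| GenAdd f g of generated U f & generated U g : generated U (f + g)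
| GenMul f g of generated U f & generated U g : generated U (f * g)
| GenComp p (f : 'rV[R]_p -> R) (g : 'rV[R]_n -> 'rV[R]_p) of
    (forall u, U u -> smooth_at f (g u)) &
    (forall j u, U u -> smooth_at (fun v => g v 0 j) u) : generated U (f \o g).

Lemma generated_sum n (U : set 'rV[R]_n) p (F : 'I_p -> 'rV[R]_n -> R) :
  (forall j, generated U (F j)) -> generated U (\sum_j F j).
Proof.
move=> HF; apply: big_ind => //; last by move=> f g; exact: GenAdd.
by apply: GenSmooth => u _; exact: smooth_at_cst.
Qed.

Lemma generated_smooth n (U : set 'rV[R]_n) f : open U -> generated U f ->
  forall u, U u -> smooth_at f u.
Proof.
move=> oU.
have near_U u : U u -> \forall v \near u, U v by move=> ?; exact: open_nbhs_nbhs.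
(* Differentiability is settled for the whole class beforehand, because the product and chain rules
   below need it for the constituents. *)
have dgen : forall f, generated U f -> forall u, U u -> differentiable f u.
  move=> {}f; elim=> {f}.
  - move=> f g _ df fg u Uu; apply: near_eq_differentiable (df _ Uu).
    by apply: filterS (near_U _ Uu).
  - by move=> f sf u /sf /smooth_at_differentiable.
  - by move=> f g _ df _ dg u Uu; apply: differentiableD; auto.
  - by move=> f g _ df _ dg u Uu; apply: differentiableM; auto.
  - move=> p f g sf sg u Uu; apply: differentiable_comp.
      by apply: differentiable_row => j; apply: smooth_at_differentiable; auto.
    by apply: smooth_at_differentiable; auto.
apply: smooth_at_coind => // {}f i; elim=> {f}.
- move=> f g _ df fg; apply: GenExt df _ => u Uu; apply: near_eq_derive.
  by apply: filterS (near_U _ Uu).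
- by move=> f sf; apply: GenSmooth => u /sf; exact: smooth_at_pderiv.
- move=> f g gf pf gg pg; apply: GenExt (GenAdd pf pg) _ => u Uu.
  rewrite /pderiv deriveD //; apply: diff_derivable; exact: dgen Uu.
- move=> f g gf pf gg pg.
  apply: GenExt (GenAdd (GenMul gf pg) (GenMul gg pf)) _ => u Uu.
  rewrite /pderiv deriveM //; apply: diff_derivable; exact: dgen Uu.
- move=> p f g sf sg.
  apply: (@GenExt _ _ (\sum_j pderiv i (fun v => g v 0 j) * (pderiv j f \o g))).
    apply: generated_sum => j; apply: GenMul.
      by apply: GenSmooth => u Uu; apply: smooth_at_pderiv; auto.
    by apply: GenComp => // u Uu; apply: smooth_at_pderiv; auto.
  move=> u Uu; rewrite fct_sumE /pderiv derive_comp_row //.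
    by apply: smooth_at_differentiable; auto.
  by move=> j; apply: smooth_at_differentiable; auto.
Qed.

(** The coinduction works on an open set, whereas smoothness at a point yields a neighbourhood; the
    interior of [P] mediates. *)
Lemma generated_smooth_at n (P : set 'rV[R]_n) f u :
  nbhs u P -> (forall U, U `<=` P -> generated U f) -> smooth_at f u.
Proof.
move=> Pu gf; apply: (@generated_smooth _ (P°)) => //; first exact: open_interior.
by apply: gf; exact: interior_subset.
Qed.

Lemma smooth_atD n (f g : 'rV[R]_n -> R) (u : 'rV[R]_n) :
  smooth_at f u -> smooth_at g u -> smooth_at (fun v => f v + g v) u.
Proof.
move=> /smooth_at_near sf /smooth_at_near sg.
apply: (generated_smooth_at (filterI sf sg)) => U UP.
by apply: GenAdd; apply: GenSmooth => v /UP [].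
Qed.

Lemma smooth_atM n (f g : 'rV[R]_n -> R) (u : 'rV[R]_n) :
  smooth_at f u -> smooth_at g u -> smooth_at (fun v => f v * g v) u.
Proof.
move=> /smooth_at_near sf /smooth_at_near sg.
apply: (generated_smooth_at (filterI sf sg)) => U UP.
by apply: GenMul; apply: GenSmooth => v /UP [].
Qed.

Lemma smooth_at_comp n p (f : 'rV[R]_p -> R) (g : 'rV[R]_n -> 'rV[R]_p) u :
  smooth_at f (g u) -> (forall j, smooth_at (fun v => g v 0 j) u) ->
  smooth_at (fun v => f (g v)) u.
Proof.
move=> /smooth_at_near sf sg.
have cg : {for u, continuous g}.
  apply: differentiable_continuous; apply: differentiable_row => j.
  exact: smooth_at_differentiable.
have sg' : \forall v \near u, forall j, smooth_at (fun v => g v 0 j) v.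
  exact: (@filter_forall _ _ (fun j v => smooth_at (fun v => g v 0 j) v) (nbhs u) _
    (fun j => smooth_at_near (sg j))).
have sf' : \forall v \near u, smooth_at f (g v) := cg _ sf.
apply: (@generated_smooth_at _ _ _ _ (@filterI _ (nbhs u) _ _ _ sf' sg')) => U UP.
by apply: GenComp => [v /UP[]|j v /UP[_]].
Qed.

End EuclideanSmooth.

(** * Bump functions on Euclidean space *)

Section FlatFunction.
Variable R : realType.

(** The classical flat function exp(-1/t), together with its products by powers of 1/t: the
    derivative of a member is a combination of two others. *)
Definition flatfun (n : nat) (t : R) : R :=
  if 0 < t then t^-1 ^+ n * expR (- t^-1) else 0.

(** The exponential series gives exp(1/t) >= t^-(n+1) / (n+1)!, one power more than the factor t^-n.
    The surplus power of [t] forces the limit 0 at the origin. *)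
Lemma flatfun_le n (t : R) : 0 < t -> `|flatfun n t| <= n.+1`!%:R * t.
Proof.
move=> t0; rewrite /flatfun t0 ger0_norm; last first.
  by rewrite mulr_ge0 ?expR_ge0// exprn_ge0// invr_ge0 ltW.
rewrite expRN -ler_pdivlMr ?invr_gt0 ?expR_gt0// invrK.
have ti : 0 <= t^-1 by rewrite invr_ge0 ltW.
have H := expR_ge1Dxn n ti.
have {}H : t^-1 ^+ n.+1 / n.+1`!%:R <= expR t^-1.
  by apply: le_trans H; rewrite lerDr ler01.
have F0 : 0 < n.+1`!%:R :> R by rewrite ltr0n fact_gt0.
rewrite -mulrA -ler_pdivrMl// -ler_pdivrMl//.
by apply: le_trans H; rewrite exprS mulrCA mulrC.
Qed.

Lemma is_derive_flatfun n (t : R) :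
  is_derive t 1 (flatfun n) (flatfun n.+2 t - n%:R * flatfun n.+1 t).
Proof.
case: (ltgtP t 0) => [t0|t0|->].
- rewrite /flatfun ltNge (ltW t0)/= mulr0 subr0.
  apply: (@near_eq_is_derive _ _ _ (cst 0)).
  by near=> s; rewrite ltNge ltW//; near: s; exact: lt_nbhsl.
- rewrite /flatfun t0.
  apply: (@near_eq_is_derive _ _ _ (GRing.inv ^+ n * (expR \o (- GRing.inv)))).
    near=> s; rewrite ifT; last by near: s; exact: lt_nbhsr.
    by rewrite !fctE.
  have tn0 : t != 0 by rewrite gt_eqF.
  have dV : is_derive t 1 (GRing.inv : R -> R) (- t ^- 2).
    have := @is_deriveV R id t 1 1 tn0 (is_derive_id _ _).
    by rewrite /GRing.scale /= mulr1.
  have d1 := is_deriveX n dV.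
  have d2 := is_derive1_comp (is_derive_expR ((- GRing.inv) t)) (is_deriveN dV).
  apply: is_derive_eq (is_deriveM d1 d2) _.
  rewrite /= !fctE /GRing.scale /= -exprVn.
  case: n {d1} => [|n]; first by rewrite !expr0; ring.
  by rewrite /= !exprS expr0; ring.
- rewrite /flatfun ltxx mulr0 subr0 -/(flatfun n).
  (* For positive increments the difference quotient at 0 is [flatfun n.+1] itself, which
     [flatfun_le] bounds by a multiple of the increment; for negative ones it is 0. *)
  have c : h^-1 *: (flatfun n (h *: 1 + 0) - flatfun n 0) @[h --> 0^'] --> 0.
    apply/cvgr0Pnorm_le => e e0.
    have F0 : 0 < n.+2`!%:R :> R by rewrite ltr0n fact_gt0.
    near=> h; rewrite addr0 [h *: 1]mulr1 {2}/flatfun ltxx subr0.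
    have [h0|h0] := ltP 0 h; last first.
      by rewrite /flatfun ltNge h0 /= scaler0 normr0 ltW.
    have -> : h^-1 *: flatfun n h = flatfun n.+1 h.
      by rewrite /flatfun h0 exprS -mulrA.
    apply: le_trans (flatfun_le _ h0) _.
    rewrite -ler_pdivlMl// mulrC; apply: le_trans (ler_norm _) (ltW _).
    by near: h; apply: dnbhs0_lt; rewrite divr_gt0.
  apply: DeriveDef; last exact: cvg_lim c.
  by apply/cvg_ex; exists 0.
Unshelve. all: by end_near. Qed.

Lemma flatfun_gt0 n t : (flatfun n t != 0) = (0 < t).
Proof.
rewrite /flatfun; case: ifP => [t0|]; last by rewrite eqxx.
by rewrite mulf_neq0 ?gt_eqF ?expR_gt0// exprn_gt0// invr_gt0.
Qed.

(** The class fed to [smooth_at_coind]: by [is_derive_flatfun], differentiation sends a generator to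
    a combination of two others. Row vectors of length 1 appear because [smooth_at] is stated for
    row vectors. *)
Inductive flat_span : ('rV[R]_1 -> R) -> Prop :=
| FlatSpan1 n : flat_span (fun u => flatfun n (u 0 0))
| FlatSpanL a f g of flat_span f & flat_span g :
    flat_span (fun u => a * f u + g u).

Lemma smooth_flatfun n (u : 'rV[R]_1) :
  smooth_at (fun v : 'rV[R]_1 => flatfun n (v 0 0)) u.
Proof.
have der m (v w : 'rV[R]_1) : differentiable (fun v : 'rV[R]_1 => flatfun m (v 0 0)) v
    /\ 'D_w (fun v : 'rV[R]_1 => flatfun m (v 0 0)) v =
       w 0 0 * (flatfun m.+2 (v 0 0) - m%:R * flatfun m.+1 (v 0 0)).
  have D := is_derive_flatfun m (v 0 0).
  have df : differentiable (flatfun m) (v 0 0) by apply/derivable1_diffP.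
  have dc := differentiable_coord v 0 0.
  have dfc := differentiable_comp dc df.
  split=> //; rewrite deriveE // (diff_comp dc df) /= deriv1E // derive1E derive_val.
  by rewrite -deriveE // deriv_coord.
have dfl f v : flat_span f -> differentiable f v.
  elim=> [m|a {}f g _ df _ dg]; first by have [] := der m v 0.
  by apply: differentiableD => //; exact: differentiableZ.
apply: (@smooth_at_coind R 1 setT flat_span openT) => //; last exact: FlatSpan1.
  by move=> f sf v _; exact: dfl.
move=> f i; elim=> {f} [m|a f g sf IHf sg IHg].
  have -> : pderiv i (fun u : 'rV[R]_1 => flatfun m (u 0 0)) =
    (fun v : 'rV[R]_1 => - m%:R * flatfun m.+1 (v 0 0) + flatfun m.+2 (v 0 0)).
    apply/funext => v; rewrite /pderiv; have [_ ->] := der m v (delta_mx 0 i).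
    by rewrite [i]ord1 mxE !eqxx mul1r addrC mulNr.
  by apply: FlatSpanL; exact: FlatSpan1.
have -> : pderiv i (fun u => a * f u + g u) =
    (fun u => a * pderiv i f u + pderiv i g u); last exact: FlatSpanL.
apply/funext => v; rewrite /pderiv deriveD ?deriveZ//.
- exact/diff_derivable/dfl.
- exact/diff_derivable/differentiableZ/dfl.
- exact/diff_derivable/dfl.
Qed.

Lemma smooth_at_prod n p (F : 'I_p -> 'rV[R]_n -> R) u :
  (forall i, smooth_at (F i) u) -> smooth_at (fun v => \prod_i F i v) u.
Proof.
move=> sF; elim: p F sF => [|p IH] F sF.
  by under eq_fun do rewrite big_ord0; exact: smooth_at_cst.
by under eq_fun do rewrite big_ord_recl; apply: smooth_atM => //; exact: IH.
Qed.

Lemma smooth_at_sum n p (F : 'I_p -> 'rV[R]_n -> R) u :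
  (forall i, smooth_at (F i) u) -> smooth_at (fun v => \sum_i F i v) u.
Proof.
move=> sF; elim: p F sF => [|p IH] F sF.
  by under eq_fun do rewrite big_ord0; exact: smooth_at_cst.
by under eq_fun do rewrite big_ord_recl; apply: smooth_atD => //; exact: IH.
Qed.

(** A product over the coordinates suits the maximum norm: no factor vanishes exactly when every
    |v_i - u_i| is less than [r]. Division by the value at [u] normalises. *)
Lemma euclidean_bump n (u : 'rV[R]_n) (r : R) : 0 < r ->
  exists psi : 'rV[R]_n -> R, [/\ forall v, smooth_at psi v, psi u = 1 &
    forall v, psi v != 0 -> `|u - v| < r].
Proof.
move=> r0.
pose psi (v : 'rV[R]_n) := \prod_i flatfun 0 (r ^+ 2 - (v 0 i - u 0 i) ^+ 2).
have s_psi v : smooth_at psi v.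
  apply: smooth_at_prod => i.
  have -> : (fun v : 'rV[R]_n => flatfun 0 (r ^+ 2 - (v 0 i - u 0 i) ^+ 2)) =
    (fun v => (fun w : 'rV[R]_1 => flatfun 0 (w 0 0))
                (\row_(_ < 1) (r ^+ 2 - (v 0 i - u 0 i) ^+ 2))).
    by apply/funext => w; rewrite mxE.
  apply: (smooth_at_comp (f := fun w : 'rV[R]_1 => flatfun 0 (w 0 0))).
    exact: smooth_flatfun.
  move=> j; under eq_fun do rewrite mxE.
  have sd : smooth_at (fun w : 'rV[R]_n => w 0 i - u 0 i) v.
    by apply: smooth_atD; [exact: smooth_at_coord|exact: smooth_at_cst].
  have -> : (fun w : 'rV[R]_n => r ^+ 2 - (w 0 i - u 0 i) ^+ 2) =
    (fun w => r ^+ 2 + -1 * ((w 0 i - u 0 i) * (w 0 i - u 0 i))).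
    by apply/funext => w; ring.
  apply: smooth_atD; first exact: smooth_at_cst.
  by apply: smooth_atM; [exact: smooth_at_cst|exact: smooth_atM].
have supp v : psi v != 0 -> `|u - v| < r.
  move=> /prodf_neq0 H; rewrite [ltLHS]/Num.Def.normr/= mx_normrE.
  apply: bigmax_lt => // -[a i] _; rewrite /= !mxE (ord1 a) {a}.
  have := H i isT; rewrite flatfun_gt0 subr_gt0 => h.
  rewrite distrC -(@ltr_pXn2r _ 2) ?nnegrE ?(ltW r0)//.
  by rewrite real_normK ?num_real.
have nz : psi u != 0.
  rewrite prodf_seq_neq0; apply/allP => i _ /=.
  by rewrite flatfun_gt0 subrr expr0n subr0 exprn_gt0.
exists (fun v => (psi u)^-1 * psi v); split.
- by move=> v; apply: smooth_atM => //; exact: smooth_at_cst.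
- by rewrite mulVf.
- by move=> v; rewrite mulf_eq0 negb_or => /andP[_ /supp].
Qed.
End FlatFunction.

Lemma fct_addE (R : realType) (T : Type) (v w : T -> R) t : (v + w) t = v t + w t.
Proof. by []. Qed.

Lemma fct_subE (R : realType) (T : Type) (v w : T -> R) t : (v - w) t = v t - w t.
Proof. by []. Qed.

Lemma fct_scaleE (R : realType) (T : Type) (r : R) (v : T -> R) t :
  (r *: v) t = r * v t.
Proof. by []. Qed.

(** * Tangent and cotangent spaces in charts *)

Section Charts.
Variables (R : realType) (n : nat) (M : manifold R n).
Implicit Types (f g : M -> R) (c : chart R M n) (x : M).

Lemma near_source c x : source c x -> \forall y \near x, source c y.
Proof. by move=> sx; apply: open_nbhs_nbhs; split=> //; exact: open_source. Qed.

Lemma near_target c u : target c u -> \forall v \near u, target c v.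
Proof. by move=> tu; apply: open_nbhs_nbhs; split=> //; exact: open_target. Qed.

Lemma near_uncoord c x (P : set M) : source c x -> (\forall y \near x, P y) ->
  \forall u \near coord c x, P (uncoord c u).
Proof.
move=> sx Px; have := uncoord_continuous (coord_target sx).
by rewrite /prop_for /continuous_at coordK//; apply.
Qed.

Lemma near_coord c x (P : set 'rV[R]_n) : source c x ->
  (\forall u \near coord c x, P u) -> \forall y \near x, P (coord c y).
Proof. by move=> sx Px; have := coord_continuous sx; apply. Qed.

(** Smooth transition maps carry smoothness from the chart at hand to every chart at [x], so that
    the quantification in [smooth_near] can be checked in a single chart. *)
Lemma smooth_nearP c f x : atlas c -> source c x ->
  smooth_near f x <-> smooth_at (f \o uncoord c) (coord c x).
Proof.
move=> ac sx; split=> [|sf c' ac' sx']; first exact.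
have [_ tr] := atlas_compatible ac ac'.
have tx := coord_target sx'.
have E : {near coord c' x, (fun v => (f \o uncoord c) (coord c (uncoord c' v)))
                           =1 f \o uncoord c'}.
  apply: filterS (near_uncoord sx' (near_source sx)) => v sv.
  by rewrite /= coordK.
apply: near_eq_smooth_at E _.
apply: smooth_at_comp; first by rewrite coordK.
by apply: tr => //; rewrite coordK.
Qed.

Lemma smooth_near_eq f g x : {near x, f =1 g} -> smooth_near f x -> smooth_near g x.
Proof.
move=> fg sf c ac sx; apply: near_eq_smooth_at (sf c ac sx).
exact: near_uncoord fg.
Qed.

Lemma smooth_near_near f x : smooth_near f x -> \forall y \near x, smooth_near f y.
Proof.
move=> sf; have [c ac sx] := atlas_covers x.
have /smooth_at_near H := sf c ac sx.
apply: filterS2 (near_source sx) (near_coord sx H) => y sy.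
by move=> /(smooth_nearP _ ac sy).
Qed.

Lemma smooth_near_cst r x : smooth_near (cst r : M -> R) x.
Proof. by move=> c _ _; exact: smooth_at_cst. Qed.

Lemma smooth_nearD f g x : smooth_near f x -> smooth_near g x ->
  smooth_near (fun y => f y + g y) x.
Proof. by move=> sf sg c ac sx; apply: smooth_atD; [exact: sf|exact: sg]. Qed.

Lemma smooth_nearM f g x : smooth_near f x -> smooth_near g x ->
  smooth_near (fun y => f y * g y) x.
Proof. by move=> sf sg c ac sx; apply: smooth_atM; [exact: sf|exact: sg]. Qed.

Lemma smooth_nearZ r f x : smooth_near f x -> smooth_near (fun y => r * f y) x.
Proof. by move=> sf; apply: smooth_nearM => //; exact: smooth_near_cst. Qed.

Lemma smooth_nearN f x : smooth_near f x -> smooth_near (fun y => - f y) x.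
Proof.
move=> /(smooth_nearZ (-1)); under eq_fun do rewrite mulN1r; exact.
Qed.

Lemma smooth_nearB f g x : smooth_near f x -> smooth_near g x ->
  smooth_near (fun y => f y - g y) x.
Proof. by move=> sf sg; apply: smooth_nearD => //; exact: smooth_nearN. Qed.

Lemma smooth_near_comp p (phi : 'rV[R]_p -> R) (g : M -> 'rV[R]_p) x :
  smooth_at phi (g x) -> (forall j, smooth_near (fun y => g y 0 j) x) ->
  smooth_near (fun y => phi (g y)) x.
Proof.
move=> sphi sg c ac sx; apply: smooth_at_comp; first by rewrite coordK.
by move=> j; exact: (sg j).
Qed.

Lemma smooth_near_coord c x i : atlas c -> source c x ->
  smooth_near (fun y => coord c y 0 i) x.
Proof.
move=> ac sx; apply/(smooth_nearP _ ac sx).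
apply: near_eq_smooth_at (smooth_at_coord i _).
apply: filterS (near_target (coord_target sx)) => v tv.
by rewrite /= uncoordK.
Qed.

Definition coordf c i : M -> R := fun y => coord c y 0 i.

Definition cvec c i : M -> tvec M := coord_vec c (delta_mx 0 i).

Lemma coord_vec_nsmooth c w x f : ~ smooth_near f x -> coord_vec c w x f = 0.
Proof. by move=> nf; rewrite /coord_vec; case: asboolP. Qed.

Lemma coord_vecE c w x f : atlas c -> source c x -> smooth_near f x ->
  coord_vec c w x f = \sum_i w 0 i * pderiv i (f \o uncoord c) (coord c x).
Proof.
move=> ac sx sf; rewrite /coord_vec asboolT // derive_pderiv //.
exact/smooth_at_differentiable/sf.
Qed.

Lemma cvecE c i x f : smooth_near f x ->
  cvec c i x f = pderiv i (f \o uncoord c) (coord c x).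
Proof. by move=> sf; rewrite /cvec /coord_vec asboolT. Qed.

Lemma coord_vec_sum c w x : atlas c -> source c x ->
  coord_vec c w x = \sum_i w 0 i *: cvec c i x.
Proof.
move=> ac sx; apply/funext => f; rewrite fct_sumE.
have [sf|nf] := pselect (smooth_near f x).
  rewrite coord_vecE //; apply: eq_bigr => i _.
  by rewrite -cvecE.
rewrite coord_vec_nsmooth// big1// => i _.
by rewrite /cvec [LHS]fct_scaleE coord_vec_nsmooth// mulr0.
Qed.

Lemma coord_vec_linear c r w w' x : atlas c -> source c x ->
  coord_vec c (r *: w + w') x = r *: coord_vec c w x + coord_vec c w' x.
Proof.
move=> ac sx; rewrite !coord_vec_sum // scaler_sumr -big_split.
by apply: eq_bigr => i _; rewrite !mxE scalerDl scalerA.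
Qed.

Lemma coord_vec_coordf c w x i : atlas c -> source c x ->
  coord_vec c w x (coordf c i) = w 0 i.
Proof.
move=> ac sx; rewrite /coord_vec asboolT; last exact: smooth_near_coord.
rewrite -(deriv_coord i w (coord c x)); apply: near_eq_derive.
apply: filterS (near_target (coord_target sx)) => v tv.
by rewrite /= /coordf uncoordK.
Qed.

Lemma cvec_coordf c i j x : atlas c -> source c x ->
  cvec c i x (coordf c j) = (i == j)%:R.
Proof. by move=> ac sx; rewrite /cvec coord_vec_coordf // mxE eqxx eq_sym. Qed.

(** Chain rule for the transition map: the new components are the values of the vector on the new
    coordinate functions. *)
Lemma coord_vec_change c c' w x : atlas c -> source c x -> atlas c' -> source c' x ->
  coord_vec c w x = coord_vec c' (\row_i coord_vec c w x (coordf c' i)) x.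
Proof.
move=> ac sx ac' sx'; apply/funext => f.
have [sf|nf] := pselect (smooth_near f x); last by rewrite !coord_vec_nsmooth.
rewrite [RHS]coord_vecE // {1}/coord_vec asboolT //.
have E : {near coord c x, f \o uncoord c =1
   (f \o uncoord c') \o (fun v => coord c' (uncoord c v))}.
  apply: filterS (near_uncoord sx (near_source sx')) => v sv.
  by rewrite /= coordK.
rewrite (near_eq_derive _ E) derive_comp_row.
- rewrite coordK //; apply: eq_bigr => i _; congr (_ * _).
  by rewrite mxE /coord_vec asboolT //; exact: smooth_near_coord.
- by rewrite coordK//; exact/smooth_at_differentiable/sf.
- move=> j; apply: smooth_at_differentiable.
  exact: (@smooth_near_coord c' x j ac' sx' c ac sx).
Qed.

(** [tangent] provides some chart at [x]; here the chart is prescribed, so that vectors coming from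
    different charts can be compared and added. *)
Lemma tangentP c x v : atlas c -> source c x ->
  tangent x v <-> v = coord_vec c (\row_i v (coordf c i)) x.
Proof.
move=> ac sx; split=> [[c' [w [ac' sx' ->]]]|->]; first exact: coord_vec_change.
by exists c, (\row_i v (coordf c i)).
Qed.

Lemma tangent_cvec c i x : atlas c -> source c x -> tangent x (cvec c i x).
Proof. by move=> ac sx; exists c, (delta_mx 0 i). Qed.

Lemma tangentL x r v w : tangent x v -> tangent x w -> tangent x (r *: v + w).
Proof.
have [c ac sx] := atlas_covers x.
move=> /(tangentP _ ac sx)-> /(tangentP _ ac sx)->.
by rewrite -coord_vec_linear //; eexists; eexists; split; [exact: ac|exact: sx|].
Qed.

Lemma tangent0 x : tangent x 0.
Proof.
have [c ac sx] := atlas_covers x.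
exists c, 0; split=> //; rewrite coord_vec_sum // big1// => i _.
by rewrite mxE scale0r.
Qed.

Lemma tangentZ x r v : tangent x v -> tangent x (r *: v).
Proof. by move=> tv; rewrite -[_ *: _]addr0; apply: tangentL => //; exact: tangent0. Qed.

Lemma tangentD x v w : tangent x v -> tangent x w -> tangent x (v + w).
Proof. by move=> tv; rewrite -[v]scale1r; exact: tangentL. Qed.

Lemma tangent_sum x p (F : 'I_p -> tvec M) :
  (forall i, tangent x (F i)) -> tangent x (\sum_i F i).
Proof.
by move=> tF; apply: big_ind => //; [exact: tangent0|exact: tangentD].
Qed.

Lemma tangent_expand c x v : atlas c -> source c x -> tangent x v ->
  v = \sum_i v (coordf c i) *: cvec c i x.
Proof.
move=> ac sx /(tangentP _ ac sx) {1}->; rewrite coord_vec_sum //.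
by apply: eq_bigr => i _; rewrite mxE.
Qed.

Lemma tangent_inj c x v w : atlas c -> source c x -> tangent x v -> tangent x w ->
  (forall i, v (coordf c i) = w (coordf c i)) -> v = w.
Proof.
move=> ac sx tv tw vw.
rewrite (tangent_expand ac sx tv) (tangent_expand ac sx tw).
by apply: eq_bigr => i _; rewrite vw.
Qed.

Lemma tangent_eq x v f g : tangent x v -> {near x, f =1 g} -> v f = v g.
Proof.
move=> [c [w [ac sx ->]]] fg; rewrite /coord_vec.
have -> : smooth_near f x = smooth_near g x.
  apply/propext; split; apply: smooth_near_eq => //.
  by apply: filterS fg.
case: asboolP => // _; apply: near_eq_derive; exact: near_uncoord fg.
Qed.

Lemma tangent_fD x v f g : tangent x v -> smooth_near f x -> smooth_near g x ->
  v (fun y => f y + g y) = v f + v g.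
Proof.
move=> [c [w [ac sx ->]]] sf sg.
rewrite /coord_vec !asboolT //; last exact: smooth_nearD.
by rewrite -deriveD //; apply/diff_derivable/smooth_at_differentiable;
  [exact: sf|exact: sg].
Qed.

Lemma tangent_fM x v f g : tangent x v -> smooth_near f x -> smooth_near g x ->
  v (fun y => f y * g y) = f x * v g + g x * v f.
Proof.
move=> [c [w [ac sx ->]]] sf sg.
rewrite /coord_vec !asboolT //; last exact: smooth_nearM.
rewrite deriveM //.
- by rewrite /= coordK.
- by apply/diff_derivable/smooth_at_differentiable; exact: sf.
- by apply/diff_derivable/smooth_at_differentiable; exact: sg.
Qed.

Lemma tangent_cst x v r : tangent x v -> v (cst r : M -> R) = 0.
Proof.
move=> [c [w [ac sx ->]]].
by rewrite /coord_vec asboolT ?derive_cst//; exact: smooth_near_cst.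
Qed.

Lemma tangent_fZ x v r f : tangent x v -> smooth_near f x ->
  v (fun y => r * f y) = r * v f.
Proof.
move=> tv sf; rewrite (tangent_fM tv (smooth_near_cst (x := x) r) sf).
by rewrite (tangent_cst _ tv) mulr0 addr0.
Qed.

Lemma tangent_fN x v f : tangent x v -> smooth_near f x ->
  v (fun y => - f y) = - v f.
Proof.
move=> tv sf; rewrite -mulN1r -(tangent_fZ _ tv) //.
by congr (v _); apply/funext => y; rewrite mulN1r.
Qed.

Lemma tangent_fB x v f g : tangent x v -> smooth_near f x -> smooth_near g x ->
  v (fun y => f y - g y) = v f - v g.
Proof.
move=> tv sf sg; rewrite (tangent_fD tv sf (smooth_nearN sg)).
by rewrite (tangent_fN tv).
Qed.

Lemma cotangentL x r a b : cotangent x a -> cotangent x b -> cotangent x (r *: a + b).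
Proof.
move=> [la za] [lb zb]; split=> [s v w tv tw|v nv].
  rewrite !fctE /GRing.scale /= la // lb //; ring.
by rewrite !fctE /GRing.scale /= za // zb // mulr0 addr0.
Qed.

Lemma cotangent0 x : cotangent x 0.
Proof. by split=> // r v w _ _; rewrite !fctE /= mulr0 addr0. Qed.

Lemma cotangentZ x r a : cotangent x a -> cotangent x (r *: a).
Proof. by move=> ca; rewrite -[_ *: _]addr0; apply: cotangentL => //; exact: cotangent0. Qed.

Lemma cotangentD x a b : cotangent x a -> cotangent x b -> cotangent x (a + b).
Proof. by move=> ca; rewrite -[a]scale1r; exact: cotangentL. Qed.

Lemma cotangent_sum x p (F : 'I_p -> covec M) :
  (forall i, cotangent x (F i)) -> cotangent x (\sum_i F i).
Proof.
by move=> tF; apply: big_ind => //; [exact: cotangent0|exact: cotangentD].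
Qed.

Section covector.
Variables (x : M) (a : covec M).
Hypothesis ca : cotangent x a.

Lemma covec0 : a 0 = 0.
Proof.
have [la _] := ca; have := la 1 _ _ (tangent0 x) (tangent0 x).
by rewrite scaler0 addr0 mul1r => /eqP; rewrite -subr_eq subrr eq_sym => /eqP.
Qed.

Lemma covecL r v w : tangent x v -> tangent x w -> a (r *: v + w) = r * a v + a w.
Proof. by case: ca => la _; exact: la. Qed.

Lemma covecZ r v : tangent x v -> a (r *: v) = r * a v.
Proof.
by move=> tv; have := covecL r tv (tangent0 x); rewrite covec0 !addr0.
Qed.

Lemma covecD v w : tangent x v -> tangent x w -> a (v + w) = a v + a w.
Proof. by move=> tv tw; have := covecL 1 tv tw; rewrite scale1r mul1r. Qed.

Lemma covecB v w : tangent x v -> tangent x w -> a (v - w) = a v - a w.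
Proof.
by move=> tv tw; rewrite [v - w]addrC -scaleN1r covecL // addrC mulN1r.
Qed.

Lemma covec_sum p (l : 'I_p -> R) (F : 'I_p -> tvec M) :
  (forall i, tangent x (F i)) -> a (\sum_i l i *: F i) = \sum_i l i * a (F i).
Proof.
move=> tF; elim: p l F tF => [|p IH] l F tF; first by rewrite !big_ord0 covec0.
rewrite !big_ord_recl covecL// ?IH //.
by apply: tangent_sum => i; exact: tangentZ.
Qed.

End covector.

(** The differential df, with the value 0 off the tangent space that [cotangent] imposes. *)
Definition dform f : M -> covec M := fun x v => if `[< tangent x v >] then v f else 0.

Lemma cotangent_dform f x : cotangent x (dform f x).
Proof.
split=> [r v w tv tw|v nv]; last by rewrite /dform; case: asboolP.
by rewrite /dform !asboolT //; exact: tangentL.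
Qed.

Lemma dformE f x v : tangent x v -> dform f x v = v f.
Proof. by move=> tv; rewrite /dform asboolT. Qed.

Lemma cotangent_expand c x a : atlas c -> source c x -> cotangent x a ->
  a = \sum_i a (cvec c i x) *: dform (coordf c i) x.
Proof.
move=> ac sx ca; apply/funext => v; rewrite fct_sumE.
have [tv|ntv] := pselect (tangent x v).
  rewrite {1}(tangent_expand ac sx tv) (covec_sum ca); last first.
    by move=> i; exact: tangent_cvec.
  by apply: eq_bigr => i _; rewrite fct_scaleE (dformE _ tv) mulrC.
have [_ ->//] := ca; rewrite big1// => i _.
by have [_ z] := cotangent_dform (coordf c i) x; rewrite fct_scaleE z // mulr0.
Qed.

Lemma cotangent_ext x a b : cotangent x a -> cotangent x b ->
  (forall v, tangent x v -> a v = b v) -> a = b.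
Proof.
move=> [_ za] [_ zb] ab; apply/funext => v.
have [tv|ntv] := pselect (tangent x v); first exact: ab.
by rewrite za// zb.
Qed.

End Charts.

(** * Bump functions, sheaves of sections and tensoriality *)

Section Bump.
Variables (R : realType) (n : nat) (M : manifold R n).

(** The Euclidean bump is supported in a closed ball, whose image in [M] is compact, hence closed
    because [M] is Hausdorff. Extension by zero outside the chart is therefore smooth. *)
Lemma bump_function (W : set M) (x : M) : open W -> W x ->
  exists b : M -> R, [/\ smooth setT b, b x = 1 &
    forall y, ~ W y -> \forall z \near y, b z = 0].
Proof.
move=> oW Wx; have [c ac sx] := atlas_covers x.
have nW : \forall u \near coord c x, W (uncoord c u).
  by apply: near_uncoord => //; exact: open_nbhs_nbhs.
have nTW : nbhs (coord c x) (target c `&` [set u | W (uncoord c u)]).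
  exact: filterI (near_target (coord_target sx)) nW.
have [e /= e0 eW] := (nbhs_ballP _ _).1 nTW.
have r0 : 0 < e / 2 by rewrite divr_gt0.
have [psi [spsi psi1 psi0]] := euclidean_bump (coord c x) r0.
pose b y := if `[< source c y >] then psi (coord c y) else 0.
(* Half the radius keeps this closed ball inside the open ball of radius [e], where both the chart
   and [W] are available. *)
pose K := [set v | `|coord c x - v| <= e / 2].
have KW v : K v -> target c v /\ W (uncoord c v).
  move=> Kv; apply: eW; rewrite -ball_normE /ball_ /=; apply: le_lt_trans Kv _.
  by rewrite ltr_pdivrMr// ltr_pMr// ltr1n.
have cK : compact (uncoord c @` K).
  apply: continuous_compact.
    apply: continuous_in_subspaceT => v; rewrite inE => /KW[tv _].
    exact: uncoord_continuous.
  apply: bounded_closed_compact.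
    exists (`|coord c x| + e / 2); split; first by rewrite num_real.
    move=> s ls v /= Kv; apply: le_trans (ltW ls).
    rewrite -[v](subKr (coord c x)) (le_trans (ler_normB _ _))//.
    by rewrite lerD2l.
  have -> : K = (fun v => `|coord c x - v|) @^-1` [set t | t <= e / 2] by [].
  apply: closed_comp; last exact: closed_le.
  move=> v _; apply: continuous_comp; last exact: norm_continuous.
  by apply: continuousB; [exact: cst_continuous|exact: id].
have clK := compact_closed (@manifold_hausdorff _ _ M) cK.
have bK y : ~ (uncoord c @` K) y -> b y = 0.
  move=> nK; rewrite /b; case: asboolP => // sy.
  apply: contrapT => /eqP /psi0 /ltW h; apply: nK.
  by exists (coord c y) => //; rewrite coordK.
have near0 y : ~ (uncoord c @` K) y -> \forall z \near y, b z = 0.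
  move=> nK; have : nbhs y (~` (uncoord c @` K)).
    by apply: open_nbhs_nbhs; split=> //; exact: closed_openC.
  by apply: filterS => z; exact: bK.
exists b; split.
- move=> y _; have [[v Kv <-]|nK] := pselect ((uncoord c @` K) y).
    have [tv _] := KW _ Kv; have sv := uncoord_source tv.
    apply: (@smooth_near_eq _ _ _ (fun y => psi (coord c y))).
      by apply: filterS (near_source sv) => z sz; rewrite /b asboolT.
    by apply: smooth_near_comp => // j; exact: smooth_near_coord.
  apply: smooth_near_eq (smooth_near_cst (x := y) 0).
  by apply: filterS (near0 _ nK) => z ->.
- by rewrite /b asboolT.
- by move=> y nWy; apply: near0 => -[v /KW[_ Wv] vy]; apply: nWy; rewrite -vy.
Qed.

End Bump.

(** * Sheaves of sections and the tensor criterion *)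

Section SectionsOfBundles.
Variables (R : realType) (n : nat) (M : manifold R n) (E : lmodType R).
Variable sec : set M -> set (M -> E).

(** A common treatment of vector fields, one-forms and sections of TN°. Since sections are total
    functions, [sheaf_ext] records that only their values on [U] count. *)
Record module_sheaf : Prop := {
  sheaf_restrict : forall U V s, open V -> V `<=` U -> sec U s -> sec V s;
  sheaf_glue : forall U s, open U ->
    (forall y, U y -> exists V, [/\ open V, V y & sec V s]) -> sec U s;
  sheaf_ext : forall U s t, open U -> (forall y, U y -> s y = t y) ->
    sec U s -> sec U t;
  sheaf_zero : forall U, open U -> sec U (fun=> 0);
  sheaf_linear : forall U f s t, open U -> smooth U f -> sec U s -> sec U t ->
    sec U (fun y => f y *: s y + t y)
}.

Hypothesis shf : module_sheaf.

Lemma sheafD U s t : open U -> sec U s -> sec U t -> sec U (fun y => s y + t y).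
Proof.
move=> oU Us Ut.
apply: (sheaf_ext shf oU _ (sheaf_linear shf oU _ Us Ut) (s := fun y => 1 *: s y + t y)).
  by move=> y _; rewrite scale1r.
by move=> y _; exact: smooth_near_cst.
Qed.

Lemma sheafM U f s : open U -> smooth U f -> sec U s -> sec U (fun y => f y *: s y).
Proof.
move=> oU sf Us.
apply: (sheaf_ext shf oU _ (sheaf_linear shf oU sf Us (sheaf_zero shf oU))).
by move=> y _; rewrite addr0.
Qed.

Lemma sheafZ U r s : open U -> sec U s -> sec U (fun y => r *: s y).
Proof. by move=> oU; apply: sheafM => // y _; exact: smooth_near_cst. Qed.

Lemma sheafB U s t : open U -> sec U s -> sec U t -> sec U (fun y => s y - t y).
Proof.
move=> oU Us Ut; apply: (sheaf_ext shf oU _ (sheafD oU Us (sheafZ (-1) oU Ut))).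
by move=> y _; rewrite scaleN1r.
Qed.

Lemma sheaf_sum U p (l : 'I_p -> M -> R) (e : 'I_p -> M -> E) : open U ->
  (forall i, smooth U (l i)) -> (forall i, sec U (e i)) ->
  sec U (fun y => \sum_i l i y *: e i y).
Proof.
move=> oU; elim: p l e => [|p IH] l e sl se.
  apply: (sheaf_ext shf oU _ (sheaf_zero shf oU)).
  by move=> y _; rewrite big_ord0.
have := sheaf_linear shf oU (sl ord0) (se ord0)
  (IH _ _ (fun i => sl (lift ord0 i)) (fun i => se (lift ord0 i))).
by apply: (sheaf_ext shf oU) => y _; rewrite big_ord_recl.
Qed.

(** Multiplication by a bump function at [x] allows extension by zero. Only the value at [x] is
    retained, which suffices for tensorial expressions. *)
Lemma sheaf_extend U s x : open U -> U x -> sec U s ->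
  exists2 S, sec setT S & S x = s x.
Proof.
move=> oU Ux Us; have [b [sb bx b0]] := bump_function oU Ux.
exists (fun y => if `[< U y >] then b y *: s y else 0); last first.
  by rewrite asboolT // bx scale1r.
apply: (sheaf_glue shf) openT _ => y _.
have [Uy|nUy] := pselect (U y).
  exists U; split=> //; apply: (sheaf_ext shf oU) (sheafM (f := b) oU _ Us).
    by move=> z Uz; rewrite asboolT.
  by move=> z _; exact: sb.
have /nbhs_interior := b0 _ nUy; set V := _°%classic => Vy.
have oV : open V by exact: open_interior.
exists V; split=> //; first exact: nbhs_singleton.
apply: (sheaf_ext shf oV) (sheaf_zero shf oV) => z Vz; case: asboolP => // _.
by rewrite (interior_subset Vz) scale0r.
Qed.

(** The last clause stands in for linear independence of the frame: a section that vanishes at the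
    point has coefficients that vanish there, as the tensor criterion requires. *)
Definition framed := forall x, exists W (p : nat) (e : 'I_p -> M -> E),
  [/\ open W, W x, forall i, sec W (e i) &
      forall U s, open U -> U `<=` W -> sec U s -> exists l : 'I_p -> M -> R,
        [/\ forall i, smooth U (l i), forall y, U y -> s y = \sum_i l i y *: e i y
          & U x -> s x = 0 -> forall i, l i x = 0]].

Variables (x : M) (W : lmodType R) (F : (M -> E) -> W).

Record tensorial : Prop := {
  tensorial_local : forall U s t, open U -> U x -> sec U s -> sec U t ->
    (forall y, U y -> s y = t y) -> F s = F t;
  tensorial_linear : forall U f s t, open U -> U x -> smooth U f ->
    sec U s -> sec U t -> F (fun y => f y *: s y + t y) = f x *: F s + F t
}.

Hypothesis tF : tensorial.

Lemma tensorial0 : F (fun=> 0) = 0.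
Proof.
have s0 := sheaf_zero shf openT.
have := tensorial_linear tF openT Logic.I (fun y _ => smooth_near_cst (x := y) 1) s0 s0.
rewrite /cst !scale1r.
have -> : (fun y : M => 0 + 0) = (fun=> 0) :> (M -> E).
  by apply/funext => y; rewrite addr0.
by move=> /eqP; rewrite -subr_eq subrr eq_sym => /eqP.
Qed.

Lemma tensorial_sum U p (l : 'I_p -> M -> R) (e : 'I_p -> M -> E) :
  open U -> U x -> (forall i, smooth U (l i)) -> (forall i, sec U (e i)) ->
  F (fun y => \sum_i l i y *: e i y) = \sum_i l i x *: F (e i).
Proof.
move=> oU Ux; elim: p l e => [|p IH] l e sl se.
  under eq_fun do rewrite big_ord0; rewrite big_ord0; exact: tensorial0.
under eq_fun do rewrite big_ord_recl.
rewrite (tensorial_linear tF oU Ux) // ?big_ord_recl ?IH //.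
exact: sheaf_sum.
Qed.

Hypothesis frm : framed.

(** The tensor criterion: near [x] the difference of the sections is expanded in a frame with
    coefficients vanishing at [x], and linearity over functions pulls these coefficients out. *)
Lemma tensorial_eq U s t : open U -> U x -> sec U s -> sec U t -> s x = t x ->
  F s = F t.
Proof.
move=> oU Ux Us Ut st.
have [V [p [e [oV Vx se fr]]]] := frm x.
have oUV : open (U `&` V) by exact: openI.
pose d y := -1 *: t y + s y.
have Ud : sec U d.
  by apply: (sheaf_linear shf) => // y _; exact: smooth_near_cst.
have Fd : F d = - F t + F s.
  rewrite (tensorial_linear tF oU Ux (f := fun=> -1)) ?scaleN1r //.
  by move=> y _; exact: smooth_near_cst.
have dUV := sheaf_restrict shf oUV (@subIsetl _ U V) Ud.
have [l [sl dl l0]] := fr _ _ oUV (@subIsetr _ U V) dUV.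
have seUV i : sec (U `&` V) (e i).
  exact: sheaf_restrict oUV (@subIsetr _ U V) (se i).
have dx : d x = 0 by rewrite /d st scaleN1r addNr.
have : F d = 0.
  rewrite (tensorial_local tF oUV (conj Ux Vx) dUV (sheaf_sum oUV sl seUV) dl).
  rewrite (tensorial_sum oUV (conj Ux Vx) sl seUV) big1// => i _.
  by rewrite l0 ?scale0r.
by rewrite Fd addrC => /eqP; rewrite subr_eq0 => /eqP.
Qed.
End SectionsOfBundles.

(** * Vector fields and one-forms as framed sheaves *)

Section VectorFieldsAndForms.
Variables (R : realType) (n : nat) (M : manifold R n).
Implicit Types (U V : set M) (f g : M -> R) (X Y : M -> tvec M)
  (alpha beta : M -> covec M).

Lemma smooth_restrict U V f : V `<=` U -> smooth U f -> smooth V f.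
Proof. by move=> VU sf x /VU /sf. Qed.

Lemma near_open U x : open U -> U x -> \forall y \near x, U y.
Proof. by move=> oU Ux; exact: open_nbhs_nbhs. Qed.

Lemma smooth_ext U f g : open U -> (forall y, U y -> f y = g y) ->
  smooth U f -> smooth U g.
Proof.
move=> oU fg sf x Ux; apply: smooth_near_eq (sf x Ux).
exact: filterS (near_open oU Ux).
Qed.

Lemma vfield_sheaf : module_sheaf (@vfield R n M).
Proof.
split.
- by move=> U V X oV VU sX x /VU /sX.
- by move=> U X oU gX x /gX[V [oV Vx sX]]; exact: sX.
- move=> U X Y oU XY sX x Ux; have [tX sXf] := sX x Ux; rewrite -XY //; split=> //.
  move=> f /sXf; apply: smooth_near_eq.
  by apply: filterS (near_open oU Ux) => y Uy; rewrite /act XY.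
- move=> U oU x _; split; first exact: tangent0.
  by move=> f _; exact: smooth_near_cst.
- move=> U f X Y oU sf sX sY x Ux; have [tX sXg] := sX x Ux; have [tY sYg] := sY x Ux.
  split; first exact: tangentL.
  move=> g sg; apply: smooth_nearD; last exact: sYg.
  by apply: smooth_nearM; [exact: sf|exact: sXg].
Qed.

Lemma oneform_sheaf : module_sheaf (@oneform R n M).
Proof.
split.
- move=> U V a oV VU [ca sa]; split=> [x /VU|W X oW WV]; first exact: ca.
  by apply: sa => //; exact: subset_trans VU.
- move=> U a oU ga; split=> [x /ga[V [oV Vx [ca _]]]|W X oW WU sX x Wx].
    exact: ca.
  have [V [oV Vx [_ sa]]] := ga x (WU x Wx).
  apply: (sa (V `&` W)) => //; first exact: openI.
  by move=> y [_ /sX].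
- move=> U a b oU ab [ca sa]; split=> [x Ux|W X oW WU sX].
    by rewrite -ab //; exact: ca.
  by apply: smooth_ext (sa _ _ oW WU sX) => // y /WU Uy; rewrite /pairing ab.
- move=> U oU; split=> [x _|W X oW WU sX x Wx]; first exact: cotangent0.
  exact: smooth_near_cst.
- move=> U f a b oU sf [ca sa] [cb sb]; split=> [x Ux|W X oW WU sX x Wx].
    by apply: cotangentL; [exact: ca|exact: cb].
  apply: smooth_nearD; last exact: (sb _ _ oW WU sX).
  by apply: smooth_nearM; [exact: sf (WU _ Wx)|exact: (sa _ _ oW WU sX)].
Qed.

Lemma vfield_cvec (c : chart R M n) i : atlas c -> vfield (source c) (cvec c i).
Proof.
move=> ac x sx; split; first exact: tangent_cvec.
move=> f sf; apply: (@smooth_near_eq _ _ _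
    (fun y => pderiv i (f \o uncoord c) (coord c y))).
  apply: filterS (smooth_near_near sf) => y sy.
  by rewrite /act cvecE.
apply: smooth_near_comp; first exact/smooth_at_pderiv/sf.
by move=> j; exact: smooth_near_coord.
Qed.

Lemma oneform_dform U f : smooth U f -> oneform U (dform f).
Proof.
move=> sf; split=> [x _|V X oV VU sX x Vx]; first exact: cotangent_dform.
apply: (@smooth_near_eq _ _ _ (act X f)).
  apply: filterS (near_open oV Vx) => y /sX[tX _].
  by rewrite /pairing dformE.
by have [_] := sX x Vx; apply; exact: sf (VU _ Vx).
Qed.

Lemma smooth_pairing U alpha X : open U -> oneform U alpha -> vfield U X ->
  smooth U (pairing alpha X).
Proof. by move=> oU [_ sa] sX; exact: sa. Qed.

Lemma smooth_act U X f : vfield U X -> smooth U f -> smooth U (act X f).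
Proof. by move=> sX sf x Ux; have [_] := sX x Ux; apply; exact: sf. Qed.

Lemma smooth_coordf (c : chart R M n) i : atlas c -> smooth (source c) (coordf c i).
Proof. by move=> ac x sx; exact: smooth_near_coord. Qed.

Lemma vfield_framed : framed (@vfield R n M).
Proof.
move=> x; have [c ac sx] := atlas_covers x.
exists (source c), n, (cvec c); split=> //; first exact: open_source.
  by move=> i; exact: vfield_cvec.
move=> U X oU Uc sX; exists (fun i => act X (coordf c i)); split.
- move=> i; apply: smooth_act => //; exact: smooth_restrict (smooth_coordf i ac).
- move=> y Uy; apply: tangent_expand => //; first exact: Uc.
  by have [] := sX y Uy.
- by move=> Ux Xx i; rewrite /act Xx.
Qed.

Lemma oneform_framed : framed (@oneform R n M).
Proof.
move=> x; have [c ac sx] := atlas_covers x.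
exists (source c), n, (fun i => dform (coordf c i)); split=> //.
- exact: open_source.
- by move=> i; apply: oneform_dform; exact: smooth_coordf.
move=> U a oU Uc sa; exists (fun i => pairing a (cvec c i)); split.
- move=> i; apply: smooth_pairing => //.
  exact: (sheaf_restrict vfield_sheaf oU Uc (vfield_cvec i ac)).
- move=> y Uy; apply: cotangent_expand => //; first exact: Uc.
  by have [ca _] := sa; exact: ca.
- by move=> Ux ax i; rewrite /pairing ax.
Qed.

Lemma vfield_value (x : M) v : tangent x v -> exists2 X, vfield setT X & X x = v.
Proof.
move=> tv; have [c ac sx] := atlas_covers x; have os := open_source c.
have [|X sX Xx] := sheaf_extend vfield_sheaf os sx
  (s := fun y => \sum_i v (coordf c i) *: cvec c i y).
  apply: (sheaf_sum vfield_sheaf os (l := fun i _ => v (coordf c i))).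
    by move=> i y _; exact: smooth_near_cst.
  by move=> i; exact: vfield_cvec.
by exists X => //; rewrite Xx -tangent_expand.
Qed.

Lemma oneform_value (x : M) a : cotangent x a -> exists2 alpha, oneform setT alpha & alpha x = a.
Proof.
move=> ca; have [c ac sx] := atlas_covers x; have os := open_source c.
have [|X sX Xx] := sheaf_extend oneform_sheaf os sx
  (s := fun y => \sum_i a (cvec c i x) *: dform (coordf c i) y).
  apply: (sheaf_sum oneform_sheaf os (l := fun i _ => a (cvec c i x))).
    by move=> i y _; exact: smooth_near_cst.
  by move=> i; apply: oneform_dform; exact: smooth_coordf.
by exists X => //; rewrite Xx -cotangent_expand.
Qed.

Lemma extendP (x : M) v : tangent x v -> vfield setT (extend x v) /\ extend x v x = v.
Proof.
move=> /vfield_value[X sX Xx]; rewrite /extend.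
exact: (xgetPex (P := [set X | vfield setT X /\ X x = v]) _ (ex_intro _ X (conj sX Xx))).
Qed.

Lemma vfield_coords U (c : chart R M n) X : open U -> atlas c -> U `<=` source c ->
  (forall y, U y -> tangent y (X y)) ->
  (forall i, smooth U (act X (coordf c i))) -> vfield U X.
Proof.
move=> oU ac Uc tX sX.
apply: (sheaf_ext vfield_sheaf oU _ (s := fun y => \sum_i act X (coordf c i) y *: cvec c i y)).
  by move=> y Uy; rewrite -(tangent_expand ac (Uc _ Uy) (tX _ Uy)).
apply: (sheaf_sum vfield_sheaf) => // i.
exact: sheaf_restrict vfield_sheaf _ _ _ oU Uc (vfield_cvec i ac).
Qed.

End VectorFieldsAndForms.

(** * Covariant derivatives of forms *)

Section CovariantDerivatives.
Variables (R : realType) (n : nat) (M : manifold R n) (nabla : connection_op M).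
Hypothesis conn : is_connection nabla.
Implicit Types (U V : set M) (f g : M -> R) (X Y Z : M -> tvec M)
  (alpha beta : M -> covec M) (x : M).

Notation vrestrict := (sheaf_restrict (vfield_sheaf M)).
Notation frestrict := (sheaf_restrict (oneform_sheaf M)).

Lemma vfield_tangent U X x : vfield U X -> U x -> tangent x (X x).
Proof. by move=> sX /sX[]. Qed.

Lemma oneform_cotangent U alpha x : oneform U alpha -> U x -> cotangent x (alpha x).
Proof. by move=> [ca _] /ca. Qed.

Lemma act_eq U f g X x : open U -> U x -> tangent x (X x) ->
  (forall y, U y -> f y = g y) -> X x f = X x g.
Proof.
by move=> oU Ux tX fg; apply: tangent_eq tX _; exact: filterS (near_open oU Ux).
Qed.

Lemma nabla_tensorial U Y x : open U -> U x -> vfield U Y ->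
  tensorial (@vfield R n M) x (fun X => nabla X Y x).
Proof.
move=> oU Ux sY; split=> [V X X' oV Vx sX sX' XX'|V f X X' oV Vx sf sX sX'].
  have oW : open (U `&` V) by exact: openI.
  have WU := @subIsetl _ U V; have WV := @subIsetr _ U V.
  apply: (nabla_local conn oW (vrestrict oW WV sX) (vrestrict oW WU sY)
    (vrestrict oW WV sX') (vrestrict oW WU sY)) => // y [_ Vy]; exact: XX'.
have oW : open (U `&` V) by exact: openI.
apply: (nabla_linearl conn oW) => //.
- exact: smooth_restrict (@subIsetr _ U V) sf.
- exact: (vrestrict oW (@subIsetr _ U V) sX).
- exact: (vrestrict oW (@subIsetr _ U V) sX').
- exact: (vrestrict oW (@subIsetl _ U V) sY).
Qed.

Lemma nabla_eql U X X' Y x : open U -> U x -> vfield U X -> vfield U X' -> vfield U Y ->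
  X x = X' x -> nabla X Y x = nabla X' Y x.
Proof.
move=> oU Ux sX sX' sY XX'.
exact: (tensorial_eq (vfield_sheaf M) (nabla_tensorial oU Ux sY) (@vfield_framed R n M) oU Ux sX sX' XX').
Qed.

Lemma nabla_combl U X Y Z W r x : open U -> U x -> vfield U X -> vfield U Y ->
  vfield U Z -> vfield U W -> Z x = r *: X x + Y x ->
  nabla Z W x = r *: nabla X W x + nabla Y W x.
Proof.
move=> oU Ux sX sY sZ sW Zx.
have sr : smooth U (fun=> r) by move=> y _; exact: smooth_near_cst.
rewrite -(nabla_linearl conn oU sr sX sY sW Ux).
by apply: (nabla_eql oU) => //; exact: (sheaf_linear (vfield_sheaf M)).
Qed.

(** The terms X(f) alpha(Y) produced by the two Leibniz rules cancel. This frees [nabla_form],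
    defined through the chosen field [extend x v], from that choice. *)
Lemma nabla_form_tensorial U X alpha x : open U -> U x -> vfield U X -> oneform U alpha ->
  tensorial (@vfield R n M) x
    (fun Y => X x (pairing alpha Y) - alpha x (nabla X Y x) : R^o).
Proof.
move=> oU Ux sX sa; have tX := vfield_tangent sX Ux.
have ca := oneform_cotangent sa Ux.
split=> [V Y Y' oV Vx sY sY' YY'|V f Y Y' oV Vx sf sY sY'];
  have oW : open (U `&` V) by exact: openI.
- have -> : X x (pairing alpha Y) = X x (pairing alpha Y').
    by apply: (act_eq oV) => // y Vy; rewrite /pairing YY'.
  have -> // : nabla X Y x = nabla X Y' x.
  have WU := @subIsetl _ U V; have WV := @subIsetr _ U V.
  apply: (nabla_local conn oW (vrestrict oW WU sX) (vrestrict oW WV sY)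
    (vrestrict oW WU sX) (vrestrict oW WV sY')) => // y [_ Vy]; exact: YY'.
have WU := @subIsetl _ U V; have WV := @subIsetr _ U V.
have {}sX := vrestrict oW WU sX; have {}sa := frestrict oW WU sa.
have {}sY := vrestrict oW WV sY; have {}sY' := vrestrict oW WV sY'.
have {}sf := smooth_restrict WV sf; have Wx : (U `&` V) x by [].
have sfY := sheafM (vfield_sheaf M) oW sf sY.
rewrite (nabla_additiver conn oW sX sfY sY' Wx) (nabla_leibniz conn oW sf sX sY Wx).
have tN := vfield_tangent (nabla_vfield conn oW sX sY) Wx.
have tN' := vfield_tangent (nabla_vfield conn oW sX sY') Wx.
have tY := vfield_tangent sY Wx.
have spY := smooth_pairing oW sa sY; have spY' := smooth_pairing oW sa sY'.
rewrite (act_eq (g := fun y => f y * pairing alpha Y y + pairing alpha Y' y) oW) //; last first.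
  move=> y Wy; rewrite /pairing (covecL (oneform_cotangent sa Wy)) //.
    exact: vfield_tangent sY Wy.
  exact: vfield_tangent sY' Wy.
rewrite (tangent_fD tX _ (spY' _ Wx)); last first.
  by apply: smooth_nearM; [exact: sf|exact: spY].
rewrite (tangent_fM tX (sf _ Wx) (spY _ Wx)).
rewrite -[X in alpha x X]addrA (covecL ca) ?(covecD ca) ?(covecZ ca) //.
- by rewrite /GRing.scale /= /pairing; ring.
- exact: tangentZ.
- by apply: tangentD => //; exact: tangentZ.
Qed.

Lemma nabla_formE U X Y alpha x : open U -> U x -> vfield U X -> vfield U Y ->
  oneform U alpha ->
  nabla_form nabla X alpha x (Y x) = X x (pairing alpha Y) - alpha x (nabla X Y x).
Proof.
move=> oU Ux sX sY sa; have tY := vfield_tangent sY Ux.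
rewrite /nabla_form asboolT //; have [sE Ex] := extendP tY.
have sE' := vrestrict oU (@subsetT _ U) sE.
exact: (tensorial_eq (vfield_sheaf M) (nabla_form_tensorial oU Ux sX sa)
  (@vfield_framed R n M) oU Ux sE' sY Ex).
Qed.

Lemma extend_vfield U x v : open U -> tangent x v -> vfield U (extend x v).
Proof. by move=> oU /extendP[sE _]; exact: vrestrict oU (@subsetT _ U) sE. Qed.

Lemma extend_val x (v : tvec M) : tangent x v -> extend x v x = v.
Proof. by move=> /extendP[]. Qed.

Lemma cotangent_nabla_form U X alpha x : open U -> U x -> vfield U X -> oneform U alpha ->
  cotangent x (nabla_form nabla X alpha x).
Proof.
move=> oU Ux sX sa; split=> [r v w tv tw|v nv]; last first.
  by rewrite /nabla_form; case: asboolP.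
have sv := extend_vfield oU tv; have sw := extend_vfield oU tw.
have sr : smooth U (fun=> r) by move=> y _; exact: smooth_near_cst.
have := tensorial_linear (nabla_form_tensorial oU Ux sX sa) oU Ux sr sv sw.
rewrite -!(nabla_formE oU) ?extend_val//.
exact: (sheaf_linear (vfield_sheaf M)).
Qed.

Lemma oneform_nabla_form U X alpha : open U -> vfield U X -> oneform U alpha ->
  oneform U (nabla_form nabla X alpha).
Proof.
move=> oU sX sa; split=> [x Ux|V Y oV VU sY]; first exact: cotangent_nabla_form sX sa.
have {}sX := vrestrict oV VU sX; have {}sa := frestrict oV VU sa.
apply: (smooth_ext (f := fun y => act X (pairing alpha Y) y - pairing alpha (nabla X Y) y)) => //.
  by move=> y Vy; rewrite /pairing (nabla_formE oV).
move=> y Vy; apply: smooth_nearB.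
  exact: (smooth_act sX (smooth_pairing oV sa sY)).
exact: (smooth_pairing oV sa (nabla_vfield conn oV sX sY)).
Qed.

Lemma nabla_form_eql U X X' alpha x : open U -> U x -> vfield U X -> vfield U X' ->
  oneform U alpha -> X x = X' x -> nabla_form nabla X alpha x = nabla_form nabla X' alpha x.
Proof.
move=> oU Ux sX sX' sa XX'; apply: cotangent_ext.
- exact: cotangent_nabla_form sX sa.
- exact: cotangent_nabla_form sX' sa.
move=> v tv; have sv := extend_vfield oU tv.
by rewrite -(extend_val tv) !(nabla_formE oU) // XX' (nabla_eql oU Ux sX sX' sv XX').
Qed.

Lemma nabla_form_combl U X Y Z r alpha x : open U -> U x -> vfield U X -> vfield U Y ->
  vfield U Z -> oneform U alpha -> Z x = r *: X x + Y x ->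
  nabla_form nabla Z alpha x = r *: nabla_form nabla X alpha x + nabla_form nabla Y alpha x.
Proof.
move=> oU Ux sX sY sZ sa Zx; apply: cotangent_ext.
- exact: cotangent_nabla_form sZ sa.
- by apply: cotangentL; [exact: cotangent_nabla_form sX sa|exact: cotangent_nabla_form sY sa].
move=> v tv; have sv := extend_vfield oU tv.
rewrite -(extend_val tv) !fct_addE fct_scaleE !(nabla_formE oU) //.
rewrite (nabla_combl oU Ux sX sY sZ sv Zx) (covecL (oneform_cotangent sa Ux)).
- by rewrite Zx !fct_addE fct_scaleE; ring.
- exact: vfield_tangent (nabla_vfield conn oU sX sv) Ux.
- exact: vfield_tangent (nabla_vfield conn oU sY sv) Ux.
Qed.

Lemma nabla_form_eqr U X alpha beta x : open U -> U x -> vfield U X ->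
  oneform U alpha -> oneform U beta -> (forall y, U y -> alpha y = beta y) ->
  nabla_form nabla X alpha x = nabla_form nabla X beta x.
Proof.
move=> oU Ux sX sa sb ab; apply: cotangent_ext.
- exact: cotangent_nabla_form sX sa.
- exact: cotangent_nabla_form sX sb.
move=> v tv; have sv := extend_vfield oU tv.
rewrite -(extend_val tv) !(nabla_formE oU) // ab //; congr (_ - _).
apply: (act_eq oU) => //; first exact: vfield_tangent sX Ux.
by move=> y Uy; rewrite /pairing ab.
Qed.

Lemma nabla_form_linear U X f alpha beta x : open U -> U x -> smooth U f -> vfield U X ->
  oneform U alpha -> oneform U beta ->
  nabla_form nabla X (fun y => f y *: alpha y + beta y) x =
  f x *: nabla_form nabla X alpha x + nabla_form nabla X beta x + X x f *: alpha x.
Proof.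
move=> oU Ux sf sX sa sb; have sfab := sheaf_linear (oneform_sheaf M) oU sf sa sb.
have ca := oneform_cotangent sa Ux.
have cNa := cotangent_nabla_form oU Ux sX sa.
have cNb := cotangent_nabla_form oU Ux sX sb.
apply: cotangent_ext.
- exact: cotangent_nabla_form sX sfab.
- by rewrite addrC; apply: cotangentL => //; exact: cotangentL.
move=> v tv; have sv := extend_vfield oU tv; have tX := vfield_tangent sX Ux.
have spa := smooth_pairing oU sa sv; have spb := smooth_pairing oU sb sv.
rewrite -(extend_val tv) !fct_addE !fct_scaleE !(nabla_formE oU) //.
have -> : pairing (fun y => f y *: alpha y + beta y) (extend x v) =
  (fun y => f y * pairing alpha (extend x v) y + pairing beta (extend x v) y) by [].
rewrite (tangent_fD tX _ (spb _ Ux)); last first.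
  by apply: smooth_nearM; [exact: sf|exact: spa].
rewrite (tangent_fM tX (sf _ Ux) (spa _ Ux)).
by rewrite fct_addE fct_scaleE /pairing; ring.
Qed.

Lemma lieE X Y x f : smooth_near f x -> lie X Y x f = X x (act Y f) - Y x (act X f).
Proof. by move=> sf; rewrite /lie asboolT. Qed.

Hypothesis tors : torsion_free nabla.

(** Absence of torsion makes the bracket a difference of two covariant derivatives, whose tangency
    and smoothness are already known. *)
Lemma vfield_lie U X Y : open U -> vfield U X -> vfield U Y -> vfield U (lie X Y).
Proof.
move=> oU sX sY.
have sN := sheafB (vfield_sheaf M) oU (nabla_vfield conn oU sX sY) (nabla_vfield conn oU sY sX).
by apply: (sheaf_ext (vfield_sheaf M) oU _ sN) => y Uy; exact: tors Uy.
Qed.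

Hypothesis flt : Defs.flat nabla.

(** The dual connection inherits zero curvature: pairing with a field Z yields second derivatives of
    the function alpha(Z), whose commutator is given by the bracket, and the curvature of [nabla] on
    Z, which vanishes; the mixed terms cancel. *)
Lemma nabla_form_flat U X Y alpha x : open U -> U x -> vfield U X -> vfield U Y ->
  oneform U alpha ->
  nabla_form nabla X (nabla_form nabla Y alpha) x
  - nabla_form nabla Y (nabla_form nabla X alpha) x = nabla_form nabla (lie X Y) alpha x.
Proof.
move=> oU Ux sX sY sa; have sL := vfield_lie oU sX sY.
have sXa := oneform_nabla_form oU sX sa; have sYa := oneform_nabla_form oU sY sa.
apply: cotangent_ext.
- rewrite addrC -scaleN1r; apply: cotangentL.
    exact: cotangent_nabla_form sY sXa.
  exact: cotangent_nabla_form sX sYa.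
- exact: cotangent_nabla_form sL sa.
move=> v tv; have sv := extend_vfield oU tv; set Z := extend x v in sv.
have tX := vfield_tangent sX Ux; have tY := vfield_tangent sY Ux.
have ca := oneform_cotangent sa Ux.
have sXZ := nabla_vfield conn oU sX sv; have sYZ := nabla_vfield conn oU sY sv.
rewrite -(extend_val tv) -/Z fct_subE !(nabla_formE oU) //.
have E A : vfield U A -> forall B, vfield U B -> tangent x (B x) ->
    B x (pairing (nabla_form nabla A alpha) Z) =
    B x (act A (pairing alpha Z)) - B x (pairing alpha (nabla A Z)).
  move=> sA B sB tB; rewrite -(tangent_fB tB) //.
  - by apply: (act_eq oU) => // y Uy; rewrite /pairing (nabla_formE oU).
  - exact: (smooth_act sA (smooth_pairing oU sa sv)).
  - exact: (smooth_pairing oU sa (nabla_vfield conn oU sA sv)).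
rewrite !E //.
rewrite lieE; last exact: (smooth_pairing oU sa sv).
have /eqP := flt oU sX sY sv Ux.
rewrite subr_eq0 => /eqP <-; rewrite (covecB ca); first by ring.
- exact: vfield_tangent (nabla_vfield conn oU sX sYZ) Ux.
- exact: vfield_tangent (nabla_vfield conn oU sY sXZ) Ux.
Qed.

End CovariantDerivatives.

(** * The contravariant connection of a Koszul-Vinberg manifold *)

Section KoszulVinbergCalculus.
Variables (R : realType) (n : nat) (M : manifold R n).
Variables (nabla : connection_op M) (h : M -> covec M -> covec M -> R).
Hypothesis bv : symmetric_bivector h.
Implicit Types (U V : set M) (f g : M -> R) (X Y Z : M -> tvec M)
  (alpha beta gamma : M -> covec M) (x : M).

Notation vrestrict := (sheaf_restrict (vfield_sheaf M)).
Notation frestrict := (sheaf_restrict (oneform_sheaf M)).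

Lemma bivectorC x a b : cotangent x a -> cotangent x b -> h x a b = h x b a.
Proof. exact: bivector_sym. Qed.

Lemma bivectorLl x r a a' b : cotangent x a -> cotangent x a' -> cotangent x b ->
  h x (r *: a + a') b = r * h x a b + h x a' b.
Proof. exact: bivector_linear. Qed.

Lemma bivectorLr x r a b b' : cotangent x a -> cotangent x b -> cotangent x b' ->
  h x a (r *: b + b') = r * h x a b + h x a b'.
Proof.
move=> ca cb cb'; rewrite bivectorC ?bivectorLl //; last exact: cotangentL.
by rewrite !(@bivectorC x a).
Qed.

Lemma bivector0r x a : cotangent x a -> h x a 0 = 0.
Proof.
move=> ca; have c0 := cotangent0 x; have := bivectorLr 1 ca c0 c0.
by rewrite scaler0 addr0 mul1r => /eqP; rewrite -subr_eq subrr eq_sym => /eqP.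
Qed.

Lemma bivector_sumr x a p (l : 'I_p -> R) (F : 'I_p -> covec M) : cotangent x a ->
  (forall i, cotangent x (F i)) -> h x a (\sum_i l i *: F i) = \sum_i l i * h x a (F i).
Proof.
move=> ca cF; elim: p l F cF => [|p IH] l F cF; first by rewrite !big_ord0 bivector0r.
rewrite !big_ord_recl bivectorLr // ?IH //.
by apply: cotangent_sum => i; exact: cotangentZ.
Qed.

(** [sharp] is a choice, so a witness is due: in a chart it is the vector with components h(a,
    dx^i). *)
Lemma sharpP x a : cotangent x a ->
  tangent x (sharp h x a) /\ forall b, cotangent x b -> b (sharp h x a) = h x a b.
Proof.
move=> ca; rewrite /sharp; set P := [set v | _].
suff : exists v, P v by move=> /(xgetPex 0).
have [c ac sx] := atlas_covers x.
exists (\sum_i h x a (dform (coordf c i) x) *: cvec c i x); split.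
  by apply: tangent_sum => i; apply: tangentZ; exact: tangent_cvec.
move=> b cb; rewrite (covec_sum cb); last by move=> i; exact: tangent_cvec.
rewrite {2}(cotangent_expand ac sx cb) bivector_sumr //; last first.
  by move=> i; exact: cotangent_dform.
by apply: eq_bigr => i _; rewrite mulrC.
Qed.

Lemma tangent_sharp x a : cotangent x a -> tangent x (sharp h x a).
Proof. by case/sharpP. Qed.

Lemma sharpE x a b : cotangent x a -> cotangent x b -> b (sharp h x a) = h x a b.
Proof. by case/sharpP=> _; apply. Qed.

Lemma tangent_sep x v w : tangent x v -> tangent x w ->
  (forall b, cotangent x b -> b v = b w) -> v = w.
Proof.
move=> tv tw vw; have [c ac sx] := atlas_covers x.
apply: (tangent_inj ac sx tv tw) => i.
by rewrite -(dformE _ tv) -(dformE _ tw); apply: vw; exact: cotangent_dform.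
Qed.

Lemma sharpL x r a b : cotangent x a -> cotangent x b ->
  sharp h x (r *: a + b) = r *: sharp h x a + sharp h x b.
Proof.
move=> ca cb; have cab := cotangentL r ca cb.
apply: (@tangent_sep x); first exact: tangent_sharp.
  by apply: tangentL; exact: tangent_sharp.
move=> d cd; rewrite (covecL cd) ?sharpE ?bivectorLl//; exact: tangent_sharp.
Qed.

Lemma vfield_sharp U alpha : open U -> oneform U alpha -> vfield U (sharp_form h alpha).
Proof.
move=> oU sa; apply: (sheaf_glue (vfield_sheaf M)) => // y Uy.
have [c ac sy] := atlas_covers y; have oc := open_source c.
exists (U `&` source c); split=> //; first exact: openI.
have oW : open (U `&` source c) by exact: openI.
have WU := @subIsetl _ U (source c); have Wc := @subIsetr _ U (source c).
have sa' := frestrict oW WU sa.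
apply: (vfield_coords oW ac Wc) => [z Wz|i].
  by apply: tangent_sharp; exact: oneform_cotangent sa' Wz.
have sd : oneform (U `&` source c) (dform (coordf c i)).
  by apply: oneform_dform; exact: smooth_restrict Wc (smooth_coordf i ac).
apply: smooth_ext (bivector_smooth bv oW sa' sd) => // z Wz.
have caz := oneform_cotangent sa' Wz.
by rewrite -sharpE ?dformE //; [exact: tangent_sharp|exact: cotangent_dform].
Qed.

Lemma smooth_bivector U alpha beta : open U -> oneform U alpha -> oneform U beta ->
  smooth U (fun y => h y (alpha y) (beta y)).
Proof. exact: bivector_smooth. Qed.

Hypothesis conn : is_connection nabla.
Notation nf := (nabla_form nabla).
Notation nh := (nabla_h nabla h).

Lemma nabla_hC U X alpha beta x : open U -> U x -> vfield U X -> oneform U alpha ->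
  oneform U beta -> nh X alpha beta x = nh X beta alpha x.
Proof.
move=> oU Ux sX sa sb.
have ca := oneform_cotangent sa Ux; have cb := oneform_cotangent sb Ux.
have cNa := cotangent_nabla_form conn oU Ux sX sa.
have cNb := cotangent_nabla_form conn oU Ux sX sb.
rewrite /nabla_h (bivectorC cNa cb) (bivectorC ca cNb).
rewrite (act_eq (g := fun y => h y (beta y) (alpha y)) oU) //; first by ring.
  exact: vfield_tangent sX Ux.
move=> y Uy; apply: bivectorC.
  exact: oneform_cotangent sa Uy.
exact: oneform_cotangent sb Uy.
Qed.

(** The terms X(f) h(alpha, beta) from the Leibniz rules for functions and for forms cancel. *)
Lemma nabla_h_linear U X f alpha alpha' beta x : open U -> U x -> smooth U f ->
  vfield U X -> oneform U alpha -> oneform U alpha' -> oneform U beta ->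
  nh X (fun y => f y *: alpha y + alpha' y) beta x =
  f x * nh X alpha beta x + nh X alpha' beta x.
Proof.
move=> oU Ux sf sX sa sa' sb.
have ca := oneform_cotangent sa Ux; have ca' := oneform_cotangent sa' Ux.
have cb := oneform_cotangent sb Ux; have tX := vfield_tangent sX Ux.
have cNa := cotangent_nabla_form conn oU Ux sX sa.
have cNa' := cotangent_nabla_form conn oU Ux sX sa'.
have cNb := cotangent_nabla_form conn oU Ux sX sb.
rewrite /nabla_h (act_eq (g := fun y => f y * h y (alpha y) (beta y) + h y (alpha' y) (beta y)) oU) //;
  last first.
  move=> y Uy; apply: bivectorLl; [exact: oneform_cotangent sa Uy|
    exact: oneform_cotangent sa' Uy|exact: oneform_cotangent sb Uy].
have sh := smooth_bivector oU sa sb; have sh' := smooth_bivector oU sa' sb.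
rewrite (tangent_fD tX _ (sh' _ Ux)); last first.
  by apply: smooth_nearM; [exact: sf|exact: sh].
rewrite (tangent_fM tX (sf _ Ux) (sh _ Ux)).
rewrite (nabla_form_linear conn oU Ux sf sX sa sa') (bivectorLl _ ca ca' cNb).
rewrite [_ + _ + _ *: alpha x]addrC !bivectorLl //; last exact: cotangentL.
by ring.
Qed.

Lemma nabla_h_eq_on U X alpha alpha' beta x : open U -> U x -> vfield U X ->
  oneform U alpha -> oneform U alpha' -> oneform U beta ->
  (forall y, U y -> alpha y = alpha' y) -> nh X alpha beta x = nh X alpha' beta x.
Proof.
move=> oU Ux sX sa sa' sb aa'; rewrite /nabla_h aa' //.
rewrite (nabla_form_eqr conn oU Ux sX sa sa' aa'); congr (_ - _ - _).
apply: (act_eq oU) => //; first exact: vfield_tangent sX Ux.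
by move=> y Uy; rewrite aa'.
Qed.

Lemma nabla_h_tensorial U X beta x : open U -> U x -> vfield U X -> oneform U beta ->
  tensorial (@oneform R n M) x (fun alpha => nh X alpha beta x : R^o).
Proof.
move=> oU Ux sX sb; split=> [V a a' oV Vx sa sa' aa'|V f a a' oV Vx sf sa sa'];
  have oW : open (U `&` V) by exact: openI.
all: have WU := @subIsetl _ U V; have WV := @subIsetr _ U V.
  apply: (nabla_h_eq_on oW _ (vrestrict oW WU sX) (frestrict oW WV sa)
    (frestrict oW WV sa') (frestrict oW WU sb)) => // y [_ Vy]; exact: aa'.
by apply: (nabla_h_linear oW _ (smooth_restrict WV sf) (vrestrict oW WU sX)
  (frestrict oW WV sa) (frestrict oW WV sa') (frestrict oW WU sb)).
Qed.

Lemma nabla_h_combl U X Y Z r alpha beta x : open U -> U x -> vfield U X -> vfield U Y ->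
  vfield U Z -> oneform U alpha -> oneform U beta -> Z x = r *: X x + Y x ->
  nh Z alpha beta x = r * nh X alpha beta x + nh Y alpha beta x.
Proof.
move=> oU Ux sX sY sZ sa sb Zx.
have ca := oneform_cotangent sa Ux; have cb := oneform_cotangent sb Ux.
have cXa := cotangent_nabla_form conn oU Ux sX sa.
have cYa := cotangent_nabla_form conn oU Ux sY sa.
have cXb := cotangent_nabla_form conn oU Ux sX sb.
have cYb := cotangent_nabla_form conn oU Ux sY sb.
rewrite /nabla_h (nabla_form_combl conn oU Ux sX sY sZ sa Zx).
rewrite (nabla_form_combl conn oU Ux sX sY sZ sb Zx) Zx fct_addE fct_scaleE.
by rewrite bivectorLl // bivectorLr //; ring.
Qed.

(** Tensoriality in the first form is transferred to the second by the symmetry [nabla_hC]; in the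
    field it comes from that of [nabla_form]. *)
Lemma nabla_h_eq U X X' alpha alpha' beta beta' x : open U -> U x ->
  vfield U X -> vfield U X' -> oneform U alpha -> oneform U alpha' ->
  oneform U beta -> oneform U beta' ->
  X x = X' x -> alpha x = alpha' x -> beta x = beta' x ->
  nh X alpha beta x = nh X' alpha' beta' x.
Proof.
move=> oU Ux sX sX' sa sa' sb sb' XX' aa' bb'.
have H (a a' b : M -> covec M) : oneform U a -> oneform U a' -> oneform U b ->
    a x = a' x -> nh X a b x = nh X a' b x.
  move=> ha ha' hb.
  exact: (tensorial_eq (oneform_sheaf M) (nabla_h_tensorial oU Ux sX hb)
    (@oneform_framed R n M) oU Ux ha ha').
rewrite (H _ _ _ sa sa' sb aa') (nabla_hC oU Ux sX sa' sb) (H _ _ _ sb sb' sa' bb').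
rewrite (nabla_hC oU Ux sX sb' sa').
by rewrite /nabla_h XX' !(nabla_form_eql conn oU Ux sX sX' _ XX').
Qed.

Lemma smooth_nabla_h U X alpha beta : open U -> vfield U X ->
  oneform U alpha -> oneform U beta -> smooth U (nh X alpha beta).
Proof.
move=> oU sX sa sb y Uy; apply: smooth_nearB; first apply: smooth_nearB.
- exact: (smooth_act sX (smooth_bivector oU sa sb)).
- exact: (smooth_bivector oU (oneform_nabla_form conn oU sX sa) sb).
- exact: (smooth_bivector oU sa (oneform_nabla_form conn oU sX sb)).
Qed.

(** The form S(alpha, beta) of the overview: the part of [contravariant] that is symmetric in its
    two arguments. *)
Definition nabla_h_form alpha beta : M -> covec M :=
  fun x v => if `[< tangent x v >] then nh (extend x v) alpha beta x else 0.

Notation S := nabla_h_form.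

Lemma nabla_h_formE U X alpha beta x : open U -> U x -> vfield U X ->
  oneform U alpha -> oneform U beta -> S alpha beta x (X x) = nh X alpha beta x.
Proof.
move=> oU Ux sX sa sb; have tX := vfield_tangent sX Ux.
rewrite /S asboolT //; apply: (nabla_h_eq oU) => //; first exact: extend_vfield.
exact: extend_val.
Qed.

Lemma oneform_nabla_h_form U alpha beta : open U -> oneform U alpha -> oneform U beta ->
  oneform U (S alpha beta).
Proof.
move=> oU sa sb; split=> [x Ux|V X oV VU sX]; last first.
  have sa' := frestrict oV VU sa; have sb' := frestrict oV VU sb.
  apply: smooth_ext (smooth_nabla_h oV sX sa' sb') => // y Vy.
  by rewrite /pairing (nabla_h_formE oV).
split=> [r v w tv tw|v nv]; last by rewrite /S; case: asboolP.
have tvw := tangentL r tv tw; rewrite /S !asboolT //.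
by apply: (nabla_h_combl oU) => //; rewrite ?extend_val //; exact: extend_vfield.
Qed.

Lemma contravariantE U X alpha beta x : open U -> U x -> vfield U X ->
  oneform U alpha -> oneform U beta ->
  contravariant nabla h alpha beta x (X x) =
  nh X alpha beta x + nf (sharp_form h alpha) beta x (X x).
Proof.
move=> oU Ux sX sa sb; have tX := vfield_tangent sX Ux.
rewrite -(nabla_h_formE oU Ux sX sa sb) /S /contravariant !asboolT //.
Qed.

Lemma contravariant_sum U alpha beta x : open U -> U x ->
  oneform U alpha -> oneform U beta ->
  contravariant nabla h alpha beta x = S alpha beta x + nf (sharp_form h alpha) beta x.
Proof.
move=> oU Ux sa sb; apply/funext => v; rewrite fct_addE /contravariant /S /nabla_form.
by case: asboolP => _ //; rewrite [RHS]addr0.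
Qed.

Lemma oneform_contravariant U alpha beta : open U -> oneform U alpha -> oneform U beta ->
  oneform U (contravariant nabla h alpha beta).
Proof.
move=> oU sa sb; have := sheafD (oneform_sheaf M) oU (oneform_nabla_h_form oU sa sb)
  (oneform_nabla_form conn oU (vfield_sharp oU sa) sb).
apply: (sheaf_ext (oneform_sheaf M)) => // y Uy; by rewrite (contravariant_sum oU).
Qed.

(** By duality h(alpha, nabla_X beta) is (nabla_X beta)(alpha^#), which is then expanded. The result
    measures how far the derivative of alpha^# is from the sharp of the derivative of alpha. *)
Lemma nabla_hE U X alpha beta x : open U -> U x -> vfield U X ->
  oneform U alpha -> oneform U beta ->
  nh X alpha beta x = beta x (nabla X (sharp_form h alpha) x)
                      - nf X alpha x (sharp_form h beta x).
Proof.
move=> oU Ux sX sa sb; have tX := vfield_tangent sX Ux.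
have ca := oneform_cotangent sa Ux; have cb := oneform_cotangent sb Ux.
have cNa := cotangent_nabla_form conn oU Ux sX sa.
have cNb := cotangent_nabla_form conn oU Ux sX sb.
have ssa := vfield_sharp oU sa.
rewrite /nabla_h -(sharpE ca cNb) (bivectorC cNa cb) -(sharpE cb cNa).
rewrite -[sharp h x (alpha x)]/(sharp_form h alpha x) (nabla_formE conn oU) //.
rewrite (act_eq (g := pairing beta (sharp_form h alpha)) oU) //; first by rewrite /sharp_form; ring.
move=> y Uy; rewrite /pairing /sharp_form sharpE //.
  exact: oneform_cotangent sa Uy.
exact: oneform_cotangent sb Uy.
Qed.

Lemma contravariant_linearl U f alpha alpha' beta x : open U -> U x -> smooth U f ->
  oneform U alpha -> oneform U alpha' -> oneform U beta ->
  contravariant nabla h (fun y => f y *: alpha y + alpha' y) beta x =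
  f x *: contravariant nabla h alpha beta x + contravariant nabla h alpha' beta x.
Proof.
move=> oU Ux sf sa sa' sb; have sl := sheaf_linear (oneform_sheaf M) oU sf sa sa'.
have cD a : oneform U a -> cotangent x (contravariant nabla h a beta x).
  by move=> ha; exact: oneform_cotangent (oneform_contravariant oU ha sb) Ux.
apply: cotangent_ext; [exact: cD|by apply: cotangentL; exact: cD|].
move=> v tv; have sX := extend_vfield oU tv.
rewrite -(extend_val tv) fct_addE fct_scaleE !(contravariantE oU Ux sX) //.
rewrite (nabla_h_linear oU Ux sf sX sa sa' sb).
rewrite (nabla_form_combl conn oU Ux (vfield_sharp oU sa) (vfield_sharp oU sa')
  (vfield_sharp oU sl) sb (r := f x)); first by rewrite fct_addE fct_scaleE; ring.
by apply: sharpL; [exact: oneform_cotangent sa Ux|exact: oneform_cotangent sa' Ux].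
Qed.

Lemma contravariant_linearr U f alpha beta beta' x : open U -> U x -> smooth U f ->
  oneform U alpha -> oneform U beta -> oneform U beta' ->
  contravariant nabla h alpha (fun y => f y *: beta y + beta' y) x =
  f x *: contravariant nabla h alpha beta x + contravariant nabla h alpha beta' x
  + sharp_form h alpha x f *: beta x.
Proof.
move=> oU Ux sf sa sb sb'; have sl := sheaf_linear (oneform_sheaf M) oU sf sb sb'.
have cD b : oneform U b -> cotangent x (contravariant nabla h alpha b x).
  by move=> hb; exact: oneform_cotangent (oneform_contravariant oU sa hb) Ux.
have cb := oneform_cotangent sb Ux.
apply: cotangent_ext; first exact: cD.
  by rewrite addrC; apply: cotangentL => //; apply: cotangentL; exact: cD.
move=> v tv; have sX := extend_vfield oU tv; have ssa := vfield_sharp oU sa.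
rewrite -(extend_val tv) !fct_addE !fct_scaleE !(contravariantE oU Ux sX) //.
rewrite (nabla_hC oU Ux sX sa sl) (nabla_h_linear oU Ux sf sX sb sb' sa).
rewrite (nabla_hC oU Ux sX sb sa) (nabla_hC oU Ux sX sb' sa).
rewrite (nabla_form_linear conn oU Ux sf ssa sb sb') !fct_addE !fct_scaleE.
by ring.
Qed.

Hypothesis kv : forall alpha beta gamma,
  oneform setT alpha -> oneform setT beta -> oneform setT gamma ->
  nh (sharp_form h alpha) beta gamma = nh (sharp_form h beta) alpha gamma.

(** The hypothesis concerns global forms; tensoriality lets each local form be replaced by a global
    one with the same value at [x]. *)
Lemma kv_local U alpha beta gamma x : open U -> U x ->
  oneform U alpha -> oneform U beta -> oneform U gamma ->
  nh (sharp_form h alpha) beta gamma x = nh (sharp_form h beta) alpha gamma x.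
Proof.
move=> oU Ux sa sb sc.
have [a0 sa0 a0x] := oneform_value (oneform_cotangent sa Ux).
have [b0 sb0 b0x] := oneform_value (oneform_cotangent sb Ux).
have [c0 sc0 c0x] := oneform_value (oneform_cotangent sc Ux).
have res := frestrict oU (@subsetT _ U).
have := congr1 (fun f => f x) (kv sa0 sb0 sc0).
rewrite (nabla_h_eq oU Ux _ (vfield_sharp oU sa) (res _ sb0) sb (res _ sc0) sc) //.
- rewrite (nabla_h_eq oU Ux _ (vfield_sharp oU sb) (res _ sa0) sa (res _ sc0) sc) //.
    exact: vfield_sharp oU (res _ sb0).
  by rewrite /sharp_form b0x.
- exact: vfield_sharp oU (res _ sa0).
- by rewrite /sharp_form a0x.
Qed.

(** Tested against a covector c, the left side is (nabla_{c^#} h)(alpha, beta) + (nabla_{alpha^#}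
    beta)(c^#). The K-V condition moves c^# out of the differentiating slot, and [nabla_hE] then
    leaves c(nabla_{alpha^#} beta^#). *)
Lemma sharp_contravariant U alpha beta x : open U -> U x ->
  oneform U alpha -> oneform U beta ->
  sharp h x (contravariant nabla h alpha beta x) =
  nabla (sharp_form h alpha) (sharp_form h beta) x.
Proof.
move=> oU Ux sa sb; have ssa := vfield_sharp oU sa; have ssb := vfield_sharp oU sb.
have sD := oneform_contravariant oU sa sb; have cD := oneform_cotangent sD Ux.
apply: (@tangent_sep x); first exact: tangent_sharp.
  exact: vfield_tangent (nabla_vfield conn oU ssa ssb) Ux.
move=> c /[dup] cc /oneform_value[c0 sc0 c0x].
have sc := frestrict oU (@subsetT _ U) sc0; have ssc := vfield_sharp oU sc.
have ca := oneform_cotangent sa Ux; have cb := oneform_cotangent sb Ux.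
have Nb := cotangent_nabla_form conn oU Ux ssa sb.
rewrite sharpE // bivectorC // -sharpE // -c0x -[sharp h x _]/(sharp_form h c0 x).
rewrite (contravariantE oU) // (kv_local oU) // (nabla_hC oU) // (nabla_hE oU) //.
by rewrite subrK.
Qed.

Lemma nabla_hDl U X alpha alpha' alpha'' beta x : open U -> U x -> vfield U X ->
  oneform U alpha -> oneform U alpha' -> oneform U alpha'' -> oneform U beta ->
  alpha'' x = alpha x + alpha' x ->
  nh X alpha'' beta x = nh X alpha beta x + nh X alpha' beta x.
Proof.
move=> oU Ux sX sa sa' sa'' sb E.
have s1 : smooth U (cst 1 : M -> R) by move=> y _; exact: smooth_near_cst.
rewrite -[nh X alpha beta x]mul1r -(nabla_h_linear oU Ux s1 sX sa sa' sb).
apply: (nabla_h_eq oU) => //; last by rewrite E scale1r.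
exact: (sheaf_linear (oneform_sheaf M)).
Qed.

Lemma bivectorBl x a a' b : cotangent x a -> cotangent x a' -> cotangent x b ->
  h x (a - a') b = h x a b - h x a' b.
Proof.
by move=> ca ca' cb; rewrite [a - a']addrC -scaleN1r bivectorLl // mulN1r addrC.
Qed.

(** * Second derivatives of the bivector and left symmetry of the contravariant connection *)

Hypothesis tors : torsion_free nabla.
Hypothesis flt : Defs.flat nabla.

(** A Ricci identity: the curvature acting on [beta] and [gamma] is zero, so only the bracket term
    and the derivatives of the two arguments remain. *)
Lemma nabla_h_commutator U X Y beta gamma x : open U -> U x -> vfield U X -> vfield U Y ->
  oneform U beta -> oneform U gamma ->
  X x (nh Y beta gamma) - Y x (nh X beta gamma) = nh (lie X Y) beta gamma x
   + nh Y (nf X beta) gamma x + nh Y beta (nf X gamma) x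
   - nh X (nf Y beta) gamma x - nh X beta (nf Y gamma) x.
Proof.
move=> oU Ux sX sY sb sc; have sL := vfield_lie conn tors oU sX sY.
have cb := oneform_cotangent sb Ux; have cc := oneform_cotangent sc Ux.
have sXb := oneform_nabla_form conn oU sX sb; have sYb := oneform_nabla_form conn oU sY sb.
have sXc := oneform_nabla_form conn oU sX sc; have sYc := oneform_nabla_form conn oU sY sc.
have E A B : vfield U A -> vfield U B -> A x (nh B beta gamma) =
   A x (act B (fun y => h y (beta y) (gamma y)))
   - A x (fun y => h y (nf B beta y) (gamma y)) - A x (fun y => h y (beta y) (nf B gamma y)).
  move=> sA sB; have tA := vfield_tangent sA Ux.
  have sBb := oneform_nabla_form conn oU sB sb; have sBc := oneform_nabla_form conn oU sB sc.
  have s1 := smooth_act sB (smooth_bivector oU sb sc).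
  have s2 := smooth_bivector oU sBb sc; have s3 := smooth_bivector oU sb sBc.
  rewrite -(tangent_fB tA (s1 _ Ux) (s2 _ Ux)) -(tangent_fB tA _ (s3 _ Ux)) //.
  by apply: smooth_nearB; [exact: s1|exact: s2].
rewrite !E // {E} /nabla_h -!(nabla_form_flat conn tors flt oU Ux sX sY) //.
rewrite lieE; last exact: (smooth_bivector oU sb sc).
have cXYb := oneform_cotangent (oneform_nabla_form conn oU sX sYb) Ux.
have cYXb := oneform_cotangent (oneform_nabla_form conn oU sY sXb) Ux.
have cXYc := oneform_cotangent (oneform_nabla_form conn oU sX sYc) Ux.
have cYXc := oneform_cotangent (oneform_nabla_form conn oU sY sXc) Ux.
rewrite (bivectorBl cXYb cYXb cc) (bivectorC cb _); last first.
  by rewrite addrC -scaleN1r; exact: cotangentL.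
rewrite (bivectorBl cXYc cYXc cb) !(bivectorC _ cb) //.
by ring.
Qed.

(* All terms on the right but the first and the third cancel under the exchange of
   [alpha] and [beta], the second and the sixth by the K-V condition. *)
Lemma contravariant_iter U X alpha beta gamma x : open U -> U x -> vfield U X ->
  oneform U alpha -> oneform U beta -> oneform U gamma ->
  let a := sharp_form h alpha in let b := sharp_form h beta in
  contravariant nabla h alpha (contravariant nabla h beta gamma) x (X x) =
  nf a (nf b gamma) x (X x) + X x (nh a beta gamma)
  + nh X (nf a beta) gamma x + nh X beta (nf a gamma) x + nh X alpha (nf b gamma) x
  - nh a beta (nf X gamma) x - nh a (nf X beta) gamma x - nh b (nf X alpha) gamma x.
Proof.
move=> oU Ux sX sa sb sc a b.
have ssa : vfield U a := vfield_sharp oU sa; have ssb : vfield U b := vfield_sharp oU sb.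
have sS := oneform_nabla_h_form oU sb sc; have sbc := oneform_nabla_form conn oU ssb sc.
have sD := oneform_contravariant oU sb sc.
have D y : U y -> contravariant nabla h beta gamma y = S beta gamma y + nf b gamma y.
  by move=> Uy; rewrite (contravariant_sum oU).
have saX := nabla_vfield conn oU ssa sX; have sXa := nabla_vfield conn oU sX ssa.
have sXal := oneform_nabla_form conn oU sX sa.
rewrite (contravariantE oU Ux sX sa sD) (nabla_hC oU) //.
rewrite (nabla_hDl oU Ux sX sS sbc sD sa (D x Ux)).
rewrite (nabla_hC oU Ux sX sS sa) (nabla_hC oU Ux sX sbc sa).
(* By [nabla_hE] this is S evaluated on nabla_X a, minus S evaluated on (nabla_X alpha)^#; in the
   latter the K-V condition exchanges [beta] with nabla_X alpha. *)
have -> : nh X alpha (S beta gamma) x = nh (nabla X a) beta gamma x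
     - nh b (nf X alpha) gamma x.
  rewrite (nabla_hE oU Ux sX sa sS) (nabla_h_formE oU Ux sXa sb sc); congr (_ - _).
  have cS := oneform_cotangent sS Ux; have cXal := oneform_cotangent sXal Ux.
  rewrite /sharp_form sharpE // bivectorC // -sharpE // -[sharp h x _]/(sharp_form h (nf X alpha) x).
  by rewrite (nabla_h_formE oU Ux (vfield_sharp oU sXal) sb sc) (kv_local oU).
have -> : nf a (contravariant nabla h beta gamma) x (X x) =
    nf a (S beta gamma) x (X x) + nf a (nf b gamma) x (X x).
  have s1 : smooth U (cst 1 : M -> R) by move=> y _; exact: smooth_near_cst.
  have sl := sheaf_linear (oneform_sheaf M) oU s1 sS sbc.
  rewrite (nabla_form_eqr conn oU Ux ssa sD sl); last by move=> y Uy; rewrite scale1r D.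
  rewrite (nabla_form_linear conn oU Ux s1 ssa sS sbc) (tangent_cst _ (vfield_tangent ssa Ux)).
  by rewrite scale0r addr0 scale1r.
rewrite (nabla_formE conn oU Ux ssa sX sS) (nabla_h_formE oU Ux saX sb sc).
rewrite (act_eq (g := nh X beta gamma) oU Ux (vfield_tangent ssa Ux)); last first.
  by move=> y Uy; rewrite /pairing (nabla_h_formE oU).
have := nabla_h_commutator oU Ux ssa sX sb sc.
have sL := vfield_lie conn tors oU ssa sX.
(* Absence of torsion splits the bracket, so that the derivatives of [h] along nabla_a X and nabla_X
   a cancel against those found above. *)
have -> : nh (lie a X) beta gamma x = nh (nabla a X) beta gamma x - nh (nabla X a) beta gamma x.
  rewrite (nabla_h_combl (r := -1) oU Ux sXa saX sL sb sc); first by ring.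
  by rewrite -(tors oU ssa sX Ux) scaleN1r addrC.
(* Only a linear identity between real numbers is left; the terms are made opaque for [lra]. *)
move: (X x (nh a _ _)) (a x _) (nh (nabla a X) _ _ x) (nh (nabla X a) _ _ x)
  (nh X (nf a beta) _ x) (nh X beta _ x) (nh a (nf X beta) _ x) (nh a beta _ x)
  (nh b _ _ x) (nh X alpha _ x) (nf a _ x (X x)) => t1 t2 t3 t4 t5 t6 t7 t8 t9 t10 t11.
lra.
Qed.

Lemma contravariant_left_symmetric U alpha beta gamma x : open U -> U x ->
  oneform U alpha -> oneform U beta -> oneform U gamma ->
  let D := contravariant nabla h in
  D (D alpha beta) gamma x - D alpha (D beta gamma) x =
  D (D beta alpha) gamma x - D beta (D alpha gamma) x.
Proof.
move=> oU Ux sa sb sc D; set a := sharp_form h alpha; set b := sharp_form h beta.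
have ssa : vfield U a := vfield_sharp oU sa; have ssb : vfield U b := vfield_sharp oU sb.
have sab := oneform_contravariant oU sa sb; have sba := oneform_contravariant oU sb sa.
have sac := oneform_contravariant oU sa sc; have sbc := oneform_contravariant oU sb sc.
have cB y u v : cotangent y u -> cotangent y v -> cotangent y (u - v).
  by move=> cu cv; rewrite addrC -scaleN1r; exact: cotangentL.
apply: cotangent_ext.
- by apply: cB; apply: oneform_cotangent Ux; exact: oneform_contravariant.
- by apply: cB; apply: oneform_cotangent Ux; exact: oneform_contravariant.
move=> v tv; have sX := extend_vfield oU tv; set X := extend x v in sX.
rewrite -(extend_val tv) -/X !fct_subE /D !(contravariant_iter oU) // -/a -/b.
have sNab := nabla_vfield conn oU ssa ssb; have sNba := nabla_vfield conn oU ssb ssa.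
rewrite (contravariantE oU Ux sX sab sc) (contravariantE oU Ux sX sba sc).
(* The derivative along (D_alpha beta)^# becomes the derivative along nabla_a b, to which flatness
   and absence of torsion apply. *)
rewrite (nabla_form_eql conn oU Ux (vfield_sharp oU sab) sNab sc); last first.
  exact: (sharp_contravariant oU).
rewrite (nabla_form_eql conn oU Ux (vfield_sharp oU sba) sNba sc); last first.
  exact: (sharp_contravariant oU).
have sfa := oneform_nabla_form conn oU ssa sb; have sfb := oneform_nabla_form conn oU ssb sa.
have sS := oneform_nabla_h_form oU sa sb; have sS' := oneform_nabla_h_form oU sb sa.
rewrite (nabla_hDl oU Ux sX sS sfa sab sc (contravariant_sum oU Ux sa sb)).
rewrite (nabla_hDl oU Ux sX sS' sfb sba sc (contravariant_sum oU Ux sb sa)).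
(* The symmetric parts cancel in D_alpha beta - D_beta alpha, leaving nabla_a beta - nabla_b
   alpha. *)
have SS : S alpha beta x = S beta alpha x.
  apply: cotangent_ext; [exact: oneform_cotangent sS Ux|exact: oneform_cotangent sS' Ux|].
  move=> w tw; have sw := extend_vfield oU tw.
  by rewrite -(extend_val tw) !(nabla_h_formE oU) // (nabla_hC oU Ux sw sa sb).
rewrite (nabla_h_eq oU Ux sX sX sS sS' sc sc erefl SS erefl).
have tX := vfield_tangent sX Ux.
(* Here the K-V condition is differentiated along [X], which is legitimate because it holds on all
   of [U] and not just at [x]. *)
rewrite (act_eq (f := nh a beta gamma) (g := nh b alpha gamma) oU Ux tX); last first.
  by move=> y Uy; exact: (kv_local oU).
rewrite (kv_local (gamma := nf X gamma) oU Ux sa sb (oneform_nabla_form conn oU sX sc)).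
have F := congr1 (fun w => w (X x)) (nabla_form_flat conn tors flt oU Ux ssa ssb sc).
have sL := vfield_lie conn tors oU ssa ssb.
have G : nf (nabla a b) gamma x (X x) = nf (nabla b a) gamma x (X x) + nf (lie a b) gamma x (X x).
  rewrite (nabla_form_combl (r := 1) conn oU Ux sNba sL sNab sc) ?scale1r//.
  by rewrite -(tors oU ssa ssb Ux) addrC subrK.
move: F G; rewrite fct_subE.
move: (nh X (S _ _) _ x) (nh X (nf a beta) _ x) (nh X (nf b alpha) _ x)
  (nf (nabla a b) _ x (X x)) (nf (nabla b a) _ x (X x)) (nf (lie a b) _ x (X x))
  (nf a (nf b gamma) x (X x)) (nf b (nf a gamma) x (X x)) (X x (nh b _ _))
  (nh X beta _ x) (nh X alpha _ x) (nh b alpha _ x) (nh a (nf X beta) _ x)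
  (nh b (nf X alpha) _ x) => t1 t2 t3 t4 t5 t6 t7 t8 t9 t10 t11 t12 t13 t14.
lra.
Qed.

End KoszulVinbergCalculus.

(** * Existence of solutions of ordinary differential equations *)

Section InitialValueProblem.
Variable R : realType.
Implicit Types (r t : R).

Lemma rV_norm_le p (u : 'rV[R]_p) (d : R) : 0 <= d ->
  (forall i, `|u 0 i| <= d) -> `|u| <= d.
Proof.
move=> d0 ud; rewrite [leLHS]/Num.Def.normr/= mx_normrE.
by apply: bigmax_le => // -[a i] _ /=; rewrite (ord1 a).
Qed.

Lemma rV_coord_le p (u : 'rV[R]_p) i : `|u 0 i| <= `|u|.
Proof.
by rewrite [leRHS]/Num.Def.normr/= mx_normrE; exact: (le_bigmax _ _ (0, i)).
Qed.

Lemma continuous_norm_le (V W : normedModType R) (f : V -> W) (u : V) :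
  (forall e, 0 < e -> exists2 d, 0 < d & forall v, `|u - v| < d -> `|f u - f v| <= e) ->
  {for u, continuous f}.
Proof.
move=> H; apply/cvgrPdist_le => e /H[d d0 Hd]; apply/nbhs_ballP.
by exists d => // v; rewrite -ball_normE /ball_ /=; exact: Hd.
Qed.

(* The truncation of [t] to the interval from [- r] to [r]. *)
Definition clamp r t : R := (`|t + r| - `|t - r|) / 2.

Lemma clamp_le r t : 0 <= r -> `|clamp r t| <= r.
Proof.
move=> r0; rewrite /clamp normrM [`|2^-1|]ger0_norm ?invr_ge0// ler_pdivrMr//.
rewrite (le_trans (ler_dist_dist _ _))//.
have -> : t + r - (t - r) = r * 2 by ring.
by rewrite ger0_norm// mulr_ge0.
Qed.

Lemma clamp_id r t : `|t| <= r -> clamp r t = t.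
Proof.
rewrite ler_norml => /andP[h1 h2]; rewrite /clamp ger0_norm; last by lra.
by rewrite ler0_norm; lra.
Qed.

Lemma clamp_lipschitz r s t : `|clamp r s - clamp r t| <= `|s - t|.
Proof.
have -> : clamp r s - clamp r t =
   ((`|s + r| - `|t + r|) + (`|t - r| - `|s - r|)) / 2 by rewrite /clamp; ring.
rewrite normrM [`|2^-1|]ger0_norm ?invr_ge0// ler_pdivrMr//.
rewrite (le_trans (ler_normD _ _))// mulr_natr mulr2n lerD//.
  rewrite (le_trans (ler_dist_dist _ _))//.
  by have -> : s + r - (t + r) = s - t by ring.
rewrite (le_trans (ler_dist_dist _ _))//.
by have -> : t - r - (s - r) = - (s - t); [ring|rewrite normrN].
Qed.

Lemma clamp_continuous r : continuous (clamp r).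
Proof.
move=> t; apply: continuous_norm_le => e e0; exists e => // s /ltW st.
exact: le_trans (clamp_lipschitz _ _ _) st.
Qed.

(** Integration starts at -1, to the left of 0, so that the derivative is two-sided at 0 and at
    small negative times; the subtracted constant normalises the value at 0. *)
Definition primitive (g : R -> R) (t : R) : R :=
  \int[lebesgue_measure]_(s in `[-1, t]) g s - \int[lebesgue_measure]_(s in `[-1, 0]) g s.

Lemma primitive0 g : primitive g 0 = 0.
Proof. by rewrite /primitive subrr. Qed.

Lemma is_derive_primitive g t : continuous g -> `|t| < 1 ->
  is_derive t 1 (primitive g) (g t).
Proof.
move=> cg; rewrite ltr_norml => /andP[t1 t2].
have ig : lebesgue_measure.-integrable `[-1, 2] (EFin \o g).
  apply: continuous_compact_integrable; first exact: segment_compact.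
  exact: continuous_subspaceT.
have t3 : t < 2 by lra.
have [d1 d2] := continuous_FTC1_closed t3 ig t1 (cg t).
have D : is_derive t 1 (fun t => \int[lebesgue_measure]_(s in `[-1, t]) g s) (g t).
  apply: DeriveDef; first exact: d1.
  by rewrite -derive1E; exact: d2.
rewrite -[g t]subr0; apply: is_deriveB D _.
Qed.

Variables (p : nat) (G : 'rV[R]_p -> 'rV[R]_p) (L : R).
Hypothesis L1 : 1 <= L.
Hypothesis lipG : forall u v, `|G u - G v| <= L * `|u - v|.
Variable z0 : 'rV[R]_p.

(** With this time span the integral operator contracts by the factor L * eps = 1/2; [1 <= L] keeps
    [eps] below 1, within the range of [is_derive_primitive]. *)
Let eps : R := (2 * L)^-1.

Let L0 : 0 < L. Proof. by apply: lt_le_trans L1. Qed.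

Let eps0 : 0 < eps. Proof. by rewrite invr_gt0 mulr_gt0. Qed.

Let eps1 : eps < 1.
Proof. by rewrite invf_lt1 ?mulr_gt0//; have := L1; lra. Qed.

Lemma lipschitz_continuous : continuous G.
Proof.
move=> u; apply: continuous_norm_le => e e0; exists (e / L); first by rewrite divr_gt0.
move=> v uv; rewrite (le_trans (lipG _ _))// -ler_pdivlMl// mulrC; exact: ltW.
Qed.

Lemma continuous_row (T : topologicalType) (f : T -> 'rV[R]_p) (t : T) :
  (forall i, {for t, continuous (fun s => f s 0 i)}) -> {for t, continuous f}.
Proof.
move=> cf; apply/cvgrPdist_le => e e0.
have : \forall s \near t, forall i, `|f t 0 i - f s 0 i| <= e.
  apply: (@filter_forall _ _ (fun i s => `|f t 0 i - f s 0 i| <= e)) => i.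
  by have /cvgrPdist_le := cf i; apply.
apply: filterS => s fs; apply: rV_norm_le; first exact: ltW.
by move=> i; rewrite !mxE.
Qed.

(* Truncating the time lets the iterates be globally continuous functions, although
   [primitive] is a primitive only on the interval from [-1] to [1]. *)
Definition picard_step (z : R -> 'rV[R]_p) (t : R) : 'rV[R]_p :=
  \row_i (z0 0 i + primitive (fun s => G (z s) 0 i) (clamp eps t)).

Lemma continuous_integrand (z : R -> 'rV[R]_p) i : continuous z ->
  continuous (fun s => G (z s) 0 i).
Proof.
move=> cz t; apply: (@continuous_comp _ _ _ z (fun u => G u 0 i)); first exact: cz.
apply: (@continuous_comp _ _ _ G (fun u : 'rV[R]_p => u 0 i)).
  exact: lipschitz_continuous.
exact: matrix_normedtype.coord_continuous.
Qed.

Lemma clamp_lt1 t : `|clamp eps t| < 1.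
Proof. by apply: le_lt_trans eps1; rewrite clamp_le// ltW. Qed.

Lemma picard_step_continuous z : continuous z -> continuous (picard_step z).
Proof.
move=> cz t; apply: continuous_row => i.
have E : (fun s => picard_step z s 0 i) =
    (fun s => z0 0 i + primitive (fun s => G (z s) 0 i) (clamp eps s)).
  by apply/funext => s; rewrite mxE.
have C : {for t, continuous
    (fun s => z0 0 i + primitive (fun s => G (z s) 0 i) (clamp eps s))}.
  apply: continuousD; first exact: cst_continuous.
  apply: (@continuous_comp _ _ _ (clamp eps)); first exact: clamp_continuous.
  apply/differentiable_continuous/derivable1_diffP.
  by have := is_derive_primitive (continuous_integrand (i := i) cz) (clamp_lt1 t); case.
by move: C; rewrite -E.
Qed.

Lemma mean_value_bound (f df : R -> R) (C t : R) : `|t| <= eps ->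
  (forall s : R, `|s| <= eps -> is_derive s 1 f (df s)) ->
  (forall s : R, `|s| <= eps -> `|df s| <= C) -> f 0 = 0 -> `|f t| <= C * eps.
Proof.
move=> te dfP dfC f0; have C0 : 0 <= C.
  by apply: le_trans (dfC 0 _); rewrite ?normr0// ltW.
have itve a b s : `|a| <= eps -> `|b| <= eps -> s \in `[a, b] -> `|s| <= eps.
  rewrite !ler_norml in_itv/= => /andP[a1 a2] /andP[b1 b2] /andP[s1 s2].
  by apply/andP; split; lra.
have e0 : `|0 : R| <= eps by rewrite normr0 ltW.
have main a b : a <= b -> `|a| <= eps -> `|b| <= eps -> `|f b - f a| <= C * (b - a).
  move=> ab ae be.
  have [||c cab ->] := @MVT_segment R f df a b ab.
  - by move=> s sab; apply: dfP; apply: itve ae be _; exact: subset_itv_oo_cc sab.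
  - apply: derivable_within_continuous => s sab.
    by have [] := dfP s (itve _ _ _ ae be sab).
  rewrite normrM [`|b - a|]ger0_norm ?subr_ge0// ler_wpM2r ?subr_ge0//.
  exact: dfC (itve _ _ _ ae be cab).
have H : `|f t| <= C * `|t|.
  have [t0|t0] := leP 0 t.
    by have := main 0 t t0 e0 te; rewrite f0 !subr0 (ger0_norm t0).
  have := main t 0 (ltW t0) te e0.
  by rewrite f0 !sub0r normrN (ltr0_norm t0).
by apply: le_trans H _; rewrite ler_wpM2l.
Qed.

(** The integrands differ by at most L * d and the truncated time is at most [eps] in absolute
    value; thanks to the truncation the estimate holds for all [t]. *)
Lemma picard_step_lipschitz (z w : R -> 'rV[R]_p) (d : R) : continuous z -> continuous w -> 0 <= d ->
  (forall t, `|z t - w t| <= d) ->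
  forall t, `|picard_step z t - picard_step w t| <= d / 2.
Proof.
move=> cz cw d0 zw t; apply: rV_norm_le; first by rewrite divr_ge0.
move=> i; rewrite !mxE opprD addrACA subrr add0r.
have := @mean_value_bound
  (fun s => primitive (fun s => G (z s) 0 i) s - primitive (fun s => G (w s) 0 i) s)
  (fun s => G (z s) 0 i - G (w s) 0 i) (L * d) (clamp eps t) (clamp_le t (ltW eps0)).
have -> : L * d * eps = d / 2 by rewrite /eps; field; rewrite gt_eqF.
apply.
- move=> s se; apply: is_deriveB; apply: is_derive_primitive;
    by [exact: continuous_integrand|exact: le_lt_trans se eps1].
- move=> s _; have := rV_coord_le (G (z s) - G (w s)) i; rewrite !mxE.
  move=> /le_trans; apply; apply: le_trans (lipG _ _) _.
  by rewrite ler_wpM2l// ltW.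
- by rewrite !primitive0 subrr.
Qed.

Definition picard_iter n : R -> 'rV[R]_p := iter n picard_step (fun=> z0).

Lemma picard_iter_continuous n : continuous (picard_iter n).
Proof.
elim: n => [|n IH]; first exact: cst_continuous.
exact: picard_step_continuous.
Qed.

Lemma picard_iter_step n t : `|picard_iter n.+1 t - picard_iter n t| <= `|G z0| / 2 ^+ n.
Proof.
elim: n t => [|n IH] t; last first.
  rewrite exprSr invfM mulrA.
  apply: (@picard_step_lipschitz (picard_iter n.+1) (picard_iter n)) => //;
    try exact: picard_iter_continuous.
rewrite expr0 divr1; apply: rV_norm_le => // i; rewrite !mxE addrAC subrr add0r.
have cc := @picard_iter_continuous 0.
have := @mean_value_bound (primitive (fun s => G z0 0 i)) (fun s => G z0 0 i) `|G z0| _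
   (clamp_le t (ltW eps0)).
move=> H; apply: (@le_trans _ _ (`|G z0| * eps)); last first.
  by rewrite ler_piMr// ltW.
apply: H.
- move=> s se; apply: is_derive_primitive; last exact: le_lt_trans se eps1.
  exact: (continuous_integrand (i := i) cc).
- by move=> s _; exact: rV_coord_le.
- exact: primitive0.
Qed.

Lemma picard_iter_cauchy n m t :
  `|picard_iter (n + m) t - picard_iter n t| <= 2 * `|G z0| / 2 ^+ n.
Proof.
(* The subtracted term makes the geometric sum telescope, so that the induction on [m] goes
   through. *)
suff : `|picard_iter (n + m) t - picard_iter n t| <=
    2 * `|G z0| / 2 ^+ n - 2 * `|G z0| / 2 ^+ (n + m).
  by move=> /le_trans; apply; rewrite gerBl divr_ge0 ?mulr_ge0// exprn_ge0.
elim: m => [|m IH]; first by rewrite addn0 !subrr normr0.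
rewrite addnS; have := picard_iter_step (n + m) t.
set u := picard_iter _.+1 t; set v := picard_iter (n + m) t in IH *; set w := picard_iter n t in IH *.
move=> H; apply: le_trans (ler_distD v _ _) _; apply: le_trans (lerD H IH) _.
rewrite exprS; have : 2 ^+ (n + m) != 0 :> R by rewrite expf_neq0.
set a := 2 ^+ (n + m); move=> a0.
suff -> : 2 * `|G z0| / (2 * a) = `|G z0| / a.
  have -> : 2 * `|G z0| / a = `|G z0| / a + `|G z0| / a by ring.
  by lra.
by field.
Qed.

Lemma picard_solution : exists z : R -> 'rV[R]_p,
  z 0 = z0 /\ forall t i, `|t| < eps -> is_derive t 1 (fun s => z s 0 i) (G (z t) 0 i).
Proof.
set C := 2 * `|G z0|.
have C0 : 0 <= C by rewrite mulr_ge0.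
have Cn n : 0 <= C / 2 ^+ n by rewrite divr_ge0// exprn_ge0.
have C_small e : 0 < e -> \forall n \near \oo, C / 2 ^+ n < e.
  move=> e0; have h : `|2^-1 : R| < 1 by rewrite ger0_norm ?invr_ge0// invf_lt1// ltr1n.
  have /cvgr0Pnorm_lt /(_ _ e0) := cvg_geometric C h.
  apply: filterS => n /=; rewrite /geometric /= exprVn ger0_norm//.
(* The limit is taken coordinate by coordinate. The bound of [picard_iter_cauchy] does not depend on
   [t], which makes the convergence uniform and the limit continuous. *)
have cvgZ t i : cvg ((picard_iter n t 0 i : R^o) @[n --> \oo]).
  apply: cauchy_cvg; apply: cauchy_exP => e e0.
  have [n0 _ Hn] := C_small e e0.
  exists (picard_iter n0 t 0 i); exists n0 => // m /= nm.
  rewrite -ball_normE /ball_ /= distrC.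
  have := rV_coord_le (picard_iter m t - picard_iter n0 t) i; rewrite !mxE.
  move=> /le_lt_trans; apply; rewrite -(subnKC nm).
  by apply: le_lt_trans (picard_iter_cauchy _ _ _) _; exact: (Hn n0 (leqnn _)).
pose z t : 'rV[R]_p := \row_i lim ((picard_iter n t 0 i : R^o) @[n --> \oo]).
have zZ n t : `|z t - picard_iter n t| <= C / 2 ^+ n.
  apply: rV_norm_le => // i; apply/ler_addgt0Pr => e e0.
  have /cvgrPdist_le /(_ e e0) [n1 _ Hn] := cvgZ t i.
  have := Hn (n + n1)%N (leq_addl _ _); rewrite !mxE => h1.
  have := rV_coord_le (picard_iter (n + n1) t - picard_iter n t) i; rewrite !mxE => h2.
  have h3 := picard_iter_cauchy n n1 t.
  apply: le_trans (ler_distD (picard_iter (n + n1) t 0 i) _ _) _.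
  by rewrite addrC lerD// (le_trans h2).
have cz : continuous z.
  move=> t; apply/cvgrPdist_le => e e0.
  have e3 : 0 < e / 3 by rewrite divr_gt0.
  have [n _ /(_ n (leqnn _)) Hn] := C_small _ e3.
  have /cvgrPdist_le /(_ _ e3) := @picard_iter_continuous n t.
  apply: filterS => s Hs.
  have H1 := zZ n t; have H2 := zZ n s.
  apply: le_trans (ler_distD (picard_iter n t) _ _) _.
  have H3 : `|picard_iter n t - z s| <= e / 3 + e / 3.
    apply: le_trans (ler_distD (picard_iter n s) _ _) _.
    by rewrite lerD// distrC (le_trans H2)// ltW.
  have -> : e = e / 3 + (e / 3 + e / 3) by field.
  by rewrite lerD// (le_trans H1)// ltW.
(* Both sides are compared with iterate [n.+1]: the limit is close to it, and the contraction
   carries the closeness of iterate [n] to the image of the limit. *)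
have fix_z t : z t = picard_step z t.
  apply/eqP; rewrite -subr_eq0 -normr_le0; apply/ler_addgt0Pr => e e0; rewrite add0r.
  have e2 : 0 < e / 2 by rewrite divr_gt0.
  have [n _ Hn] := C_small _ e2.
  have H1 := zZ n.+1 t.
  have H2 := picard_step_lipschitz (@picard_iter_continuous n) cz (Cn n)
    (fun s => (_ : `|picard_iter n s - z s| <= _)).
  apply: le_trans (ler_distD (picard_iter n.+1 t) _ _) _.
  rewrite [e]splitr; apply: lerD.
    by apply: le_trans H1 (ltW _); exact: Hn (leqnSn n).
  apply: le_trans (H2 _ _) _; first by move=> s; rewrite distrC.
  rewrite ler_pdivrMr//; apply: le_trans (ltW (Hn n (leqnn _))) _; lra.
exists z; split.
  apply/rowP => i; rewrite fix_z mxE clamp_id ?primitive0 ?addr0//.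
  by rewrite normr0 ltW.
move=> t i te.
have D := is_derive_primitive (continuous_integrand (i := i) cz) (lt_trans te eps1).
have D' : is_derive t 1 (fun s => z0 0 i + primitive (fun s => G (z s) 0 i) s) (G (z t) 0 i).
  by rewrite -[G (z t) 0 i]add0r; apply: is_deriveD.
(* Near a time inside the span the truncation is the identity, so the fixed point equation is the
   integral equation. *)
apply: near_eq_is_derive D'; near=> s.
rewrite [in RHS]fix_z mxE clamp_id//.
near: s; have : {for t, continuous (fun s : R => `|s|)} by exact: norm_continuous.
by move=> /cvgr_le; apply.
Unshelve. all: by end_near. Qed.

End InitialValueProblem.

(** * Local integral curves of smooth vector fields *)

Section LocalFlow.
Variables (R : realType) (p : nat) (G : 'rV[R]_p -> 'rV[R]_p).

(** By continuity each partial derivative stays within 1 of its value at [u]; the sum over the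
    indices bounds all of them by one constant. *)
Lemma smooth_bounded_pderiv n (g : 'rV[R]_n -> R) (u : 'rV[R]_n) : smooth_at g u ->
  exists2 B : R, 0 <= B & \forall v \near u, forall j, `|pderiv j g v| <= B.
Proof.
move=> sg; exists (\sum_j (`|pderiv j g u| + 1)).
  by apply: sumr_ge0 => j _; rewrite addr_ge0.
have : \forall v \near u, forall j, `|pderiv j g u - pderiv j g v| <= 1.
  apply: (near_forall (P := fun j v => `|pderiv j g u - pderiv j g v| <= 1)) => j.
  have : {for u, continuous (pderiv j g)}.
    by apply/differentiable_continuous/smooth_at_differentiable/smooth_at_pderiv.
  by move=> /cvgrPdist_le/(_ 1 ltr01).
apply: filterS => v H j; rewrite (bigD1 j)//=.
have H0 : 0 <= \sum_(i | i != j) (`|pderiv i g u| + 1).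
  by apply: sumr_ge0 => i _; rewrite addr_ge0.
apply: ler_wpDr => //.
rewrite -[pderiv j g v](subKr (pderiv j g u)) (le_trans (ler_normB _ _))// lerD2l.
exact: H.
Qed.

Lemma is_derive_along n (f : 'rV[R]_n -> R) (c : R -> 'rV[R]_n) (dc : 'rV[R]_n) (t : R) :
  (forall i, is_derive t 1 (fun s => c s 0 i) (dc 0 i)) -> differentiable f (c t) ->
  is_derive t 1 (f \o c) (\sum_j dc 0 j * pderiv j f (c t)).
Proof.
move=> dcP df.
have dci i : differentiable (fun s => c s 0 i) t.
  by apply/derivable1_diffP; have [] := dcP i.
apply: DeriveDef.
  by apply: diff_derivable; apply: differentiable_comp => //; exact: differentiable_row.
rewrite derive_comp_row //; apply: eq_bigr => i _.
by have [_ ->] := dcP i.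
Qed.

(** Mean value theorem along the segment from [w] to [v], inside a ball where the partial
    derivatives are bounded by [B]. For the maximum norm the constant is [B] times the number of
    coordinates. *)
Lemma smooth_local_lipschitz (g : 'rV[R]_p -> R) (u : 'rV[R]_p) : smooth_at g u ->
  exists2 L, 0 <= L & exists2 r, 0 < r &
    forall v w, `|u - v| <= r -> `|u - w| <= r -> `|g v - g w| <= L * `|v - w|.
Proof.
move=> sg; have [B B0 HB] := smooth_bounded_pderiv sg.
exists (\sum_(j < p) B); first by apply: sumr_ge0.
have nB : nbhs u ([set v | smooth_at g v] `&` [set v | forall j, `|pderiv j g v| <= B]).
  exact: filterI (smooth_at_near sg) HB.
have [e /= e0 He] := (nbhs_ballP _ _).1 nB.
have He' v : `|u - v| < e -> smooth_at g v /\ forall j, `|pderiv j g v| <= B.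
  by move=> uv; apply: He; rewrite -ball_normE.
exists (e / 2); first by rewrite divr_gt0.
move=> v w uv uw; pose c (t : R) := w + t *: (v - w).
have cin t : t \in `[0, 1] -> `|u - c t| < e.
  rewrite in_itv/= => /andP[t0 t1]; apply: (@le_lt_trans _ _ (e / 2)); last first.
    by rewrite ltr_pdivrMr// ltr_pMr// ltr1n.
  have -> : u - c t = t *: (u - v) + (1 - t) *: (u - w).
    by apply/rowP => i; rewrite !mxE; ring.
  apply: le_trans (ler_normD _ _) _; rewrite !normrZ (ger0_norm t0).
  rewrite [`|1 - t|]ger0_norm ?subr_ge0//.
  have -> : e / 2 = t * (e / 2) + (1 - t) * (e / 2) by ring.
  by apply: lerD; rewrite ler_wpM2l// subr_ge0.
have dc (t : R) i : is_derive t 1 (fun s : R => c s 0 i) ((v - w) 0 i).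
  have -> : (fun s => c s 0 i) = (fun s => w 0 i + s * (v - w) 0 i).
    by apply/funext => s; rewrite !mxE.
  rewrite -[X in is_derive _ _ _ X]add0r; apply: is_deriveD.
  have := @is_deriveM R R id (cst ((v - w) 0 i)) t 1 1 0 (is_derive_id _ _) (is_derive_cst _ _ _).
  by rewrite /GRing.scale /= mulr0 add0r mulr1.
have dg (t : R) : t \in `[0, 1] ->
    is_derive t 1 (g \o c) (\sum_j (v - w) 0 j * pderiv j g (c t)).
  move=> /cin/He'[sgt _].
  exact: (is_derive_along (dc t) (smooth_at_differentiable sgt)).
have c1 : c 1 = v by rewrite /c scale1r addrC subrK.
have c0 : c 0 = w by rewrite /c scale0r addr0.
rewrite -c1 -[in X in _ - g X]c0; move: dg cin; clearbody c => dg cin.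
have cgc : {within `[0, 1], continuous (g \o c)}.
  by apply: derivable_within_continuous => s /dg[].
have dg' (s : R) : s \in `]0, 1[ -> is_derive s 1 (g \o c) (\sum_j (v - w) 0 j * pderiv j g (c s)).
  by move=> /subset_itv_oo_cc; exact: dg.
have [s s01] := MVT_segment ler01 dg' cgc.
rewrite subr0 mulr1 /= c1 => ->.
apply: le_trans (ler_norm_sum _ _ _) _; rewrite mulr_suml; apply: ler_sum => j _.
rewrite normrM mulrC; have [_ Hs] := He' _ (cin s s01).
by apply: ler_pM => //; exact: rV_coord_le.
Qed.

(** A smooth [G] is only locally Lipschitz. Truncating every coordinate to the cube of half-side [r]
    around [z0] makes it globally so; the solution of the truncated equation starts at the centre,
    hence stays in the cube for a short time and solves the original equation there. *)
Lemma local_flow (z0 : 'rV[R]_p) (W : set 'rV[R]_p) :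
  (forall i, smooth_at (fun u => G u 0 i) z0) -> nbhs z0 W ->
  exists2 e : R, 0 < e & exists2 z : R -> 'rV[R]_p, z 0 = z0 &
    forall t : R, `|t| < e -> W (z t) /\
      forall i, is_derive t 1 (fun s => z s 0 i) (G (z t) 0 i).
Proof.
move=> sG nW.
have [Lf /all_and2[Lf0 HL]] := @choice _ _ (fun i L => 0 <= L /\ exists2 r, 0 < r &
    forall v w, `|z0 - v| <= r -> `|z0 - w| <= r -> `|G v 0 i - G w 0 i| <= L * `|v - w|)
  (fun i => let: ex_intro2 L L0 H := smooth_local_lipschitz (sG i) in ex_intro _ L (conj L0 H)).
have [rf Hr] := @choice _ _ (fun i r => 0 < r /\
    forall v w, `|z0 - v| <= r -> `|z0 - w| <= r -> `|G v 0 i - G w 0 i| <= Lf i * `|v - w|)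
  (fun i => let: ex_intro2 L L0 H := HL i in ex_intro _ L (conj L0 H)).
pose r := \big[Num.min/1]_i rf i.
have r0 : 0 < r by apply: lt_bigmin => // i _; have [] := Hr i.
have rr i : r <= rf i by exact: bigmin_le_cond.
(* The 1 secures the [1 <= L] required by [picard_solution]; the sum dominates the constant of each
   coordinate. *)
pose L := 1 + \sum_i Lf i.
have L1 : 1 <= L by rewrite lerDl sumr_ge0.
pose cl (u : 'rV[R]_p) : 'rV[R]_p := \row_i (z0 0 i + clamp r (u 0 i - z0 0 i)).
have clr u : `|z0 - cl u| <= r.
  apply: rV_norm_le; first exact: ltW.
  by move=> i; rewrite !mxE opprD addNKr normrN clamp_le// ltW.
have clid u : `|z0 - u| <= r -> cl u = u.
  move=> zu; apply/rowP => i; rewrite mxE clamp_id ?(addrC _ (_ - _)) ?subrK//.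
  by apply: le_trans zu; have := rV_coord_le (z0 - u) i; rewrite !mxE distrC.
have cl_lip u v : `|cl u - cl v| <= `|u - v|.
  apply: rV_norm_le => // i; rewrite !mxE opprD addrACA subrr add0r.
  apply: le_trans (clamp_lipschitz _ _ _) _.
  have -> : u 0 i - z0 0 i - (v 0 i - z0 0 i) = (u - v) 0 i by rewrite !mxE; ring.
  exact: rV_coord_le.
have lipG u v : `|G (cl u) - G (cl v)| <= L * `|u - v|.
  apply: rV_norm_le; first by rewrite mulr_ge0// (le_trans _ L1).
  move=> i; rewrite !mxE; have [_ H] := Hr i.
  apply: le_trans (H _ _ (le_trans (clr u) (rr i)) (le_trans (clr v) (rr i))) _.
  apply: ler_pM => //; rewrite /L (bigD1 i)//= addrCA lerDl addr_ge0// sumr_ge0//.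
have [z [zz0 Dz]] := picard_solution L1 lipG z0.
have e0 : 0 < (2 * L)^-1 by rewrite invr_gt0 mulr_gt0// (lt_le_trans _ L1).
have cz : {for 0, continuous z}.
  apply: continuous_row => i; apply/differentiable_continuous/derivable1_diffP.
  by have := Dz 0 i; rewrite normr0 => /(_ e0)[].
have nV : nbhs (z 0) (W `&` [set v | `|z0 - v| <= r]).
  rewrite zz0; apply: filterI => //; apply/nbhs_ballP; exists r => // v.
  by rewrite -ball_normE => /ltW.
have nW' : \forall t \near (0 : R), W (z t) /\ `|z0 - z t| <= r := cz _ nV.
have [d /= d0 Hd] := (nbhs_ballP _ _).1 nW'.
exists (Num.min d (2 * L)^-1); first by rewrite lt_min d0.
exists z => // t; rewrite lt_min => /andP[td te].
have [Wt zt] : W (z t) /\ `|z0 - z t| <= r.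
  by apply: Hd; rewrite -ball_normE /ball_ /= sub0r normrN.
by split=> // i; have := Dz t i te; rewrite clid.
Qed.

Variables (e : R) (z : R -> 'rV[R]_p).
Hypothesis dz : forall t : R, `|t| < e -> forall i, is_derive t 1 (fun s => z s 0 i) (G (z t) 0 i).
Hypothesis sG : forall t : R, `|t| < e -> forall i, smooth_at (fun u => G u 0 i) (z t).

Lemma flow_differentiable (t : R) i : `|t| < e -> differentiable (fun s => z s 0 i) t.
Proof. by move=> /dz/(_ i)[d _]; apply/derivable1_diffP. Qed.

Lemma is_derive_flow (f : 'rV[R]_p -> R) (t : R) : `|t| < e -> smooth_at f (z t) ->
  is_derive t 1 (f \o z) (\sum_i G (z t) 0 i * pderiv i f (z t)).
Proof.
by move=> te sf; exact: (is_derive_along (dz te) (smooth_at_differentiable sf)).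
Qed.

(* The derivatives of [f \o z] are of the form [fj \o z] with [fj] smooth, because
   [z' = G z]. *)
Lemma smooth1_flow (f : 'rV[R]_p -> R) (t : R) : `|t| < e -> smooth_at f (z t) ->
  smooth1_at (f \o z) t.
Proof.
move=> te sf.
pose O := [set s : R | `|s| < e /\ smooth_at f (z s)].
have nO s : O s -> \forall s' \near s, O s'.
  move=> [se sfs]; have cz : {for s, continuous z}.
    by apply: differentiable_continuous; apply: differentiable_row => i; exact: flow_differentiable.
  have n1 : \forall s' \near s, `|s'| < e.
    have cn : {for s, continuous (fun s : R => `|s|)} by exact: norm_continuous.
    by have /cvgr_lt := cn; apply.
  have n2 : \forall s' \near s, smooth_at f (z s') by apply: cz; exact: smooth_at_near.
  exact: filterI n1 n2.
suff H j : exists fj : 'rV[R]_p -> R, forall s, O s ->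
    smooth_at fj (z s) /\ derive1n j (f \o z) s = fj (z s).
  have := nO t (conj te sf); apply: filterS => s Os j.
  have [fj Hj] := H j; have [[se _] [sfj _]] := (Os, Hj s Os).
  have [D _] := is_derive_flow se sfj.
  apply: near_eq_derivable D; apply: filterS (nO s Os) => s' Os'.
  by have [_ ->] := Hj s' Os'.
elim: j => [|j [fj Hj]]; first by exists f => s [].
exists (fun v => \sum_i G v 0 i * pderiv i fj v) => s Os.
have [[se _] [sfj _]] := (Os, Hj s Os); split.
  apply: smooth_at_sum => i; apply: smooth_atM; first exact: sG.
  exact: smooth_at_pderiv.
rewrite derive1nS derive1E; have [_ <-] := is_derive_flow se sfj.
apply: near_eq_derive; apply: filterS (nO s Os) => s' Os'.
by have [_ ->] := Hj s' Os'.
Qed.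
End LocalFlow.

(** * Geodesics *)

Section Hessian.
Variables (R : realType) (n : nat) (M : manifold R n) (nabla : connection_op M).
Hypothesis conn : is_connection nabla.
Implicit Types (U V : set M) (f g : M -> R) (X Y Z : M -> tvec M) (x : M)
  (c : chart R M n).

Notation vrestrict := (sheaf_restrict (vfield_sheaf M)).

Lemma christoffelE c i j k x :
  christoffel nabla c i j k x = nabla (cvec c i) (cvec c j) x (coordf c k).
Proof. by []. Qed.

Lemma smooth_christoffel c i j k : atlas c ->
  smooth (source c) (christoffel nabla c i j k).
Proof.
move=> ac; apply: smooth_act (smooth_coordf k ac).
by apply: (nabla_vfield conn (open_source c)); exact: vfield_cvec.
Qed.

Lemma nabla_cvec c i j x : atlas c -> source c x ->
  nabla (cvec c i) (cvec c j) x = \sum_k christoffel nabla c i j k x *: cvec c k x.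
Proof.
move=> ac sx; rewrite [LHS](tangent_expand ac sx) //.
apply: vfield_tangent sx.
by apply: (nabla_vfield conn (open_source c)); exact: vfield_cvec.
Qed.

Lemma lie_cvec c i j k x : atlas c -> source c x ->
  lie (cvec c i) (cvec c j) x (coordf c k) = 0.
Proof.
move=> ac sx; rewrite lieE; last exact: smooth_near_coord.
have Z a b : cvec c a x (act (cvec c b) (coordf c k)) = 0.
  rewrite (act_eq (U := source c) (g := cst (b == k)%:R) (X := cvec c a)) //.
  - by apply: tangent_cst; exact: tangent_cvec.
  - exact: open_source.
  - exact: tangent_cvec.
  - by move=> y sy; rewrite /act cvec_coordf.
by rewrite !Z subrr.
Qed.

Lemma christoffelC c i j k x : torsion_free nabla -> atlas c -> source c x ->
  christoffel nabla c i j k x = christoffel nabla c j i k x.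
Proof.
move=> tors ac sx; rewrite !christoffelE.
have := tors _ _ _ (open_source c) (vfield_cvec i ac) (vfield_cvec j ac) _ sx.
move=> /(congr1 (fun v => v (coordf c k))); rewrite lie_cvec // fct_subE => /eqP.
by rewrite subr_eq0 => /eqP.
Qed.

(* Tensorial in [X] and [Y]; this gives the invariance of the geodesic equation
   under changes of charts. *)
Definition hessian f X Y x : R := X x (act Y f) - nabla X Y x f.

Lemma hessian_tensorial U f X x : open U -> U x -> vfield U X -> smooth_near f x ->
  tensorial (@vfield R n M) x (fun Y => hessian f X Y x : R^o).
Proof.
move=> oU Ux sX sf; have tX := vfield_tangent sX Ux.
split=> [V Y Y' oV Vx sY sY' YY'|V g Y Y' oV Vx sg sY sY'];
  have oW : open (U `&` V) by exact: openI.
all: have WU := @subIsetl _ U V; have WV := @subIsetr _ U V.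
all: have {}sY := vrestrict oW WV sY; have {}sY' := vrestrict oW WV sY'.
all: have {}sX := vrestrict oW WU sX; have Wx : (U `&` V) x by [].
  rewrite /hessian (nabla_local conn oW sX sY sX sY') //; last by move=> y [_ /YY'].
  congr (_ - _); apply: (act_eq oW) => // y [_ Vy]; by rewrite /act YY'.
have {}sg := smooth_restrict WV sg.
have sfY := sheafM (vfield_sheaf M) oW sg sY.
rewrite /hessian (nabla_additiver conn oW sX sfY sY' Wx) (nabla_leibniz conn oW sg sX sY Wx).
have [_ /(_ _ sf) sYf] := sY x Wx; have [_ /(_ _ sf) sYf'] := sY' x Wx.
have -> : act (fun y => g y *: Y y + Y' y) f = (fun y => g y * act Y f y + act Y' f y) by [].
rewrite (tangent_fD tX _ sYf'); last by apply: smooth_nearM => //; exact: sg.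
rewrite (tangent_fM tX (sg _ Wx) sYf) !fct_addE !fct_scaleE /GRing.scale /=.
by rewrite /act; ring.
Qed.

Lemma hessian_expand U c f X Y x : open U -> U x -> atlas c -> source c x ->
  vfield U X -> vfield U Y -> smooth_near f x ->
  hessian f X Y x = \sum_i \sum_j X x (coordf c i) * Y x (coordf c j)
                                  * hessian f (cvec c i) (cvec c j) x.
Proof.
move=> oU Ux ac sx sX sY sf; have tX := vfield_tangent sX Ux; have tY := vfield_tangent sY Ux.
have oW : open (U `&` source c) by apply: openI => //; exact: open_source.
have WU := @subIsetl _ U (source c); have Wc := @subIsetr _ U (source c).
have Wx : (U `&` source c) x by [].
have {}sX := vrestrict oW WU sX; have {}sY := vrestrict oW WU sY.
have sc i := vrestrict oW Wc (vfield_cvec i ac).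
have sl (Z : M -> tvec M) i : smooth (U `&` source c) (fun=> Z x (coordf c i)).
  by move=> y _; exact: smooth_near_cst.
have sZ (Z : M -> tvec M) := sheaf_sum (vfield_sheaf M) oW (sl Z) sc.
have tF := hessian_tensorial oW Wx sX sf.
rewrite (tensorial_eq (vfield_sheaf M) tF (@vfield_framed R n M) oW Wx sY (sZ Y)); last first.
  exact: tangent_expand.
rewrite (tensorial_sum (vfield_sheaf M) tF oW Wx (sl Y) sc) exchange_big /=.
apply: eq_bigr => j _; rewrite /GRing.scale /= /hessian (nabla_eql conn oW Wx sX (sZ X) (sc j) (tangent_expand ac sx tX)).
rewrite (tensorial_sum (vfield_sheaf M) (nabla_tensorial conn oW Wx (sc j)) oW Wx (sl X) sc).
rewrite [X x (act _ _)](_ : _ = \sum_i X x (coordf c i) * cvec c i x (act (cvec c j) f)); last first.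
  rewrite {1}(tangent_expand ac sx tX) fct_sumE.
  by apply: eq_bigr => i _; rewrite fct_scaleE.
rewrite fct_sumE -sumrB mulr_sumr; apply: eq_bigr => i _.
by rewrite fct_scaleE; ring.
Qed.

(** The derivatives of a coordinate function along the coordinate fields are constant, so only the
    connection term of the Hessian survives. *)
Lemma hessian_coordf c i j k x : atlas c -> source c x ->
  hessian (coordf c k) (cvec c i) (cvec c j) x = - christoffel nabla c i j k x.
Proof.
move=> ac sx; rewrite /hessian -christoffelE.
rewrite (act_eq (U := source c) (g := cst (j == k)%:R) (X := cvec c i)) //.
- by rewrite (tangent_cst _ (tangent_cvec i ac sx)) sub0r.
- exact: open_source.
- exact: tangent_cvec.
- by move=> y sy; rewrite /act cvec_coordf.
Qed.

Lemma hessian_cvec c f i j x : atlas c -> source c x -> smooth_near f x ->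
  hessian f (cvec c i) (cvec c j) x =
  pderiv i (pderiv j (f \o uncoord c)) (coord c x)
  - \sum_k christoffel nabla c i j k x * pderiv k (f \o uncoord c) (coord c x).
Proof.
move=> ac sx sf; rewrite /hessian nabla_cvec // fct_sumE; congr (_ - _); last first.
  by apply: eq_bigr => k _; rewrite fct_scaleE cvecE.
have [_ /(_ _ sf) sYf] := vfield_cvec j ac sx.
rewrite cvecE //; apply: near_eq_derive.
apply: filterS2 (near_uncoord sx (smooth_near_near sf)) (near_target (coord_target sx)) => v sv tv.
by rewrite /= /act cvecE // uncoordK.
Qed.

End Hessian.

(** * Geodesics as integral curves of the spray *)

Section Geodesics.
Variables (R : realType) (n : nat) (M : manifold R n) (nabla : connection_op M).
Hypothesis conn : is_connection nabla.
Variables (d : chart R M n).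
Hypothesis ad : atlas d.

(** Position and velocity are concatenated into one row, which turns the second-order geodesic
    equation into a first-order system. *)
Definition geodesic_spray (z : 'rV[R]_(n + n)) : 'rV[R]_(n + n) :=
  row_mx (rsubmx z) (\row_l - \sum_i \sum_j
    christoffel nabla d i j l (uncoord d (lsubmx z)) * (rsubmx z) 0 i * (rsubmx z) 0 j).

Lemma smooth_geodesic_spray z a : target d (lsubmx z) ->
  smooth_at (fun z => geodesic_spray z 0 a) z.
Proof.
move=> tz; have sr i : smooth_at (fun z : 'rV[R]_(n + n) => (rsubmx z) 0 i) z.
  under eq_fun do rewrite mxE; exact: smooth_at_coord.
have sl i : smooth_at (fun z : 'rV[R]_(n + n) => (lsubmx z) 0 i) z.
  under eq_fun do rewrite mxE; exact: smooth_at_coord.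
rewrite -(splitK a); case: (fintype.split a) => i /=.
  by under eq_fun do rewrite row_mxEl.
under eq_fun do rewrite row_mxEr mxE -mulN1r.
apply: smooth_atM; first exact: smooth_at_cst.
apply: smooth_at_sum => j; apply: smooth_at_sum => l.
apply: smooth_atM => //; apply: smooth_atM => //.
apply: (smooth_at_comp (f := fun u => christoffel nabla d j l i (uncoord d u))) => //.
have sx := uncoord_source tz.
by have := smooth_christoffel conn j l i ad sx ad sx; rewrite uncoordK.
Qed.

Variables (e : R) (z : R -> 'rV[R]_(n + n)).
Hypothesis zt : forall t : R, `|t| < e -> target d (lsubmx (z t)).
Hypothesis dz : forall t : R, `|t| < e ->
  forall a, is_derive t 1 (fun s => z s 0 a) (geodesic_spray (z t) 0 a).

Let gamma t := uncoord d (lsubmx (z t)).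
Let u t := lsubmx (z t).
Let w t := rsubmx (z t).

Lemma near_ball0 (t : R) : `|t| < e -> \forall s \near t, `|s| < e.
Proof.
move=> te; have cn : {for t, continuous (fun s : R => `|s|)} by exact: norm_continuous.
by have /cvgr_lt := cn; apply.
Qed.

Lemma spray_position (t : R) i : `|t| < e -> is_derive t 1 (fun s => u s 0 i) (w t 0 i).
Proof.
move=> te; have := dz te (lshift n i); rewrite row_mxEl.
have -> // : (fun s => u s 0 i) = (fun s => z s 0 (lshift n i)).
by apply/funext => s; rewrite mxE.
Qed.

Lemma spray_velocity (t : R) l : `|t| < e -> is_derive t 1 (fun s => w s 0 l)
  (- \sum_i \sum_j christoffel nabla d i j l (gamma t) * w t 0 i * w t 0 j).
Proof.
move=> te; have := dz te (rshift n l); rewrite row_mxEr mxE.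
have -> // : (fun s => w s 0 l) = (fun s => z s 0 (rshift n l)).
by apply/funext => s; rewrite mxE.
Qed.

Lemma spray_source (t : R) : `|t| < e -> source d (gamma t).
Proof. by move=> /zt; exact: uncoord_source. Qed.

Lemma spray_coord (t : R) : `|t| < e -> coord d (gamma t) = u t.
Proof. by move=> /zt; exact: uncoordK. Qed.

Lemma spray_smooth_at f (t : R) : `|t| < e -> smooth_near f (gamma t) ->
  smooth_at (f \o uncoord d) (u t).
Proof.
by move=> te sf; rewrite -spray_coord //; exact: (sf d ad (spray_source te)).
Qed.

Lemma spray_continuous (t : R) : `|t| < e -> {for t, continuous u}.
Proof.
move=> te; apply: differentiable_continuous; apply: differentiable_row => i.
by apply/derivable1_diffP; have [] := spray_position i te.
Qed.

Lemma spray_smooth_curve : smooth_curve [set t | `|t| < e] gamma.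
Proof.
move=> t te f sf.
apply: (smooth1_flow (G := geodesic_spray) dz _ te
   (f := fun v => (f \o uncoord d) (lsubmx v))).
  by move=> s se i; apply: smooth_geodesic_spray; exact: zt.
apply: smooth_at_comp; first exact: spray_smooth_at.
by move=> j; under eq_fun do rewrite mxE; exact: smooth_at_coord.
Qed.

Lemma spray_derive f (t : R) : `|t| < e -> smooth_near f (gamma t) ->
  is_derive t 1 (f \o gamma) (\sum_i w t 0 i * pderiv i (f \o uncoord d) (u t)).
Proof.
move=> te sf.
have := is_derive_along (fun i => spray_position i te)
  (smooth_at_differentiable (spray_smooth_at te sf)).
exact.
Qed.

(** Differentiating the velocities brings in the Christoffel symbols, and these make up exactly the
    connection term of the Hessian in [d]. As [f] is arbitrary, the formula also applies to
    coordinates of other charts. *)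
Lemma spray_derive2 f (t : R) : `|t| < e -> smooth_near f (gamma t) ->
  derive1n 2 (f \o gamma) t =
  \sum_i \sum_j w t 0 i * w t 0 j * hessian nabla f (cvec d i) (cvec d j) (gamma t).
Proof.
move=> te sf; rewrite derive1nS derive1E.
have ns : \forall s \near t, smooth_at (f \o uncoord d) (u s).
  have := spray_smooth_at te sf; move=> /smooth_at_near; exact: (spray_continuous te).
rewrite (near_eq_derive (g := \sum_i (fun s => w s 0 i * pderiv i (f \o uncoord d) (u s))));
  last first.
  near=> s; rewrite fct_sumE derive1n1 derive1E.
  have se : `|s| < e by near: s; exact: near_ball0.
  have sfs : smooth_near f (gamma s).
    apply/(smooth_nearP _ ad (spray_source se)); rewrite spray_coord //.
    by near: s.
  by have [_ ->] := spray_derive se sfs.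
pose phi i := pderiv i (f \o uncoord d).
have sphi i : differentiable (phi i) (u t).
  by apply/smooth_at_differentiable/smooth_at_pderiv; exact: spray_smooth_at.
have D i := is_deriveM (spray_velocity i te)
  (is_derive_along (fun j => spray_position j te) (sphi i)).
have [_ ->] := is_derive_sum (fun i => D i).
transitivity (\sum_i \sum_j w t 0 j * w t 0 i * pderiv j (phi i) (u t)
   - \sum_l \sum_i \sum_j christoffel nabla d i j l (gamma t) * w t 0 i * w t 0 j * phi l (u t)).
  rewrite -sumrB; apply: eq_bigr => i _; rewrite /GRing.scale /= mulr_sumr.
  congr (_ + _).
    by apply: eq_bigr => j _; ring.
  rewrite mulrN; congr (- _); rewrite mulrC mulr_suml; apply: eq_bigr => j _.
  by rewrite mulr_suml.
rewrite exchange_big /=.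
rewrite [X in _ - X]exchange_big -sumrB; apply: eq_bigr => i _.
rewrite exchange_big -sumrB; apply: eq_bigr => j _.
rewrite (hessian_cvec conn _ _ ad (spray_source te) sf) spray_coord // mulrBr; congr (_ - _).
by rewrite mulr_sumr; apply: eq_bigr => l _; rewrite /phi; ring.
Unshelve. all: by end_near. Qed.

(** The curve solves the equation in [d], but [geodesic] demands it in every chart [c]. The second
    derivative of a coordinate of [c] is its Hessian on the velocity; tensoriality re-expands this
    Hessian in [c], where it is minus the Christoffel sum. *)
Lemma spray_geodesic : geodesic nabla [set t | `|t| < e] gamma.
Proof.
split; first exact: spray_smooth_curve.
move=> t c te ac sc g k.
have gE i : g i = coordf c i \o gamma by [].
have sf i : smooth_near (coordf c i) (gamma t) by exact: smooth_near_coord.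
have se := spray_source te.
rewrite gE (spray_derive2 te (sf k)).
(* The velocity as an intrinsic vector: its values on the coordinates of [c] are the first
   derivatives of the curve in [c]. *)
have tV : tangent (gamma t) (coord_vec d (w t) (gamma t)) by exists d, (w t).
have sX := extend_vfield openT tV; have XE := extend_val tV.
set X := extend _ _ in sX XE.
have H1 := hessian_expand conn openT Logic.I ad se sX sX (sf k).
have H2 := hessian_expand conn openT Logic.I ac sc sX sX (sf k).
have g1 i : derive1n 1 (g i) t = X (gamma t) (coordf c i).
  rewrite derive1n1 derive1E gE; have [_ ->] := spray_derive te (sf i).
  by rewrite XE coord_vecE // spray_coord.
transitivity (hessian nabla (coordf c k) X X (gamma t) - hessian nabla (coordf c k) X X (gamma t));
  last by rewrite subrr.
congr (_ + _).
  rewrite H1; apply: eq_bigr => i _; apply: eq_bigr => j _.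
  by rewrite XE !coord_vec_coordf.
rewrite H2 -sumrN; apply: eq_bigr => i _; rewrite -sumrN; apply: eq_bigr => j _.
by rewrite !g1 hessian_coordf //; ring.
Qed.

End Geodesics.

(** That the curve stays in the domain of [d] is part of the conclusion because the curve is later
    read in slice coordinates. *)
Lemma geodesic_exists (R : realType) (n : nat) (M : manifold R n) (nabla : connection_op M)
    (d : chart R M n) (x : M) (w : 'rV[R]_n) :
  is_connection nabla -> atlas d -> source d x ->
  exists2 e : R, 0 < e & exists gamma : R -> M,
    [/\ gamma 0 = x, geodesic nabla [set t | `|t| < e] gamma,
        forall t : R, `|t| < e -> source d (gamma t) &
        forall i, is_derive (0 : R) 1 (coordf d i \o gamma) (w 0 i)].
Proof.
move=> conn ad sx.
pose z0 := row_mx (coord d x) w.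
have tz0 : target d (lsubmx z0) by rewrite row_mxKl; exact: coord_target.
have nW : nbhs z0 [set z | target d (lsubmx z)].
  have cl : {for z0, continuous (fun z : 'rV[R]_(n + n) => lsubmx z)}.
    by apply: differentiable_continuous; exact: differentiable_lsubmx.
  by apply: cl; exact: near_target.
have [e e0 [z zz0 Hz]] := local_flow (fun a => smooth_geodesic_spray conn ad a tz0) nW.
have zt t te := (Hz t te).1; have dz t te := (Hz t te).2.
exists e => //; exists (fun t => uncoord d (lsubmx (z t))).
have e00 : `|0 : R| < e by rewrite normr0.
have x0 : uncoord d (lsubmx (z 0)) = x by rewrite zz0 row_mxKl coordK.
split=> //.
- exact: spray_geodesic.
- by move=> t te; exact: spray_source te.
move=> i; have sf : smooth_near (coordf d i) (uncoord d (lsubmx (z 0))).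
  by rewrite x0; exact: smooth_near_coord.
have := spray_derive ad zt dz e00 sf.
suff -> : \sum_i0 rsubmx (z 0) 0 i0 * pderiv i0 (coordf d i \o uncoord d) (lsubmx (z 0)) = w 0 i.
  by [].
rewrite zz0 row_mxKl row_mxKr -coord_vecE ?coord_vec_coordf //.
exact: smooth_near_coord.
Qed.

(** * The conormal bundle of a submanifold *)

Section Submanifold.
Variables (R : realType) (k m : nat).
Variables (M : manifold R (k + m)) (N : manifold R k) (iota : N -> M).
Hypothesis sub : submanifold iota.
Implicit Types (c : chart R M (k + m)) (d : chart R N k) (y z : N) (x : M).

Definition slice c d : Prop :=
  [/\ atlas c, atlas d, source d = iota @^-1` source c &
      forall z, source d z -> coord c (iota z) = row_mx (coord d z) 0].

Lemma slice_exists y : exists c d, [/\ slice c d, source c (iota y) & source d y].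
Proof.
have [_ /(_ y)[c [d [[ac sc] ad sd cd _]]]] := sub.
by exists c, d; split=> //; rewrite sd.
Qed.

Lemma slice_source c d y : slice c d -> source d y -> source c (iota y).
Proof. by move=> [_ _ ->]. Qed.

Lemma open_nbhsP (T : topologicalType) (A : set T) :
  (forall t, A t -> \forall s \near t, A s) -> open A.
Proof. by move=> H; rewrite openE => t /H. Qed.

(** This is the continuity of [iota], read off slice charts, where the map is v |-> (v, 0). *)
Lemma near_iota y (P : set M) : (\forall x \near iota y, P x) ->
  \forall z \near y, P (iota z).
Proof.
move=> nP; have [c [d [cd sc sd]]] := slice_exists y; have [ac ad _ cdE] := cd.
have H := near_uncoord sc nP.
have cont : {for coord d y, continuous (fun v : 'rV[R]_k => row_mx v 0 : 'rV[R]_(k + m))}.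
  apply: differentiable_continuous; apply: differentiable_row => j.
  rewrite -(splitK j); case: (fintype.split j) => i /=.
    under eq_fun do rewrite row_mxEl; exact: differentiable_coord.
  under eq_fun do rewrite row_mxEr; exact: differentiable_cst.
rewrite (cdE _ sd) in H.
have H1 : \forall v \near coord d y, P (uncoord c (row_mx v 0)) := cont _ H.
apply: filterS2 (near_coord sd H1) (near_source sd) => z Hz sz.
by rewrite -cdE // coordK // in Hz; exact: slice_source sz.
Qed.

Lemma smooth_pullback f y : smooth_near f (iota y) -> smooth_near (f \o iota) y.
Proof.
move=> sf; have [c [d [cd sc sd]]] := slice_exists y; have [ac ad _ cdE] := cd.
apply: (@smooth_near_eq _ _ _ (fun z => (f \o uncoord c) (row_mx (coord d z) 0))).
  apply: filterS (near_source sd) => z sz.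
  by rewrite /= -cdE // coordK //; exact: slice_source sz.
apply: smooth_near_comp; first by rewrite -cdE //; exact: sf.
move=> j; rewrite -(splitK j); case: (fintype.split j) => i /=.
  under eq_fun do rewrite row_mxEl; exact: smooth_near_coord.
under eq_fun do rewrite row_mxEr mxE; exact: smooth_near_cst.
Qed.

(** The local projection of [M] onto [N] that forgets the last [m] slice coordinates; composing with
    it extends functions and coefficients from [N] to [M]. *)
Definition retraction c d x : N := uncoord d (lsubmx (coord c x)).

(** An extension along [retraction] needs data on [V] only, since by [tube_iotaP] this set meets [N]
    inside [V]. *)
Definition tube c d (V : set N) : set M :=
  [set x | [/\ source c x, target d (lsubmx (coord c x)) & V (retraction c d x)]].

Lemma retraction_iota c d y : slice c d -> source d y -> retraction c d (iota y) = y.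
Proof. by move=> [_ _ _ cdE] sd; rewrite /retraction cdE // row_mxKl coordK. Qed.

Lemma tube_iota c d V y : slice c d -> source d y -> V y -> tube c d V (iota y).
Proof.
move=> cd sd Vy; split; first exact: slice_source sd.
  by have [_ _ _ ->] := cd => //; rewrite row_mxKl; exact: coord_target.
by rewrite retraction_iota.
Qed.

Lemma tube_iotaP c d V y : slice c d -> tube c d V (iota y) -> source d y /\ V y.
Proof.
move=> cd [sc _ Vr]; have sd : source d y by have [_ _ -> _] := cd.
by split=> //; rewrite retraction_iota in Vr.
Qed.

Lemma open_tube c d V : open V -> open (tube c d V).
Proof.
move=> oV; apply: open_nbhsP => x [sc td Vr].
have cl : {for coord c x, continuous (fun u : 'rV[R]_(k + m) => lsubmx u)}.
  by apply: differentiable_continuous; exact: differentiable_lsubmx.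
have nt : \forall u \near coord c x, target d (lsubmx u) := cl _ (near_target td).
have nV : \forall v \near lsubmx (coord c x), V (uncoord d v).
  by have := uncoord_continuous td; apply; exact: near_open.
have nV' : \forall u \near coord c x, V (uncoord d (lsubmx u)) := cl _ nV.
apply: filterS3 (near_source sc) (near_coord sc nt) (near_coord sc nV') => z.
by split.
Qed.

Lemma smooth_retraction c d f x : slice c d -> source c x ->
  target d (lsubmx (coord c x)) -> smooth_near f (retraction c d x) ->
  smooth_near (fun x => f (retraction c d x)) x.
Proof.
move=> [ac ad _ _] sc td sf.
apply: (smooth_near_comp (phi := f \o uncoord d) (g := fun x => lsubmx (coord c x))).
  by have := sf d ad (uncoord_source td); rewrite uncoordK.
by move=> j; under eq_fun do rewrite mxE; exact: smooth_near_coord.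
Qed.

Lemma pushE y (u : tvec N) f : smooth_near f (iota y) -> push iota y u f = u (f \o iota).
Proof. by move=> sf; rewrite /push asboolT. Qed.

Lemma pushL y r (u v : tvec N) :
  push iota y (r *: u + v) = r *: push iota y u + push iota y v.
Proof.
apply/funext => f; rewrite fct_addE fct_scaleE /push.
by case: asboolP => _ //; rewrite mulr0 addr0.
Qed.

Lemma push0 y : push iota y (0 : tvec N) = 0.
Proof. by apply/funext => f; rewrite /push; case: asboolP. Qed.

Lemma push_sum y p (l : 'I_p -> R) (F : 'I_p -> tvec N) :
  push iota y (\sum_i l i *: F i) = \sum_i l i *: push iota y (F i).
Proof.
elim: p l F => [|p IH] l F; first by rewrite !big_ord0 push0.
by rewrite !big_ord_recl pushL IH.
Qed.

(** Chain rule for v |-> (v, 0), whose derivative in direction [i] has a single non-zero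
    component. *)
Lemma push_cvec c d i y : slice c d -> source d y ->
  push iota y (cvec d i y) = cvec c (lshift m i) (iota y).
Proof.
move=> cd sd; have [ac ad _ cdE] := cd; have sc := slice_source cd sd.
apply/funext => f; have [sf|nf] := pselect (smooth_near f (iota y)); last first.
  by rewrite /push asboolF // /cvec coord_vec_nsmooth.
rewrite pushE // !cvecE //; last exact: smooth_pullback.
have E : {near coord d y, (f \o iota) \o uncoord d =1
    (f \o uncoord c) \o (fun v => row_mx v 0)}.
  apply: filterS (near_target (coord_target sd)) => v tv.
  have sv := uncoord_source tv.
  rewrite /= -{2}(uncoordK tv) -cdE // coordK //; exact: slice_source sv.
rewrite /pderiv (near_eq_derive _ E) derive_comp_row.
- rewrite -cdE //; have D j : 'D_(delta_mx 0 i) (fun v : 'rV[R]_k => (row_mx v 0 : 'rV[R]_(k + m)) 0 j)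
      (coord d y) = (j == lshift m i)%:R.
    rewrite -(splitK j); case: (fintype.split j) => a /=.
      under eq_fun do rewrite row_mxEl.
      by rewrite deriv_coord mxE eqxx (inj_eq (@lshift_inj _ _)).
    under eq_fun do rewrite row_mxEr mxE.
    by rewrite derive_cst eq_rlshift.
  rewrite (bigD1 (lshift m i)) //= D eqxx mul1r big1 ?addr0 // => j ji.
  by rewrite D (negbTE ji) mul0r.
- by rewrite -cdE //; apply/smooth_at_differentiable/sf.
- move=> j; rewrite -(splitK j); case: (fintype.split j) => a /=.
    under eq_fun do rewrite row_mxEl; exact: differentiable_coord.
  under eq_fun do rewrite row_mxEr; exact: differentiable_cst.
Qed.

Lemma push_expand c d y (u : tvec N) : slice c d -> source d y -> tangent y u ->
  push iota y u = \sum_i u (coordf d i) *: cvec c (lshift m i) (iota y).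
Proof.
move=> cd sd tu; have [ac ad _ _] := cd.
rewrite {1}(tangent_expand ad sd tu) push_sum.
by apply: eq_bigr => i _; rewrite (push_cvec _ cd).
Qed.

Lemma push_extension y (u : tvec N) f g : tangent y u -> smooth_near g (iota y) ->
  {near y, g \o iota =1 f} -> push iota y u g = u f.
Proof. by move=> tu sg gf; rewrite pushE //; exact: tangent_eq tu gf. Qed.

(** The first slice coordinates of [M] restrict to the coordinates of [N], so the components of a
    vector can be read from its image. *)
Lemma push_inj y (u v : tvec N) : tangent y u -> tangent y v ->
  push iota y u = push iota y v -> u = v.
Proof.
move=> tu tv uv; have [c [d [cd sc sd]]] := slice_exists y; have [ac ad _ cdE] := cd.
apply: (tangent_inj ad sd tu tv) => i.
have sf : smooth_near (coordf c (lshift m i)) (iota y) by exact: smooth_near_coord.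
have E : {near y, coordf c (lshift m i) \o iota =1 coordf d i}.
  by apply: filterS (near_source sd) => z sz; rewrite /= /coordf cdE // row_mxEl.
by rewrite -(push_extension tu sf E) -(push_extension tv sf E) uv.
Qed.

Notation ann := (ann iota).
Notation ann_section := (ann_section iota).

Lemma annP c d y a : slice c d -> source d y ->
  ann y a <-> cotangent (iota y) a /\ forall i, a (cvec c (lshift m i) (iota y)) = 0.
Proof.
move=> cd sd; have [ac ad _ _] := cd; have sc := slice_source cd sd.
split=> -[ca az]; split=> //; [move=> i|move=> u tu].
  by rewrite -(push_cvec _ cd sd); apply: az; exact: tangent_cvec.
rewrite (push_expand cd sd tu) (covec_sum ca); last by move=> i; exact: tangent_cvec.
by rewrite big1 // => i _; rewrite az mulr0.
Qed.

Lemma annL y r a b : ann y a -> ann y b -> ann y (r *: a + b).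
Proof.
move=> [ca az] [cb bz]; split=> [|u tu]; first exact: cotangentL.
by rewrite fct_addE fct_scaleE az // bz // mulr0 addr0.
Qed.

Lemma ann0 y : ann y 0.
Proof. by split=> //; exact: cotangent0. Qed.

Lemma ann_subspace y : subspace (ann y).
Proof. by split; [exact: ann0|move=> r a b; exact: annL]. Qed.

Lemma ann_sum y p (l : 'I_p -> R) (F : 'I_p -> covec M) :
  (forall i, ann y (F i)) -> ann y (\sum_i l i *: F i).
Proof.
move=> aF; elim: p l F aF => [|p IH] l F aF; first by rewrite big_ord0; exact: ann0.
by rewrite big_ord_recl; apply: annL => //; exact: IH.
Qed.

Lemma dform_normal c d a y : slice c d -> source d y ->
  ann y (dform (coordf c (rshift k a)) (iota y)).
Proof.
move=> cd sd; have [ac ad _ _] := cd; have sc := slice_source cd sd.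
apply/(annP _ cd sd); split; first exact: cotangent_dform.
move=> i; rewrite dformE; last exact: tangent_cvec.
by rewrite cvec_coordf // eq_lrshift.
Qed.

Lemma ann_expand c d y a : slice c d -> source d y -> ann y a ->
  a = \sum_j a (cvec c (rshift k j) (iota y)) *: dform (coordf c (rshift k j)) (iota y).
Proof.
move=> cd sd aa; have [ac ad _ _] := cd; have sc := slice_source cd sd.
have /(annP _ cd sd)[ca az] := aa.
rewrite {1}(cotangent_expand ac sc ca) big_split_ord /= big1 ?add0r // => i _.
by rewrite az scale0r.
Qed.

Lemma ann_section_sheaf : module_sheaf ann_section.
Proof.
split.
- move=> U V s oV VU [as_ ss]; split=> [y /VU|W X oW sX y Vy]; first exact: as_.
  by apply: (ss W X) => //; exact: VU.
- move=> U s oU gs; split=> [y /gs[V [_ Vy [as_ _]]]|W X oW sX y Uy Wy]; first exact: as_.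
  by have [V [_ Vy [_ ss]]] := gs y Uy; exact: (ss W X).
- move=> U s t oU st [as_ ss]; split=> [y Uy|W X oW sX y Uy Wy].
    by rewrite -st //; exact: as_.
  apply: smooth_near_eq (ss W X oW sX y Uy Wy).
  by apply: filterS (near_open oU Uy) => z Uz; rewrite st.
- move=> U oU; split=> [y _|W X oW sX y _ _]; first exact: ann0.
  exact: smooth_near_cst.
- move=> U f s t oU sf [as_ ss] [at_ st]; split=> [y Uy|W X oW sX y Uy Wy].
    by apply: annL; [exact: as_|exact: at_].
  apply: smooth_nearD; last exact: (st W X).
  by apply: smooth_nearM; [exact: sf|exact: (ss W X)].
Qed.

Lemma oneform_ann_section U V alpha : open U -> oneform U alpha ->
  (forall y, V y -> U (iota y) /\ ann y (alpha (iota y))) ->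
  ann_section V (alpha \o iota).
Proof.
move=> oU sa HV; split=> [y /HV[]//|W X oW sX y Vy Wy].
have [Uy _] := HV y Vy; have oUW := openI oU oW.
apply: (@smooth_pullback (pairing alpha X)).
apply: (smooth_pairing oUW (sheaf_restrict (oneform_sheaf M) oUW (@subIsetl _ U W) sa)
  (sheaf_restrict (vfield_sheaf M) oUW (@subIsetr _ U W) sX)).
by split.
Qed.

(** The coefficients in the frame of normal coordinate differentials are made constant along the
    fibres of the retraction. *)
Lemma ann_section_extend V alpha y : open V -> ann_section V alpha -> V y ->
  exists U alphat, [/\ open U, U (iota y), oneform U alphat &
    forall z, U (iota z) -> V z /\ alphat (iota z) = alpha z].
Proof.
move=> oV [aa sa] Vy; have [c [d [cd sc sd]]] := slice_exists y; have [ac ad _ _] := cd.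
have oT := open_tube c d oV.
pose l j z := alpha z (cvec c (rshift k j) (iota z)).
pose at_ x := \sum_j l j (retraction c d x) *: dform (coordf c (rshift k j)) x.
exists (tube c d V), at_; split=> //; first exact: tube_iota.
  apply: (sheaf_sum (oneform_sheaf M) oT (l := fun j x => l j (retraction c d x))) => j.
    move=> x [sx tx Vr]; apply: smooth_retraction => //.
    apply: (sa (source c)) => //; [exact: open_source|exact: vfield_cvec|].
    by apply: (slice_source cd); exact: uncoord_source.
  apply: oneform_dform; apply: smooth_restrict (smooth_coordf _ ac) => x; by case.
move=> z /(tube_iotaP cd)[sz Vz]; split=> //.
by rewrite /at_ retraction_iota // /l -(ann_expand cd sz) //; exact: aa.
Qed.

Lemma function_extend f y : smooth setT f -> exists U g, [/\ open U, U (iota y),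
  smooth U g & forall z, U (iota z) -> g (iota z) = f z].
Proof.
move=> sf; have [c [d [cd sc sd]]] := slice_exists y.
exists (tube c d setT), (fun x => f (retraction c d x)); split.
- exact/open_tube/openT.
- exact: tube_iota.
- by move=> x [sx tx _]; apply: smooth_retraction => //; exact: sf.
- by move=> z /(tube_iotaP cd)[sz _]; rewrite retraction_iota.
Qed.

(** The differentials of the last [m] slice coordinates form a local frame; evaluation on the dual
    coordinate fields recovers the coefficients, and with them their smoothness. *)
Lemma ann_vector_bundle : vector_bundle ann ann_section.
Proof.
split; first exact: ann_subspace.
- move=> U s oU; split=> [sU y Uy|]; first by exists U; split.
  move=> gs; apply: (sheaf_glue ann_section_sheaf) => // y Uy.
  by have [V [oV Vy _ sV]] := gs y Uy; exists V; split.
move=> y; have [c [d [cd sc sd]]] := slice_exists y; have [ac ad _ _] := cd.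
exists (source d), m, (fun a z => dform (coordf c (rshift k a)) (iota z)); split=> //.
- exact: open_source.
- move=> z sz a; split=> [aa|[l ->]].
    by exists (fun j => a (cvec c (rshift k j) (iota z))); exact: (ann_expand cd sz).
  by apply: ann_sum => j; exact: (dform_normal j cd sz).
- move=> z sz l H i.
  have := congr1 (fun w : covec M => w (cvec c (rshift k i) (iota z))) H.
  rewrite fct_sumE (bigD1 i) //= big1 ?addr0.
    rewrite fct_scaleE dformE; last by apply: tangent_cvec => //; exact: slice_source sz.
    rewrite cvec_coordf //; last exact: slice_source sz.
    by rewrite eqxx mulr1.
  move=> j ji; rewrite fct_scaleE dformE; last by apply: tangent_cvec => //; exact: slice_source sz.
  rewrite cvec_coordf //; last exact: slice_source sz.
  by rewrite (inj_eq (@rshift_inj _ _)) eq_sym (negbTE ji) mulr0.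
- move=> U s oU Ud; split=> [[as_ ss]|[l [sl sE]]].
    exists (fun j z => s z (cvec c (rshift k j) (iota z))); split=> [j z Uz|z Uz].
      apply: (ss (source c)) => //; [exact: open_source|exact: vfield_cvec|].
      by apply: (slice_source cd); exact: Ud.
    by apply: (ann_expand cd); [exact: Ud|exact: as_].
  apply: (sheaf_ext ann_section_sheaf oU (fun z Uz => esym (sE z Uz))).
  apply: (sheaf_sum ann_section_sheaf) => // j.
  have sdf : oneform (source c) (dform (coordf c (rshift k j))).
    by apply: oneform_dform; exact: smooth_coordf.
  apply: (oneform_ann_section (open_source c) sdf) => z Uz; split.
    by apply: (slice_source cd); exact: Ud.
  by apply: (dform_normal _ cd); exact: Ud.
Qed.

End Submanifold.

(** * Coisotropic submanifolds *)

Section CoisotropicSubmanifold.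
Variables (R : realType) (k m : nat).
Variables (M : manifold R (k + m)) (nabla : connection_op M).
Variables (h : M -> covec M -> covec M -> R) (N : manifold R k) (iota : N -> M).
Hypothesis kv : kv_manifold nabla h.
Hypothesis co : coisotropic_kv_submanifold iota nabla h.
Implicit Types (y z : N) (U : set M) (V : set N) (alpha beta gamma : N -> covec M)
  (c : chart R M (k + m)) (d : chart R N k).

Notation ann := (ann iota).
Notation ann_section := (ann_section iota).
Notation push := (push iota).
Notation slice := (slice iota).
Notation D := (contravariant nabla h).
Notation anchor := (ann_anchor iota h).
Notation vrestrict := (sheaf_restrict (vfield_sheaf M)).
Notation frestrict := (sheaf_restrict (oneform_sheaf M)).

Let conn : is_connection nabla. Proof. by have [[]] := kv. Qed.
Let flt : Defs.flat nabla. Proof. by have [[]] := kv. Qed.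
Let tors : torsion_free nabla. Proof. by have [[]] := kv. Qed.
Let bv : symmetric_bivector h. Proof. by have [] := kv. Qed.
Let kveq : forall alpha beta gamma : M -> covec M,
  oneform setT alpha -> oneform setT beta -> oneform setT gamma ->
  nabla_h nabla h (sharp_form h alpha) beta gamma
  = nabla_h nabla h (sharp_form h beta) alpha gamma.
Proof. by have [] := kv. Qed.
Let sub : submanifold iota. Proof. by have [[]] := co. Qed.

Lemma christoffel_quadratic c d y a (w : 'rV[R]_k) : slice c d -> source d y ->
  \sum_i \sum_j christoffel nabla c (lshift m i) (lshift m j) (rshift k a) (iota y)
    * w 0 i * w 0 j = 0.
Proof.
move=> cd sd; have [ac ad _ cdE] := cd.
have [[_ [nablaN [[connN _ _] geo]]] _] := co.
(* The initial velocity [w] is arbitrary. At time 0 the normal component of the geodesic equation of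
   [M] reduces to the quadratic relation, as the normal coordinates vanish along the curve together
   with their derivatives. *)
have [e e0 [g [g0 gg gs dg]]] := geodesic_exists w connN ad sd.
have oI : open [set t : R | `|t| < e].
  by apply: open_nbhsP => t; exact: near_ball0.
have iI : is_interval [set t : R | `|t| < e].
  move=> s t /= se te r /andP[sr rt]; move: se te; rewrite !ltr_norml.
  by move=> /andP[s1 s2] /andP[t1 t2]; apply/andP; split; lra.
have [_ /(_ 0 c)] := geo _ g oI iI gg.
have e00 : `|0 : R| < e by rewrite normr0.
have sg := slice_source cd (gs 0 e00).
pose G (i : 'I_(k + m)) (s : R) : R := coord c (iota (g s)) 0 i.
move=> /(_ e00 ac sg (rshift k a)) H.
have {}H : derive1n 2 (G (rshift k a)) 0 + \sum_i \sum_j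
    christoffel nabla c i j (rshift k a) (iota (g 0))
    * derive1n 1 (G i) 0 * derive1n 1 (G j) 0 = 0 := H.
have Gr b : forall t : R, `|t| < e -> G (rshift k b) t = 0.
  by move=> t te; rewrite /G cdE ?row_mxEr ?mxE //; exact: gs.
have Gr1 b (t : R) : `|t| < e -> derive1n 1 (G (rshift k b)) t = 0.
  move=> te; rewrite derive1n1 derive1E (near_eq_derive (g := cst 0)) ?derive_cst //.
  by apply: filterS (near_ball0 te) => s; exact: Gr.
have Gr2 b : derive1n 2 (G (rshift k b)) 0 = 0.
  rewrite derive1nS derive1E (near_eq_derive (g := cst 0)) ?derive_cst //.
  by apply: filterS (near_ball0 e00) => s; exact: Gr1.
have Gl i : derive1n 1 (G (lshift m i)) 0 = w 0 i.
  rewrite derive1n1 derive1E (near_eq_derive (g := coordf d i \o g)).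
    by have [_ ->] := dg i.
  by apply: filterS (near_ball0 e00) => s se; rewrite /G cdE ?row_mxEl //; exact: gs.
transitivity (\sum_i \sum_j christoffel nabla c i j (rshift k a) (iota y)
    * derive1n 1 (G i) 0 * derive1n 1 (G j) 0); last first.
  by move: H; rewrite g0 Gr2 add0r.
rewrite [RHS]big_split_ord [X in _ = _ + X]big1 ?addr0; last first.
  move=> i _; rewrite big1 // => j _.
  by rewrite Gr1 // mulr0 mul0r.
apply: eq_bigr => i _; rewrite [RHS]big_split_ord [X in _ = _ + X]big1 ?addr0; last first.
  by move=> j _; rewrite Gr1 // mulr0.
by apply: eq_bigr => j _; rewrite !Gl.
Qed.

(* Polarisation of the geodesic equation: this is where parallel transport along
   [N] is seen to preserve [TN]. *)
Lemma christoffel_normal c d y i j a : slice c d -> source d y ->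
  christoffel nabla c (lshift m i) (lshift m j) (rshift k a) (iota y) = 0.
Proof.
move=> cd sd; have [ac ad _ _] := cd; have sc := slice_source cd sd.
set C := fun i j => christoffel nabla c (lshift m i) (lshift m j) (rshift k a) (iota y).
have CC u v : C u v = C v u by exact: christoffelC.
have Q (w : 'rV[R]_k) : \sum_i \sum_j C i j * w 0 i * w 0 j = 0 := christoffel_quadratic a w cd sd.
have E (p q : 'I_k) : \sum_i \sum_j C i j * (i == p)%:R * (j == q)%:R = C p q.
  rewrite (bigD1 p) //= (bigD1 q) //= !eqxx !mulr1 !big1 ?addr0 //.
    by move=> u up; rewrite big1 // => v _; rewrite (negbTE up) mulr0 mul0r.
  by move=> v vq; rewrite (negbTE vq) mulr0.
have diag p : C p p = 0.
  rewrite -(E p p) -[RHS](Q (delta_mx 0 p)).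
  by apply: eq_bigr => u _; apply: eq_bigr => v _; rewrite !mxE !eqxx.
have := Q (delta_mx 0 i + delta_mx 0 j).
have -> : \sum_u \sum_v C u v * (delta_mx 0 i + delta_mx 0 j : 'rV[R]_k) 0 u
       * (delta_mx 0 i + delta_mx 0 j : 'rV[R]_k) 0 v =
   (C i i + C i j) + (C j i + C j j).
  rewrite -(E i i) -(E i j) -(E j i) -(E j j) -!big_split /=.
  by apply: eq_bigr => u _; rewrite -!big_split; apply: eq_bigr => v _; rewrite !mxE !eqxx /=; ring.
rewrite !diag add0r addr0 (CC j i) => /eqP; rewrite -mulr2n mulrn_eq0 /= => /eqP.
by [].
Qed.

(** At the point, [X] is a combination of tangential coordinate fields; their derivatives of a
    tangential field have no normal component by [christoffel_normal], and [b] kills the tangential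
    ones. Tensoriality makes the value of [X] at the point sufficient. *)
Lemma ann_nabla c d y j b U X (u : tvec N) : slice c d -> source d y -> ann y b ->
  open U -> U (iota y) -> vfield U X -> tangent y u -> X (iota y) = push y u ->
  b (nabla X (cvec c (lshift m j)) (iota y)) = 0.
Proof.
move=> cd sd ab oU Uy sX tu Xu; have [ac ad _ _] := cd; have sc := slice_source cd sd.
have oW : open (U `&` source c) by apply: openI => //; exact: open_source.
have WU := @subIsetl _ U (source c); have Wc := @subIsetr _ U (source c).
have Wy : (U `&` source c) (iota y) by [].
have sC i := vrestrict oW Wc (vfield_cvec i ac).
have sl i : smooth (U `&` source c) (fun=> u (coordf d i)).
  by move=> x _; exact: smooth_near_cst.
have sS := sheaf_sum (vfield_sheaf M) oW sl (fun i => sC (lshift m i)).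
have XE : X (iota y) = \sum_i u (coordf d i) *: cvec c (lshift m i) (iota y).
  by rewrite Xu (push_expand sub cd sd tu).
rewrite (nabla_eql conn oW Wy (vrestrict oW WU sX) sS (sC _) XE).
rewrite (tensorial_sum (vfield_sheaf M) (nabla_tensorial conn oW Wy (sC _)) oW Wy sl
  (fun i => sC (lshift m i))).
have [cb bz] := (annP sub b cd sd).1 ab.
rewrite (covec_sum cb); last first.
  by move=> i; apply: vfield_tangent Wy; exact: nabla_vfield.
rewrite big1 // => i _; rewrite (nabla_cvec conn _ _ ac sc) (covec_sum cb); last first.
  by move=> l; exact: tangent_cvec.
rewrite big_split_ord /= !big1 ?addr0 ?mulr0 // => l _.
  by rewrite (christoffel_normal _ _ _ cd sd) mul0r.
by rewrite bz mulr0.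
Qed.

(** [alpha] is constrained only at the points of [N] in [U], so that the notion restricts to smaller
    open sets and applies to products before these are known to be global sections. *)
Definition ann_extension U (at_ : M -> covec M) alpha : Prop :=
  [/\ open U, oneform U at_ &
      forall z, U (iota z) -> ann z (alpha z) /\ at_ (iota z) = alpha z].

Lemma ann_extension_ann U at_ alpha y : ann_extension U at_ alpha -> U (iota y) ->
  ann y (at_ (iota y)).
Proof. by move=> [_ _ E] /E[aa ->]. Qed.

Lemma ann_extension_restrict U U' at_ alpha : open U' -> U' `<=` U ->
  ann_extension U at_ alpha -> ann_extension U' at_ alpha.
Proof.
move=> oU' U'U [oU sa E]; split=> //; first exact: frestrict oU' U'U sa.
by move=> z /U'U; exact: E.
Qed.

Lemma anchorP y a : ann y a -> tangent y (anchor y a) /\ push y (anchor y a) = sharp h (iota y) a.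
Proof.
have [_ H] := co; move=> /H[u tu uE]; rewrite /ann_anchor.
set P := [set _ | _]; suff : P (xget 0 P) by [].
exact: (xgetPex 0 (ex_intro P u (conj tu uE))).
Qed.



(** Coisotropy: a^# is tangent to [N], and [b] annihilates such vectors. *)
Lemma ann_ann_h y a b : ann y a -> ann y b -> h (iota y) a b = 0.
Proof.
move=> aa [cb bz]; have [ta pa] := anchorP aa; have [ca _] := aa.
by rewrite -(sharpE bv ca cb) -pa bz.
Qed.

Lemma push_zero y (u : tvec N) f : tangent y u -> smooth_near f (iota y) ->
  {near y, f \o iota =1 cst 0} -> push y u f = 0.
Proof.
by move=> tu sf f0; rewrite (push_extension tu sf f0); exact: tangent_cst tu.
Qed.

Section Extensions.
Variables (U : set M) (at_ : M -> covec M) (alpha : N -> covec M) (y : N).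
Hypotheses (ea : ann_extension U at_ alpha) (Uy : U (iota y)).

Let oU : open U. Proof. by have [] := ea. Qed.
Let sa : oneform U at_. Proof. by have [] := ea. Qed.

Lemma near_extension : \forall z \near y, U (iota z).
Proof. by apply: (near_iota sub); exact: near_open. Qed.

(** Tested on a tangential coordinate field: its pairing with the form vanishes along [N] and is
    differentiated along [N], while the connection term is zero by [ann_nabla]. *)
Lemma ann_nabla_form X (u : tvec N) : vfield U X -> tangent y u -> X (iota y) = push y u ->
  ann y (nabla_form nabla X at_ (iota y)).
Proof.
move=> sX tu Xu; have [c [d [cd sc sd]]] := slice_exists sub y; have [ac ad _ _] := cd.
apply/(annP sub _ cd sd); split; first exact: cotangent_nabla_form sX sa.
move=> i; have oW : open (U `&` source c) by apply: openI => //; exact: open_source.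
have WU := @subIsetl _ U (source c); have Wc := @subIsetr _ U (source c).
have Wy : (U `&` source c) (iota y) by [].
have sC := vrestrict oW Wc (vfield_cvec (lshift m i) ac).
have sX' := vrestrict oW WU sX; have sa' := frestrict oW WU sa.
rewrite (nabla_formE conn oW Wy sX' sC sa').
rewrite (ann_nabla i cd sd (ann_extension_ann ea Uy) oW Wy sX' tu Xu) subr0 Xu.
apply: push_zero => //; first exact: (smooth_pairing oW sa' sC).
apply: filterS2 near_extension (near_source sd) => z Uz sz.
by rewrite /= /pairing; have [_ ->] := (annP sub _ cd sz).1 (ann_extension_ann ea Uz).
Qed.
End Extensions.

(** The identity h(alpha, beta) = 0 on [N] is differentiated along [N]; the derivatives of both
    forms stay in TN°, so all three terms are zero. *)
Lemma nabla_h_tangent U at_ bt alpha beta y X (u : tvec N) :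
  ann_extension U at_ alpha -> ann_extension U bt beta -> U (iota y) ->
  vfield U X -> tangent y u -> X (iota y) = push y u ->
  nabla_h nabla h X at_ bt (iota y) = 0.
Proof.
move=> ea eb Uy sX tu Xu; have [oU sa _] := ea; have [_ sb _] := eb.
rewrite /nabla_h (ann_ann_h (ann_nabla_form ea Uy sX tu Xu) (ann_extension_ann eb Uy)).
rewrite (ann_ann_h (ann_extension_ann ea Uy) (ann_nabla_form eb Uy sX tu Xu)) !subr0 Xu.
apply: push_zero => //; first exact: (smooth_bivector bv oU sa sb).
apply: filterS (near_extension ea Uy) => z Uz /=.
by apply: ann_ann_h; [exact: ann_extension_ann ea Uz|exact: ann_extension_ann eb Uz].
Qed.

(* Only the first and last terms involve the extensions, and they are tensorial. *)
Lemma contravariant_restrictE U at_ bt alpha beta y X :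
  ann_extension U at_ alpha -> ann_extension U bt beta -> U (iota y) -> vfield U X ->
  D at_ bt (iota y) (X (iota y)) = nabla_h nabla h X at_ bt (iota y)
    + (anchor y (alpha y) (fun z => beta z (X (iota z)))
       - beta y (nabla (sharp_form h at_) X (iota y))).
Proof.
move=> ea eb Uy sX; have [oU sa aE] := ea; have [_ sb bE] := eb.
have ssa := vfield_sharp bv oU sa.
rewrite (contravariantE bv conn oU Uy sX sa sb) (nabla_formE conn oU Uy ssa sX sb).
congr (_ + (_ - _)); last by have [_ ->] := bE y Uy.
have [aa atE] := aE y Uy; have [ta pa] := anchorP aa.
rewrite /sharp_form atE -pa; apply: push_extension => //.
  exact: (smooth_pairing oU sb sX).
apply: filterS (near_extension eb Uy) => z Uz /=.
by rewrite /pairing; have [_ ->] := bE z Uz.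
Qed.

(** Tested on tangential coordinate fields: the derivative of [h] vanishes by [nabla_h_tangent], the
    pairing of beta with the field is zero along [N], and [ann_nabla] applies because alpha^# is
    tangent to [N]. *)
Lemma ann_contravariant U at_ bt alpha beta y :
  ann_extension U at_ alpha -> ann_extension U bt beta -> U (iota y) ->
  ann y (D at_ bt (iota y)).
Proof.
move=> ea eb Uy; have [oU sa aE] := ea; have [_ sb bE] := eb.
have [c [d [cd sc sd]]] := slice_exists sub y; have [ac ad _ _] := cd.
apply/(annP sub _ cd sd); split.
  exact: oneform_cotangent (oneform_contravariant bv conn oU sa sb) Uy.
move=> i; have oW : open (U `&` source c) by apply: openI => //; exact: open_source.
have WU := @subIsetl _ U (source c); have Wc := @subIsetr _ U (source c).
have Wy : (U `&` source c) (iota y) by [].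
have {}ea := ann_extension_restrict oW WU ea; have {}eb := ann_extension_restrict oW WU eb.
have [_ sa' _] := ea; have [_ _ bE'] := eb.
have sC := vrestrict oW Wc (vfield_cvec (lshift m i) ac).
have ti := tangent_cvec i ad sd.
have [aa atE] := aE y Uy; have [ta pa] := anchorP aa.
rewrite (contravariant_restrictE ea eb Wy sC).
rewrite (nabla_h_tangent ea eb Wy sC ti (esym (push_cvec sub i cd sd))) add0r.
have [ab btE] := bE y Uy.
rewrite (ann_nabla (u := anchor y (alpha y)) i cd sd ab oW Wy (vfield_sharp bv oW sa')) //; last first.
  by rewrite /sharp_form atE pa.
rewrite subr0 (tangent_eq (g := cst 0) ta); first exact: tangent_cst ta.
apply: filterS2 (near_extension eb Wy) (near_source sd) => z Uz sz.
have [abz _] := bE' z Uz.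
by have [_ ->] := (annP sub _ cd sz).1 abz.
Qed.

Lemma contravariant_unique U U' at_ bt at' bt' alpha beta y :
  ann_extension U at_ alpha -> ann_extension U bt beta -> U (iota y) ->
  ann_extension U' at' alpha -> ann_extension U' bt' beta -> U' (iota y) ->
  D at_ bt (iota y) = D at' bt' (iota y).
Proof.
move=> ea eb Uy ea' eb' Uy'.
have [oU _ _] := ea; have [oU' _ _] := ea'.
have oW : open (U `&` U') by exact: openI.
have WU := @subIsetl _ U U'; have WU' := @subIsetr _ U U'.
have Wy : (U `&` U') (iota y) by [].
have {}ea := ann_extension_restrict oW WU ea; have {}eb := ann_extension_restrict oW WU eb.
have {}ea' := ann_extension_restrict oW WU' ea'; have {}eb' := ann_extension_restrict oW WU' eb'.
have [_ sa aE] := ea; have [_ sb bE] := eb; have [_ sa' aE'] := ea'; have [_ sb' bE'] := eb'.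
have aa : at_ (iota y) = at' (iota y) by have [_ ->] := aE y Wy; have [_ ->] := aE' y Wy.
have bb : bt (iota y) = bt' (iota y) by have [_ ->] := bE y Wy; have [_ ->] := bE' y Wy.
apply: cotangent_ext.
- exact: oneform_cotangent (oneform_contravariant bv conn oW sa sb) Wy.
- exact: oneform_cotangent (oneform_contravariant bv conn oW sa' sb') Wy.
move=> v tv; have sX := extend_vfield oW tv.
rewrite -(extend_val tv) (contravariant_restrictE ea eb Wy sX).
rewrite (contravariant_restrictE ea' eb' Wy sX).
rewrite (nabla_h_eq bv conn oW Wy sX sX sa sa' sb sb' erefl aa bb).
congr (_ + (_ - beta y _)); apply: (nabla_eql conn oW) => //.
- exact: vfield_sharp.
- exact: vfield_sharp.
- by rewrite /sharp_form aa.
Qed.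

(** Extensions are chosen separately at each point, so no global extension from [N] to [M] has to be
    built; [contravariant_unique] makes the choice harmless. *)
Definition bullet alpha beta : N -> covec M := fun y =>
  xget 0 [set v | exists U at_ bt, [/\ ann_extension U at_ alpha,
    ann_extension U bt beta, U (iota y) & v = D at_ bt (iota y)]].

Lemma bulletE U at_ bt alpha beta y :
  ann_extension U at_ alpha -> ann_extension U bt beta -> U (iota y) ->
  bullet alpha beta y = D at_ bt (iota y).
Proof.
move=> ea eb Uy; rewrite /bullet; set P := [set _ | _].
have : P (xget 0 P).
  by apply: (xgetPex 0); exists (D at_ bt (iota y)), U, at_, bt.
by move=> [U' [at' [bt' [ea' eb' Uy' ->]]]]; exact: contravariant_unique ea' eb' Uy' ea eb Uy.
Qed.

Lemma ann_extension_exists V alpha y : open V -> ann_section V alpha -> V y ->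
  exists U at_, [/\ ann_extension U at_ alpha, U (iota y) & forall z, U (iota z) -> V z].
Proof.
move=> oV sa Vy; have [U [at_ [oU Uy sat E]]] := ann_section_extend sub oV sa Vy.
exists U, at_; split=> //; last by move=> z /E[].
by split=> // z /E[Vz ->]; split=> //; have [aa _] := sa; exact: aa.
Qed.

Lemma ann_extension2 alpha beta y : ann_section setT alpha -> ann_section setT beta ->
  exists U at_ bt, [/\ ann_extension U at_ alpha, ann_extension U bt beta & U (iota y)].
Proof.
move=> sa sb; have [U [at_ [ea Uy _]]] := ann_extension_exists openT sa (y := y) Logic.I.
have [U' [bt [eb Uy' _]]] := ann_extension_exists openT sb (y := y) Logic.I.
have oW : open (U `&` U') by apply: openI; [have [] := ea|have [] := eb].
exists (U `&` U'), at_, bt; split=> //.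
  exact: ann_extension_restrict oW (@subIsetl _ U U') ea.
exact: ann_extension_restrict oW (@subIsetr _ U U') eb.
Qed.

Lemma ann_extension3 alpha beta gamma y :
  ann_section setT alpha -> ann_section setT beta -> ann_section setT gamma ->
  exists U at_ bt ct, [/\ ann_extension U at_ alpha, ann_extension U bt beta,
    ann_extension U ct gamma & U (iota y)].
Proof.
move=> sa sb sc; have [U [at_ [bt [ea eb Uy]]]] := ann_extension2 y sa sb.
have [U' [ct [ec Uy' _]]] := ann_extension_exists openT sc (y := y) Logic.I.
have oW : open (U `&` U') by apply: openI; [have [] := ea|have [] := ec].
exists (U `&` U'), at_, bt, ct; split=> //.
- exact: ann_extension_restrict oW (@subIsetl _ U U') ea.
- exact: ann_extension_restrict oW (@subIsetl _ U U') eb.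
- exact: ann_extension_restrict oW (@subIsetr _ U U') ec.
Qed.

(** This makes iterated products computable on [M]: the extension of the product lives on the same
    open set as those of the factors and can be fed to [bulletE] again. *)
Lemma bullet_extension U at_ bt alpha beta :
  ann_extension U at_ alpha -> ann_extension U bt beta ->
  ann_extension U (D at_ bt) (bullet alpha beta).
Proof.
move=> ea eb; have [oU sa _] := ea; have [_ sb _] := eb; split=> //.
  exact: oneform_contravariant.
by move=> z Uz; rewrite (bulletE ea eb Uz); split=> //; exact: ann_contravariant ea eb Uz.
Qed.

Lemma bullet_section alpha beta : ann_section setT alpha -> ann_section setT beta ->
  ann_section setT (bullet alpha beta).
Proof.
move=> sa sb; apply: (sheaf_glue (ann_section_sheaf iota)) openT _ => y _.
have [U [at_ [bt [ea eb Uy]]]] := ann_extension2 y sa sb.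
have eD := bullet_extension ea eb; have [oU sD DE] := eD.
have oV : open [set z | U (iota z)].
  by apply: open_nbhsP => z Uz; apply: (near_iota sub); exact: near_open.
exists [set z | U (iota z)]; split=> //.
apply: (sheaf_ext (ann_section_sheaf iota) oV (s := D at_ bt \o iota)).
  by move=> z Uz; have [_ E] := DE z Uz; exact: E.
apply: (oneform_ann_section sub oU sD) => z Uz; split=> //.
exact: ann_contravariant ea eb Uz.
Qed.

Lemma ann_extension_linear U g f at_ at' alpha alpha' : smooth U g ->
  (forall z, U (iota z) -> g (iota z) = f z) ->
  ann_extension U at_ alpha -> ann_extension U at' alpha' ->
  ann_extension U (fun x => g x *: at_ x + at' x) (fun z => f z *: alpha z + alpha' z).
Proof.
move=> sg gf [oU sa aE] [_ sa' aE']; split=> //.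
  exact: (sheaf_linear (oneform_sheaf M)).
move=> z Uz; have [aa ->] := aE z Uz; have [aa' ->] := aE' z Uz; rewrite gf //.
by split=> //; exact: annL.
Qed.

Lemma function_ann_extension3 f alpha beta gamma y : smooth setT f ->
  ann_section setT alpha -> ann_section setT beta -> ann_section setT gamma ->
  exists U g at_ bt ct, [/\ smooth U g /\ (forall z, U (iota z) -> g (iota z) = f z),
    ann_extension U at_ alpha, ann_extension U bt beta,
    ann_extension U ct gamma & U (iota y)].
Proof.
move=> sf sa sb sc; have [U [at_ [bt [ct [ea eb ec Uy]]]]] := ann_extension3 y sa sb sc.
have [U' [g [oU' Uy' sg gE]]] := function_extend sub y sf.
have oW : open (U `&` U') by apply: openI => //; have [] := ea.
exists (U `&` U'), g, at_, bt, ct; split=> //.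
- by split=> [|z [_ /gE]//]; exact: smooth_restrict (@subIsetr _ U U') sg.
- exact: ann_extension_restrict oW (@subIsetl _ U U') ea.
- exact: ann_extension_restrict oW (@subIsetl _ U U') eb.
- exact: ann_extension_restrict oW (@subIsetl _ U U') ec.
Qed.

Lemma bullet_linearl f alpha alpha' beta : smooth setT f ->
  ann_section setT alpha -> ann_section setT alpha' -> ann_section setT beta ->
  bullet (fun z => f z *: alpha z + alpha' z) beta =
  (fun z => f z *: bullet alpha beta z + bullet alpha' beta z).
Proof.
move=> sf sa sa' sb; apply/funext => y.
have [U [g [at_ [at' [bt [[sg gf] ea ea' eb Uy]]]]]] := function_ann_extension3 y sf sa sa' sb.
have [oU s1 _] := ea; have [_ s2 _] := ea'; have [_ s3 _] := eb.
rewrite (bulletE (ann_extension_linear sg gf ea ea') eb Uy).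
rewrite (contravariant_linearl bv conn oU Uy sg s1 s2 s3) gf //.
by rewrite -(bulletE ea eb Uy) -(bulletE ea' eb Uy).
Qed.

Lemma bullet_linearr f alpha beta beta' : smooth setT f ->
  ann_section setT alpha -> ann_section setT beta -> ann_section setT beta' ->
  bullet alpha (fun z => f z *: beta z + beta' z) =
  (fun z => f z *: bullet alpha beta z + bullet alpha beta' z
            + anchor z (alpha z) f *: beta z).
Proof.
move=> sf sa sb sb'; apply/funext => y.
have [U [g [at_ [bt [bt' [[sg gf] ea eb eb' Uy]]]]]] := function_ann_extension3 y sf sa sb sb'.
have [oU s1 aE] := ea; have [_ s2 bE] := eb; have [_ s3 _] := eb'.
rewrite (bulletE ea (ann_extension_linear sg gf eb eb') Uy).
rewrite (contravariant_linearr bv conn oU Uy sg s1 s2 s3) gf //.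
rewrite -(bulletE ea eb Uy) -(bulletE ea eb' Uy).
have [_ ->] := bE y Uy; congr (_ + _ *: _).
have [aa atE] := aE y Uy; have [ta pa] := anchorP aa.
rewrite /sharp_form atE -pa; apply: push_extension => //; first exact: sg.
by apply: filterS (near_extension ea Uy) => z; exact: gf.
Qed.

Lemma bullet_left_symmetric alpha beta gamma :
  ann_section setT alpha -> ann_section setT beta -> ann_section setT gamma ->
  ass bullet alpha beta gamma = ass bullet beta alpha gamma.
Proof.
move=> sa sb sc; apply/funext => y.
have [U [at_ [bt [ct [ea eb ec Uy]]]]] := ann_extension3 y sa sb sc.
have [oU s1 _] := ea; have [_ s2 _] := eb; have [_ s3 _] := ec.
rewrite /ass ![(_ - _) y]/(_ - _).
rewrite (bulletE (bullet_extension ea eb) ec Uy) (bulletE ea (bullet_extension eb ec) Uy).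
rewrite (bulletE (bullet_extension eb ea) ec Uy) (bulletE eb (bullet_extension ea ec) Uy).
exact: (contravariant_left_symmetric bv conn kveq tors flt oU Uy s1 s2 s3).
Qed.

(** Checked in [M], where [sharp] is linear, and brought back by the injectivity of [push]. *)
Lemma anchorL y r a b : ann y a -> ann y b ->
  anchor y (r *: a + b) = r *: anchor y a + anchor y b.
Proof.
move=> aa ab; have aab := annL r aa ab.
have [ta pa] := anchorP aa; have [tb pb] := anchorP ab; have [tab pab] := anchorP aab.
apply: (push_inj sub tab); first exact: tangentL.
by rewrite pab pushL pa pb; apply: sharpL => //; [case: aa|case: ab].
Qed.

Lemma anchor_vfield V alpha : open V -> ann_section V alpha ->
  vfield V (fun z => anchor z (alpha z)).
Proof.
move=> oV sa y Vy; have [aa _] := sa; have [ta pa] := anchorP (aa y Vy); split=> // f sf.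
have [U [at_ [ea Uy UV]]] := ann_extension_exists oV sa Vy.
have [c [d [cd sc sd]]] := slice_exists sub y.
(* [f] is known to be smooth only near [y]. It is extended along the retraction over the open set
   where it is smooth; differentiating the extension along alpha^# and restricting to [N] gives the
   derivative along the anchor. *)
pose O := [set z | smooth_near f z].
have oO : open O by apply: open_nbhsP => z; exact: smooth_near_near.
have oT := open_tube c d oO.
have sg : smooth (tube c d O) (fun x => f (retraction c d x)).
  by move=> x [sx tx Or]; exact: (smooth_retraction cd).
have [oU _ _] := ea; have oW : open (U `&` tube c d O) by exact: openI.
have {}ea := ann_extension_restrict oW (@subIsetl _ U _) ea; have [_ sat aE] := ea.
have {}sg := smooth_restrict (@subIsetr _ U (tube c d O)) sg.
have Wy : (U `&` tube c d O) (iota y) by split=> //; exact: tube_iota.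
have := smooth_pullback sub (smooth_act (vfield_sharp bv oW sat) sg Wy).
apply: smooth_near_eq; apply: filterS (near_extension ea Wy) => z Wz.
have [az atE] := aE z Wz; have [tz pz] := anchorP az.
rewrite /= /act /sharp_form atE -pz; apply: push_extension => //; first exact: sg.
apply: filterS (near_extension ea Wz) => w [_ /(tube_iotaP cd)[sw _]].
by rewrite /= (retraction_iota cd).
Qed.

Lemma contravariant_extension U at_ alpha : open U -> extends_form iota U at_ alpha ->
  (forall z, ann z (alpha z)) -> ann_extension U at_ alpha.
Proof. by move=> oU [sa aE] aa; split=> // z /aE. Qed.

Lemma bullet_restricted : restricted_contravariant iota nabla h bullet.
Proof.
move=> alpha beta sa sb y; have [aa _] := sa; have [ab _] := sb; split.
  have [U [at_ [bt [[oU s1 aE] [_ s2 bE] Uy]]]] := ann_extension2 y sa sb.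
  by exists U, at_, bt; split=> //; split=> // z Uz; [have [_ ->] := aE z Uz|have [_ ->] := bE z Uz].
move=> U at_ bt oU Uy ea eb; apply/esym; apply: bulletE Uy.
  by apply: contravariant_extension => // z; exact: aa.
by apply: contravariant_extension => // z; exact: ab.
Qed.

(** Additivity at 0 + 0. The laws for products with functions are read off the combined linearity by
    taking the second summand to be zero. *)
Lemma bullet0l beta : ann_section setT beta -> bullet (fun=> 0) beta = (fun=> 0).
Proof.
move=> sb; have s0 := sheaf_zero (ann_section_sheaf iota) openT.
have s1 : smooth setT (fun _ : N => 1) by move=> y _; exact: smooth_near_cst.
have := bullet_linearl (alpha := fun=> 0) (alpha' := fun=> 0) s1 s0 s0 sb.
have -> : (fun z : N => (1 : R) *: (0 : covec M) + 0) = (fun=> 0).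
  by apply/funext => z; rewrite scaler0 addr0.
move=> H; apply/funext => y; have /eqP := congr1 (fun f => f y) H.
by rewrite scale1r -subr_eq subrr eq_sym => /eqP.
Qed.

Lemma bullet0r alpha : ann_section setT alpha -> bullet alpha (fun=> 0) = (fun=> 0).
Proof.
move=> sa; have s0 := sheaf_zero (ann_section_sheaf iota) openT.
have s1 : smooth setT (fun _ : N => 1) by move=> y _; exact: smooth_near_cst.
have := bullet_linearr (beta := fun=> 0) (beta' := fun=> 0) s1 sa s0 s0.
have -> : (fun z : N => (1 : R) *: (0 : covec M) + 0) = (fun=> 0).
  by apply/funext => z; rewrite scaler0 addr0.
move=> H; apply/funext => y; have /eqP := congr1 (fun f => f y) H.
by rewrite scaler0 addr0 scale1r -subr_eq subrr eq_sym => /eqP.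
Qed.

Lemma bullet_algebroid : left_symmetric_algebroid ann ann_section anchor bullet.
Proof.
have s0 := sheaf_zero (ann_section_sheaf iota) openT.
have sr r : smooth setT (fun _ : N => r) by move=> y _; exact: smooth_near_cst.
split.
- exact: ann_vector_bundle.
- split=> [y a /anchorP[]//|y r a b|U s]; first exact: anchorL.
  exact: anchor_vfield.
- exact: bullet_section.
- by move=> r a a' b sa sa' sb; exact: (bullet_linearl (sr r) sa sa' sb).
- move=> r a b b' sa sb sb'; rewrite (bullet_linearr (sr r) sa sb sb').
  apply/funext => y; have [aa _] := sa; have [ta _] := anchorP (aa y Logic.I).
  by rewrite (tangent_cst r ta) scale0r addr0.
- move=> f a b sf sa sb; have := bullet_linearl sf sa s0 sb.
  rewrite bullet0l // => H; transitivity (bullet (fun z => f z *: a z + 0) b).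
    by congr (bullet _ b); apply/funext => y; rewrite addr0.
  by rewrite H; apply/funext => y; rewrite addr0.
- move=> f a b sf sa sb; have := bullet_linearr sf sa sb s0.
  rewrite bullet0r // => H; transitivity (bullet a (fun z => f z *: b z + 0)).
    by congr (bullet a _); apply/funext => y; rewrite addr0.
  by rewrite H; apply/funext => y; rewrite addr0.
- exact: bullet_left_symmetric.
Qed.

(** * The isotropy algebra at a point *)

Section Isotropy.
Variable y : N.
Notation g := (isotropy ann anchor y).

Lemma isotropy_subspace : subspace g.
Proof.
have A0 : anchor y 0 = 0.
  have := anchorL 1 (ann0 iota y) (ann0 iota y).
  by rewrite !scale1r addr0 => /eqP; rewrite -subr_eq subrr eq_sym => /eqP.
split; first by split=> //; exact: ann0.
move=> r a b [aa a0] [ab b0]; split; first exact: annL.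
by rewrite anchorL // a0 b0 scaler0 addr0.
Qed.

Definition value_section (a : covec M) : N -> covec M :=
  xget 0 [set s | ann_section setT s /\ s y = a].

Lemma value_sectionP a : ann y a -> ann_section setT (value_section a) /\ value_section a y = a.
Proof.
move=> aa; rewrite /value_section; set P := [set _ | _]; suff : P (xget 0 P) by [].
suff [s sP] : exists s, P s by exact: (xgetPex 0 (ex_intro P s sP)).
have [c [d [cd sc sd]]] := slice_exists sub y; have [ac ad _ _] := cd.
have oc := open_source d.
have sF j : ann_section (source d) (dform (coordf c (rshift k j)) \o iota).
  have sdf : oneform (source c) (dform (coordf c (rshift k j))).
    by apply: oneform_dform; exact: smooth_coordf.
  apply: (oneform_ann_section sub (open_source c) sdf) => z sz; split.
    exact: slice_source cd sz.
  exact: (dform_normal sub j cd sz).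
have sl j : smooth (source d) (fun=> a (cvec c (rshift k j) (iota y))).
  by move=> z _; exact: smooth_near_cst.
have [s ss sy] := sheaf_extend (ann_section_sheaf iota) oc sd
  (sheaf_sum (ann_section_sheaf iota) oc sl sF).
by exists s; split=> //; rewrite sy -(ann_expand sub cd sd aa).
Qed.

Definition isotropy_mul (a b : covec M) : covec M :=
  bullet (value_section a) (value_section b) y.

Lemma isotropy_sharp U at_ alpha : ann_extension U at_ alpha -> U (iota y) ->
  anchor y (alpha y) = 0 -> sharp_form h at_ (iota y) = 0.
Proof.
move=> [_ _ E] Uy a0; have [aa aE] := E y Uy; have [_ pa] := anchorP aa.
by rewrite /sharp_form aE -pa a0 push0.
Qed.

(** As alpha^# vanishes at the point, nabla_{alpha^#} beta drops out; what remains is tensorial in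
    both forms and symmetric. *)
Lemma bullet_isotropyE U at_ bt alpha beta X : ann_extension U at_ alpha ->
  ann_extension U bt beta -> U (iota y) -> vfield U X -> anchor y (alpha y) = 0 ->
  bullet alpha beta y (X (iota y)) = nabla_h nabla h X at_ bt (iota y).
Proof.
move=> ea eb Uy sX a0; rewrite (bulletE ea eb Uy).
have [oU s1 _] := ea; have [_ s2 _] := eb; have ss := vfield_sharp bv oU s1.
rewrite (contravariantE bv conn oU Uy sX s1 s2).
(* All three fields are alpha^#: since it vanishes at the point it equals -1 times itself plus
   itself there, so the covariant derivative A along it is - A + A. *)
rewrite (nabla_form_combl (r := -1) conn oU Uy ss ss ss s2); last first.
  by rewrite (isotropy_sharp ea Uy a0) scaler0 addr0.
by rewrite scaleN1r addNr addr0.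
Qed.

Lemma bullet_isotropy_eq alpha beta alpha' beta' :
  ann_section setT alpha -> ann_section setT beta ->
  ann_section setT alpha' -> ann_section setT beta' ->
  anchor y (alpha y) = 0 -> alpha y = alpha' y -> beta y = beta' y ->
  bullet alpha beta y = bullet alpha' beta' y.
Proof.
move=> sa sb sa' sb' a0 aa bb.
have [U [at_ [bt [at' [ea eb ea' Uy]]]]] := ann_extension3 y sa sb sa'.
have [U' [bt' [eb' Uy' _]]] := ann_extension_exists openT sb' (y := y) Logic.I.
have oW : open (U `&` U') by apply: openI; [have [] := ea|have [] := eb'].
have WU := @subIsetl _ U U'; have WU' := @subIsetr _ U U'.
have Wy : (U `&` U') (iota y) by [].
have {}ea := ann_extension_restrict oW WU ea; have {}eb := ann_extension_restrict oW WU eb.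
have {}ea' := ann_extension_restrict oW WU ea'; have {}eb' := ann_extension_restrict oW WU' eb'.
have [_ s1 aE] := ea; have [_ s2 bE] := eb; have [_ s3 aE'] := ea'; have [_ s4 bE'] := eb'.
apply: (cotangent_ext (x := iota y)).
- by have [] := (bullet_section sa sb).1 y Logic.I.
- by have [] := (bullet_section sa' sb').1 y Logic.I.
move=> v tv; have sX := extend_vfield oW tv.
rewrite -(extend_val tv) (bullet_isotropyE ea eb Wy sX a0).
rewrite (bullet_isotropyE ea' eb' Wy sX) -?aa //.
apply: (nabla_h_eq bv conn oW Wy sX sX s1 s3 s2 s4) => //.
  by have [_ ->] := aE y Wy; have [_ ->] := aE' y Wy.
by have [_ ->] := bE y Wy; have [_ ->] := bE' y Wy.
Qed.

Lemma bullet_isotropyC alpha beta : ann_section setT alpha -> ann_section setT beta ->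
  anchor y (alpha y) = 0 -> anchor y (beta y) = 0 ->
  bullet alpha beta y = bullet beta alpha y.
Proof.
move=> sa sb a0 b0; have [U [at_ [bt [ea eb Uy]]]] := ann_extension2 y sa sb.
have [oU s1 _] := ea; have [_ s2 _] := eb.
apply: (cotangent_ext (x := iota y)).
- by have [] := (bullet_section sa sb).1 y Logic.I.
- by have [] := (bullet_section sb sa).1 y Logic.I.
move=> v tv; have sX := extend_vfield oU tv.
rewrite -(extend_val tv) (bullet_isotropyE ea eb Uy sX a0).
by rewrite (bullet_isotropyE eb ea Uy sX b0) (nabla_hC bv conn oU).
Qed.

(** The sharp of the product is nabla_{alpha^#} beta^#, which is tensorial in alpha^# and vanishes
    with it. *)
Lemma anchor_bullet alpha beta : ann_section setT alpha -> ann_section setT beta ->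
  anchor y (alpha y) = 0 -> anchor y (bullet alpha beta y) = 0.
Proof.
move=> sa sb a0; have [U [at_ [bt [ea eb Uy]]]] := ann_extension2 y sa sb.
have [oU s1 _] := ea; have [_ s2 _] := eb.
have [tb pb] := anchorP ((bullet_section sa sb).1 y Logic.I).
apply: (push_inj sub tb); first exact: tangent0.
rewrite pb push0 (bulletE ea eb Uy) (sharp_contravariant bv conn kveq oU Uy s1 s2).
have ss := vfield_sharp bv oU s1; have st := vfield_sharp bv oU s2.
rewrite (nabla_combl (r := -1) conn oU Uy ss ss ss st); last first.
  by rewrite (isotropy_sharp ea Uy a0) scaler0 addr0.
by rewrite scaleN1r addNr.
Qed.

Lemma isotropy_mulE alpha beta : ann_section setT alpha -> ann_section setT beta ->
  anchor y (alpha y) = 0 -> isotropy_mul (alpha y) (beta y) = bullet alpha beta y.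
Proof.
move=> sa sb a0.
have [sv vE] := value_sectionP (sa.1 y Logic.I).
have [sw wE] := value_sectionP (sb.1 y Logic.I).
by apply: bullet_isotropy_eq => //; rewrite vE.
Qed.

Lemma isotropy_section a : g a -> exists2 s, ann_section setT s & s y = a.
Proof. by move=> [aa _]; have [] := value_sectionP aa; exists (value_section a). Qed.

Lemma isotropy_induced : induced_product ann ann_section anchor bullet y isotropy_mul.
Proof.
move=> a b ga gb; split.
  have [s ss sy] := isotropy_section ga; have [t st ty] := isotropy_section gb.
  by exists s, t.
by move=> s t ss st sy ty; rewrite -sy -ty isotropy_mulE // sy; have [] := ga.
Qed.

Lemma isotropy_algebra : commutative_associative_algebra g isotropy_mul.
Proof.
have A s : g (s y) -> anchor y (s y) = 0 by case.
have closed a b : g a -> g b -> g (isotropy_mul a b).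
  move=> ga gb; have [s ss sy] := isotropy_section ga; have [t st ty] := isotropy_section gb.
  rewrite -sy in ga *; rewrite -ty isotropy_mulE //; last exact: A.
  by split; [exact: (bullet_section ss st).1|apply: anchor_bullet => //; exact: A].
have comm a b : g a -> g b -> isotropy_mul a b = isotropy_mul b a.
  move=> ga gb; have [s ss sy] := isotropy_section ga; have [t st ty] := isotropy_section gb.
  rewrite -sy -ty in ga gb *; rewrite !isotropy_mulE //; try exact: A.
  by apply: bullet_isotropyC => //; exact: A.
(* Left symmetry loses its terms (ab)c and (ba)c by commutativity, leaving a(bc) = b(ac). *)
have swap a b (c : covec M) : g a -> g b -> g c ->
    isotropy_mul a (isotropy_mul b c) = isotropy_mul b (isotropy_mul a c).
  move=> ga gb gc; have [s ss sy] := isotropy_section ga.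
  have [t st ty] := isotropy_section gb; have [r sr ry] := isotropy_section gc.
  rewrite -sy -ty -ry in ga gb gc *.
  have as0 := A s ga; have at0 := A t gb.
  rewrite [isotropy_mul (t y) (r y)]isotropy_mulE // [isotropy_mul (s y) (r y)]isotropy_mulE //.
  rewrite !isotropy_mulE //; try exact: bullet_section.
  have := congr1 (fun f => f y) (bullet_left_symmetric ss st sr).
  rewrite /ass ![(_ - _) y]/(_ - _).
  (* The two inner products agree at [y] and lie in the kernel of the anchor there, so their
     products with [r] agree at [y]. *)
  rewrite (bullet_isotropy_eq (alpha := bullet s t) (alpha' := bullet t s) (beta' := r)) //;
    try exact: bullet_section.
  - by move=> /addrI/oppr_inj.
  - exact: anchor_bullet.
  - exact: bullet_isotropyC.
split=> //; first exact: isotropy_subspace.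
- move=> r a a' b ga ga' gb; have [s ss sy] := isotropy_section ga.
  have [s' ss' sy'] := isotropy_section ga'; have [t st ty] := isotropy_section gb.
  have [_ gL] := isotropy_subspace; have := gL r _ _ ga ga'.
  rewrite -sy -sy' -ty in ga ga' gb * => gr.
  have sr : smooth setT (fun _ : N => r) by move=> z _; exact: smooth_near_cst.
  have sl := sheaf_linear (ann_section_sheaf iota) openT sr ss ss'.
  have -> : isotropy_mul (r *: s y + s' y) (t y) = bullet (fun z => r *: s z + s' z) t y.
    by rewrite -(isotropy_mulE sl st) //; case: gr.
  by rewrite bullet_linearl // !isotropy_mulE //; exact: A.
(* (ab)c = c(ab) = a(cb) = a(bc), the middle equality being [swap]. *)
- move=> a b c ga gb gc; rewrite (comm (isotropy_mul a b) c) //; last exact: closed.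
  by rewrite (swap c a b) // (comm c b).
Qed.

End Isotropy.

End CoisotropicSubmanifold.

Theorem proposition7p7 (R : realType) (k m : nat)
    (M : manifold R (k + m)) (nabla : connection_op M)
    (h : M -> covec M -> covec M -> R)
    (N : manifold R k) (iota : N -> M) :
  kv_manifold nabla h ->
  coisotropic_kv_submanifold iota nabla h ->
  exists bullet : (N -> covec M) -> (N -> covec M) -> (N -> covec M),
    [/\ restricted_contravariant iota nabla h bullet,
        left_symmetric_algebroid (ann iota) (ann_section iota)
          (ann_anchor iota h) bullet
      & forall x : N, exists mul : covec M -> covec M -> covec M,
          induced_product (ann iota) (ann_section iota) (ann_anchor iota h)
            bullet x mul /\
          commutative_associative_algebra
            (isotropy (ann iota) (ann_anchor iota h) x) mul].
Proof.
move=> kv co; exists (bullet nabla h iota); split.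
- exact: bullet_restricted.
- exact: bullet_algebroid.
- move=> x; exists (isotropy_mul nabla h iota x); split.
    exact: isotropy_induced.
  exact: isotropy_algebra.
Qed.
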